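(* Let $G=Q_{28}$. There exists a projective $\mathbb{Z}G$-module $P$ such that $[P]$ does not have cancellation but $[P]/\mathrm{Aut}(G)$ has cancellation, where $\mathrm{Aut}(G)$ acts on $[P]$ by $\theta: P_0\mapsto(P_0)_\theta$.
   Context: $Q_{28}=\langle x,y\mid x^7=y^2, yxy^{-1}=x^{-1}\rangle$. For a projective $\mathbb{Z}G$-module $P$, $[P]$ is the set of isomorphism classes of projective $P_0$ with $P_0\oplus\mathbb{Z}G^i\cong P\oplus\mathbb{Z}G^j$ for some $i,j$; $(P_0)_\theta$ is $P_0$ with action twisted by $\theta$ (this preserves $[P]$ since $\mathrm{Aut}(Q_{28})$ acts trivially on the projective class group $C(\mathbb{Z}Q_{28})\cong\mathbb{Z}/2$). $[P]$ has cancellation if $P_1\oplus\mathbb{Z}G\cong P_2\oplus\mathbb{Z}G$ implies $P_1\cong P_2$ for $P_1,P_2\in[P]$; $[P]/\mathrm{Aut}(G)$ has cancellation if $P_1\oplus\mathbb{Z}G\cong P_2\oplus\mathbb{Z}G$ implies $P_1$ and $P_2$ lie in the same $\mathrm{Aut}(G)$-orbit. *)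

(* Defs.v *)
From HB Require Import structures.
From mathcomp Require Import all_boot all_order all_algebra all_fingroup.
Set Implicit Arguments. Unset Strict Implicit. Unset Printing Implicit Defensive.
Import GRing.Theory.

(* Finitely generated ZG-modules which are free as Z-modules ("ZG-lattices"),
   given by an integer matrix representation of G acting on column vectors
   of Z^ldim.  Every finitely generated projective ZG-module is of this form. *)
Record lattice (gT : finGroupType) := Lat {
  ldim : nat;
  lrep : gT -> 'M[int]_ldim }.

Section Lattices.
Variables (gT : finGroupType) (G : {group gT}).
Local Open Scope ring_scope.

Definition is_rep (M : lattice gT) : Prop :=
  lrep M 1%g = 1%:M /\
  {in G &, forall g h, lrep M (g * h)%g = lrep M g *m lrep M h}.

Definition lat_iso (M N : lattice gT) : Prop :=
  exists A : 'M[int]_(ldim N, ldim M), exists B : 'M[int]_(ldim M, ldim N),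
    [/\ A *m B = 1%:M, B *m A = 1%:M &
        {in G, forall g, A *m lrep M g = lrep N g *m A}].

Definition dsum (M N : lattice gT) : lattice gT :=
  @Lat gT (ldim M + ldim N)
      (fun g => block_mx (lrep M g) 0 0 (lrep N g)).

Definition zero_lat : lattice gT := @Lat gT 0 (fun _ => 1%:M).

(* The free module ZG of rank one (left regular representation, with the
   standard basis indexed by the elements of G). *)
Definition reg_lat : lattice gT :=
  @Lat gT #|G| (fun g => \matrix_(i, j)
      ((@enum_val gT (mem G) i == (g * @enum_val gT (mem G) j)%g)%:R : int)).

Fixpoint free_lat (k : nat) : lattice gT :=
  if k is k'.+1 then dsum (free_lat k') reg_lat else zero_lat.

Definition projective (P : lattice gT) : Prop :=
  is_rep P /\ exists Q : lattice gT, is_rep Q /\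
    exists k, lat_iso (dsum P Q) (free_lat k).

Definition in_stable_class (P P0 : lattice gT) : Prop :=
  projective P0 /\
  exists i j, lat_iso (dsum P0 (free_lat i)) (dsum P (free_lat j)).

Definition has_cancellation (P : lattice gT) : Prop :=
  forall P1 P2, in_stable_class P P1 -> in_stable_class P P2 ->
    lat_iso (dsum P1 reg_lat) (dsum P2 reg_lat) -> lat_iso P1 P2.

Definition twist (theta : {perm gT}) (M : lattice gT) : lattice gT :=
  @Lat gT (ldim M) (fun g => lrep M (theta g)).

Definition has_cancellation_mod_Aut (P : lattice gT) : Prop :=
  forall P1 P2, in_stable_class P P1 -> in_stable_class P P2 ->
    lat_iso (dsum P1 reg_lat) (dsum P2 reg_lat) ->
    exists2 theta, theta \in Aut G & lat_iso (twist theta P1) P2.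

End Lattices.

(* Main.v *)
Require Import Defs.
From HB Require Import structures.
From mathcomp Require Import all_boot all_order all_algebra all_fingroup.
From mathcomp Require Import ring lra zify realalg.
From Stdlib Require Import Classical ClassicalEpsilon.
Set Implicit Arguments. Unset Strict Implicit. Unset Printing Implicit Defensive.
Import Order.TTheory GRing.Theory Num.Theory.
Local Open Scope ring_scope.

(* Write R = Z[Q28] for the ring of pairs p(x) + q(x) y over Z[x]/(x^14 - 1).  Evaluating x at
   -zeta, -1, zeta, 1 (zeta a primitive 7th root of unity) embeds R in the product of an order Lam
   in a totally definite quaternion algebra, Z[i], a twisted group ring Alg contained in M_2, and
   Z[C2], as the set of quadruples satisfying congruences modulo 2 and modulo the primes over 7.
   P is the set of r whose Z[i]-component lies in (2 + i).  The automorphism x -> x, y -> xy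
   conjugates Z[i], so it carries P to the analogous P' for (2 - i).

   The residue ring of Lam at 7 is F49, and the units of Lam have image in F7* u F7* i, whereas an
   isomorphism P -> P' would require a unit with image in F7* (1 + i) {1, i}: so P and P' are not
   isomorphic.  A module M with M + R = P + R is isomorphic to a left ideal which is principal in
   each component (Lam is left principal); a determinant over Lam shows that the class of its
   Lam-generator in F49* / F7* {1, i} has square norm, which leaves two classes, those of P and P'.
   In rank at least two cancellation holds because finite quotients of R have stable rank one. *)

(** Of the four components only the totally definite [Lam] violates the Eichler condition, which is
    why cancellation fails there and only in rank one. The count of classes rests on ramification: 7
    is totally ramified in Z[c], so the cube of a residue is the norm mod 7, and two elements of
    equal norm have residues whose quotient has cube 1, a square of F7. In F49 the units modulo
    those of F7 form a cyclic group of order 8 where i has order 2, so the classes of square norm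
    modulo i form a group of order two. The prime 5 enters because it splits in Z[i] and (2 + i)^2 =
    3 + 4i lies in the nontrivial class.

    The hard point is that [Lam] is left principal. Everywhere a trace below 3 forces a norm below
    1, and the covering bound for Z[zeta] is 49/24. That makes Z[zeta] Euclidean, but twice 49/24
    exceeds 3, so rounding both coordinates of a quaternion does not give a division algorithm.
    Instead an element of minimal norm in the ideal is compared with the others: a second coordinate
    is first shown to be essentially a fraction over Z[c], and then made short enough, by units of
    Z[c], to fit into the remaining 23/24. *)

Record invol := Invol {
  inv_ring : comNzRingType;
  inv_conj : {rmorphism inv_ring -> inv_ring};
  inv_sq : inv_ring;
  inv_conjK : involutive inv_conj;
  inv_conj_sq : inv_conj inv_sq = inv_sq }.

(** A pair (a, b) stands for a + b j with j a = s(a) j and j^2 = t; associativity is where t being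
    fixed by s enters. The group ring, its four components, F49 and the residue rings at 2 are all
    instances, so that the maps between them come from maps of base rings ([imorph]). *)
Definition tw (D : invol) := (inv_ring D * inv_ring D)%type.

Section Twisted.
Variable D : invol.
Local Notation C := (inv_ring D).
Local Notation s := (@inv_conj D).
Local Notation t := (inv_sq D).

HB.instance Definition _ := GRing.Zmodule.copy (tw D) (C * C)%type.

Definition tw_one : tw D := (1, 0).
Definition tw_mul (u v : tw D) : tw D :=
  (u.1 * v.1 + u.2 * s v.2 * t, u.1 * v.2 + u.2 * s v.1).

Fact tw_mulA : associative tw_mul.
Proof.
move=> [a b] [a' b'] [a2 b2]; rewrite /tw_mul /=.
rewrite !rmorphD !rmorphM /= !inv_conjK inv_conj_sq.
by apply: injective_projections => /=; ring.
Qed.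
Fact tw_mul1 : left_id tw_one tw_mul.
Proof. by move=> [a b]; rewrite /tw_mul /=; apply: injective_projections => /=; ring. Qed.
Fact tw_mulr1 : right_id tw_one tw_mul.
Proof. by move=> [a b]; rewrite /tw_mul /= rmorph0 rmorph1; apply: injective_projections => /=; ring. Qed.
Fact tw_mulDl : left_distributive tw_mul +%R.
Proof. by move=> [a b] [a' b'] [a2 b2]; rewrite /tw_mul /tw_one /=; apply: injective_projections => /=; ring. Qed.
Fact tw_mulDr : right_distributive tw_mul +%R.
Proof.
by move=> [a b] [a' b'] [a2 b2]; rewrite /tw_mul /= !rmorphD; apply: injective_projections => /=; ring.
Qed.
Fact tw_one_neq0 : tw_one != 0.
Proof. by rewrite xpair_eqE oner_eq0. Qed.

HB.instance Definition _ := GRing.Zmodule_isNzRing.Build (tw D)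
  tw_mulA tw_mul1 tw_mulr1 tw_mulDl tw_mulDr tw_one_neq0.

Lemma twE (u v : tw D) :
  u * v = (u.1 * v.1 + u.2 * s v.2 * t, u.1 * v.2 + u.2 * s v.1).
Proof. by []. Qed.

Definition twC (a : C) : tw D := (a, 0).

Fact twC_additive : {morph twC : a b / a - b}.
Proof. by move=> a b; rewrite /twC; apply: injective_projections; rewrite /= ?subrr. Qed.
Fact twC_multiplicative : monoid_morphism twC.
Proof.
by split=> // a b; apply: injective_projections; rewrite /twC twE /=; ring.
Qed.
HB.instance Definition _ := GRing.isZmodMorphism.Build C (tw D) twC twC_additive.
HB.instance Definition _ := GRing.isMonoidMorphism.Build C (tw D) twC twC_multiplicative.

End Twisted.

Record imorph (D D' : invol) := IMorph {
  im_fun : {rmorphism inv_ring D -> inv_ring D'};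
  im_conj : forall a, im_fun (inv_conj D a) = inv_conj D' (im_fun a);
  im_sq : im_fun (inv_sq D) = inv_sq D' }.

Definition twmap D D' (f : imorph D D') (u : tw D) : tw D' :=
  (im_fun f u.1, im_fun f u.2).

Section TwMap.
Variables (D D' : invol) (f : imorph D D').
Fact twmap_additive : {morph twmap f : a b / a - b}.
Proof. by move=> [a b] [a' b']; rewrite /twmap /= !rmorphB. Qed.
Fact twmap_multiplicative : monoid_morphism (twmap f).
Proof.
split=> [|[a b] [a' b']]; first by rewrite /twmap /= rmorph1 rmorph0.
by rewrite /twmap !twE /= !(rmorphD, rmorphM) /= !im_conj im_sq.
Qed.
HB.instance Definition _ := GRing.isZmodMorphism.Build _ _ (twmap f) twmap_additive.
HB.instance Definition _ := GRing.isMonoidMorphism.Build _ _ (twmap f) twmap_multiplicative.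
End TwMap.

(** * The group algebra of the cyclic group of order 14 *)

Definition cyc (F : comNzRingType) := {ffun 'I_14 -> F}.

Section Cyclic.
Variable F : comNzRingType.
HB.instance Definition _ := GRing.Zmodule.copy (cyc F) {ffun 'I_14 -> F}.

Definition cyc_one : cyc F := [ffun i => (i == 0)%:R].
Definition cyc_mul (u v : cyc F) : cyc F :=
  [ffun k => \sum_(i < 14) u i * v (k - i)].

Fact cyc_mulC : commutative cyc_mul.
Proof.
move=> u v; apply/ffunP=> k; rewrite !ffunE.
rewrite (reindex_inj (inj_comp (addrI k) oppr_inj)) /=.
by apply: eq_bigr => i _; rewrite opprB addrCA subrr addr0 mulrC.
Qed.
Fact cyc_mulA : associative cyc_mul.
Proof.
move=> u v w; apply/ffunP=> k; rewrite !ffunE.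
transitivity (\sum_(i < 14) \sum_(j < 14) u i * (v (j - i) * w (k - j))).
  apply: eq_bigr => i _; rewrite ffunE big_distrr /=.
  rewrite (reindex_inj (addIr (- i))) /=; apply: eq_bigr => j _.
  by rewrite opprB addrA subrK.
rewrite exchange_big; apply: eq_bigr => j _; rewrite ffunE big_distrl /=.
by apply: eq_bigr => i _; rewrite mulrA.
Qed.
Fact cyc_mul1 : left_id cyc_one cyc_mul.
Proof.
move=> u; apply/ffunP=> k; rewrite !ffunE (bigD1 0) //= big1 => [|i /negPf n0].
  by rewrite ffunE eqxx mul1r subr0 addr0.
by rewrite ffunE n0 mul0r.
Qed.
Fact cyc_mulDl : left_distributive cyc_mul +%R.
Proof.
move=> u v w; apply/ffunP=> k; rewrite !ffunE -big_split /=.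
by apply: eq_bigr => i _; rewrite ffunE mulrDl.
Qed.
Fact cyc_one_neq0 : cyc_one != 0.
Proof.
apply/eqP=> /ffunP/(_ 0); rewrite !ffunE eqxx => /eqP.
by rewrite oner_eq0.
Qed.
HB.instance Definition _ := GRing.Zmodule_isComNzRing.Build (cyc F)
  cyc_mulA cyc_mulC cyc_mul1 cyc_mulDl cyc_one_neq0.

Definition cycX : cyc F := [ffun i => (i == 1)%:R].

Lemma cycXn (n : nat) : cycX ^+ n = [ffun i => (i == n%:R)%:R].
Proof.
elim: n => [|n IHn]; first by [].
rewrite exprS IHn; apply/ffunP=> k; rewrite !ffunE (bigD1 1) //= big1 => [|i /negPf n0].
  by rewrite !ffunE eqxx mul1r addr0 subr_eq -natr1.
by rewrite ffunE n0 mul0r.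
Qed.

Lemma cycX14 : cycX ^+ 14 = 1.
Proof. by rewrite cycXn; apply/ffunP=> i; rewrite !ffunE. Qed.

End Cyclic.

Section CycEval.
Variables (S : pzRingType) (s : S).
Hypothesis s14 : s ^+ 14 = 1.

Let expz (i j : 'I_14) : s ^+ (i + j)%R = s ^+ i * s ^+ j.
Proof.
by rewrite -exprD /= [in RHS](divn_eq (i + j) 14) exprD mulnC exprM s14 expr1n mul1r.
Qed.

(** The equation is an argument so that a ring morphism structure can be attached to the term
    [cyc_ev s14]. *)
Definition cyc_ev & s ^+ 14 = 1 := fun u : cyc int => \sum_(i < 14) s ^+ i *~ u i.

Fact cyc_ev_additive : {morph cyc_ev s14 : a b / a - b}.
Proof.
move=> a b; rewrite /cyc_ev -sumrB; apply: eq_bigr => i _.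
by rewrite !ffunE mulrzBr.
Qed.
Fact cyc_ev_multiplicative : monoid_morphism (cyc_ev s14).
Proof.
split=> [|a b].
  rewrite /cyc_ev (bigD1 0) //= big1 => [|i /negPf n0]; first by rewrite ffunE addr0 mulr1z.
  by rewrite ffunE n0.
rewrite /cyc_ev.
transitivity (\sum_(i < 14) \sum_(j < 14) s ^+ j *~ (a i * b (j - i))).
  rewrite exchange_big; apply: eq_bigr => j _; rewrite ffunE.
  by rewrite mulrz_sumr.
rewrite big_distrl; apply: eq_bigr => i _; rewrite big_distrr /=.
rewrite (reindex_inj (addIr i)); apply: eq_bigr => j _.
by rewrite addrK expz -!exprD [in LHS]addnC exprD mulrzAl mulrzAr -mulrzA mulrC.
Qed.
HB.instance Definition _ := GRing.isZmodMorphism.Build _ _ (cyc_ev s14) cyc_ev_additive.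
HB.instance Definition _ := GRing.isMonoidMorphism.Build _ _ (cyc_ev s14) cyc_ev_multiplicative.

Lemma cyc_evX : cyc_ev s14 (cycX int) = s.
Proof.
rewrite /cyc_ev (bigD1 1) //= big1 => [|i /negPf n0]; first by rewrite ffunE addr0 mulr1z.
by rewrite ffunE n0.
Qed.
End CycEval.

Lemma cyc_sum (u : cyc int) : u = \sum_(i < 14) cycX int ^+ i *~ u i.
Proof.
apply/ffunP => k; rewrite sum_ffunE.
have E (i : 'I_14) : (cycX int ^+ i *~ u i) k = u i *+ (k == i).
  by rewrite ffunMzE cycXn ffunE Zp_nat valZpK;
  case: (k == i); rewrite ?mul0rz // -mulrzl intz mulr1.
rewrite (bigD1 k) //= E eqxx big1 ?addr0 // => i nk.
by rewrite E eq_sym (negPf nk).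
Qed.

Lemma cyc_morph_eq (S : pzRingType) (f g : {rmorphism cyc int -> S}) :
  f (cycX int) = g (cycX int) -> f =1 g.
Proof.
move=> fg u; rewrite (cyc_sum u) !rmorph_sum; apply: eq_bigr => i _.
by rewrite !rmorphMz !rmorphXn fg.
Qed.

(** * The cubic ring F[c], c^3 + c^2 - 2c - 1 = 0, and F[c][zeta] *)

Definition OK (F : comNzRingType) := (F * F * F)%type.

Section CubicRing.
Variable F : comNzRingType.
HB.instance Definition _ := GRing.Zmodule.copy (OK F) (F * F * F)%type.
Implicit Types a b : OK F.

Definition mkK (r0 r1 r2 : F) : OK F := (r0, r1, r2).
Definition K0 a : F := a.1.1.
Definition K1 a : F := a.1.2.
Definition K2 a : F := a.2.

Lemma K_ext a b : K0 a = K0 b -> K1 a = K1 b -> K2 a = K2 b -> a = b.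
Proof. by case: a b => [[? ?] ?] [[? ?] ?]; rewrite /K0 /K1 /K2 /= => -> -> ->. Qed.

Definition K_one : OK F := mkK 1 0 0.
(** Coordinates in the basis 1, c, c^2, reduced by c^3 = 1 + 2c - c^2 and c^4 = -1 - c + 3c^2. Here
    c is zeta + zeta^-1. *)
Definition K_mul a b : OK F :=
  mkK (K0 a * K0 b + (K1 a * K2 b + K2 a * K1 b) - K2 a * K2 b)
      (K0 a * K1 b + K1 a * K0 b + (K1 a * K2 b + K2 a * K1 b) *+ 2 - K2 a * K2 b)
      (K0 a * K2 b + K1 a * K1 b + K2 a * K0 b - (K1 a * K2 b + K2 a * K1 b)
        + (K2 a * K2 b) *+ 3).

Fact K_mulA : associative K_mul.
Proof.
by move=> [[a0 a1] a2] [[b0 b1] b2] [[c0 c1] c2]; apply: K_ext;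
  rewrite /K_mul /mkK /K0 /K1 /K2 /=; ring.
Qed.
Fact K_mulC : commutative K_mul.
Proof.
by move=> [[a0 a1] a2] [[b0 b1] b2]; apply: K_ext;
  rewrite /K_mul /mkK /K0 /K1 /K2 /=; ring.
Qed.
Fact K_mul1 : left_id K_one K_mul.
Proof.
by move=> [[a0 a1] a2]; apply: K_ext; rewrite /K_mul /K_one /mkK /K0 /K1 /K2 /=; ring.
Qed.
Fact K_mulDl : left_distributive K_mul +%R.
Proof.
by move=> [[a0 a1] a2] [[b0 b1] b2] [[c0 c1] c2]; apply: K_ext;
  rewrite /K_mul /mkK /K0 /K1 /K2 /=; ring.
Qed.
Fact K_one_neq0 : K_one != 0.
Proof. by rewrite !xpair_eqE oner_eq0. Qed.
HB.instance Definition _ := GRing.Zmodule_isComNzRing.Build (OK F)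
  K_mulA K_mulC K_mul1 K_mulDl K_one_neq0.

Lemma K0M a b : K0 (a * b) = K0 a * K0 b + (K1 a * K2 b + K2 a * K1 b) - K2 a * K2 b.
Proof. by []. Qed.
Lemma K1M a b : K1 (a * b) =
  K0 a * K1 b + K1 a * K0 b + (K1 a * K2 b + K2 a * K1 b) *+ 2 - K2 a * K2 b.
Proof. by []. Qed.
Lemma K2M a b : K2 (a * b) = K0 a * K2 b + K1 a * K1 b + K2 a * K0 b
  - (K1 a * K2 b + K2 a * K1 b) + (K2 a * K2 b) *+ 3.
Proof. by []. Qed.
Lemma K0D a b : K0 (a + b) = K0 a + K0 b. Proof. by []. Qed.
Lemma K1D a b : K1 (a + b) = K1 a + K1 b. Proof. by []. Qed.
Lemma K2D a b : K2 (a + b) = K2 a + K2 b. Proof. by []. Qed.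
Lemma K0N a : K0 (- a) = - K0 a. Proof. by []. Qed.
Lemma K1N a : K1 (- a) = - K1 a. Proof. by []. Qed.
Lemma K2N a : K2 (- a) = - K2 a. Proof. by []. Qed.
Lemma K0_1 : K0 1 = 1. Proof. by []. Qed.
Lemma K1_1 : K1 1 = 0. Proof. by []. Qed.
Lemma K2_1 : K2 1 = 0. Proof. by []. Qed.
Lemma K0_0 : K0 0 = 0. Proof. by []. Qed.
Lemma K1_0 : K1 0 = 0. Proof. by []. Qed.
Lemma K2_0 : K2 0 = 0. Proof. by []. Qed.
Lemma K0mk r0 r1 r2 : K0 (mkK r0 r1 r2) = r0. Proof. by []. Qed.
Lemma K1mk r0 r1 r2 : K1 (mkK r0 r1 r2) = r1. Proof. by []. Qed.
Lemma K2mk r0 r1 r2 : K2 (mkK r0 r1 r2) = r2. Proof. by []. Qed.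
Definition KE := (K0M, K1M, K2M, K0D, K1D, K2D, K0N, K1N, K2N, K0_1, K1_1, K2_1,
  K0_0, K1_0, K2_0, K0mk, K1mk, K2mk).

HB.instance Definition _ := GRing.isZmodMorphism.Build (OK F) F K0 (fun _ _ => erefl).
HB.instance Definition _ := GRing.isZmodMorphism.Build (OK F) F K1 (fun _ _ => erefl).
HB.instance Definition _ := GRing.isZmodMorphism.Build (OK F) F K2 (fun _ _ => erefl).

Definition Kc : OK F := mkK 0 1 0.
Definition KC (r : F) : OK F := mkK r 0 0.
Fact KC_additive : {morph KC : a b / a - b}.
Proof. by move=> a b; apply: K_ext; rewrite /KC !KE; ring. Qed.
Fact KC_multiplicative : monoid_morphism KC.
Proof. by split=> // a b; apply: K_ext; rewrite /KC !KE; ring. Qed.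
HB.instance Definition _ := GRing.isZmodMorphism.Build _ _ KC KC_additive.
HB.instance Definition _ := GRing.isMonoidMorphism.Build _ _ KC KC_multiplicative.

Lemma KcE : Kc ^+ 3 = - Kc ^+ 2 + Kc *+ 2 + 1.
Proof. by apply: K_ext; rewrite !exprS expr0 mulr2n !KE; ring. Qed.

Lemma K_sum a : a = KC (K0 a) + KC (K1 a) * Kc + KC (K2 a) * Kc ^+ 2.
Proof. by apply: K_ext; rewrite expr2 /KC /Kc !KE; ring. Qed.

(** The Galois generator c -> c^2 - 2, induced by zeta -> zeta^2. *)
Definition Kgal a : OK F := mkK (K0 a - K1 a *+ 2 + K2 a *+ 3) (- K2 a) (K1 a - K2 a).
Fact Kgal_additive : {morph Kgal : a b / a - b}.
Proof. by move=> a b; apply: K_ext; rewrite /Kgal !KE; ring. Qed.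
Fact Kgal_multiplicative : monoid_morphism Kgal.
Proof. by split=> [|a b]; apply: K_ext; rewrite /Kgal !KE; ring. Qed.
HB.instance Definition _ := GRing.isZmodMorphism.Build _ _ Kgal Kgal_additive.
HB.instance Definition _ := GRing.isMonoidMorphism.Build _ _ Kgal Kgal_multiplicative.

(** The determinant of multiplication by a, expanded along a row: the norm. [KT] is the trace, the
    basis having traces 3, -1, 5. *)
Definition KN a : F :=
  K0 a * ((K0 a + K2 a *+ 2) * (K0 a - K1 a + K2 a *+ 3) - (K1 a - K2 a) * (K1 a *+ 2 - K2 a))
  - K1 a * (K2 a * (K0 a - K1 a + K2 a *+ 3) - (K1 a - K2 a) ^+ 2)
  + K2 a * (K2 a * (K1 a *+ 2 - K2 a) - (K0 a + K2 a *+ 2) * (K1 a - K2 a)).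
Definition KT a : F := K0 a *+ 3 - K1 a + K2 a *+ 5.
Definition Kcof a : OK F := Kgal a * Kgal (Kgal a).

Lemma KNM a b : KN (a * b) = KN a * KN b.
Proof. by rewrite /KN !KE; ring. Qed.
Lemma KN1 : KN 1 = 1.
Proof. by rewrite /KN !KE; ring. Qed.
Lemma KN_C r : KN (KC r) = r ^+ 3.
Proof. by rewrite /KN /KC !KE; ring. Qed.
Lemma Kcof_mul a : a * Kcof a = KC (KN a).
Proof. by apply: K_ext; rewrite /Kcof /Kgal /KC /KN !KE; ring. Qed.
Lemma KTD a b : KT (a + b) = KT a + KT b.
Proof. by rewrite /KT !KE; ring. Qed.
Lemma KTZ r a : KT (KC r * a) = r * KT a.
Proof. by rewrite /KT /KC !KE; ring. Qed.
Lemma KT_C r : KT (KC r) = r *+ 3.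
Proof. by rewrite /KT /KC !KE; ring. Qed.

End CubicRing.

Arguments Kc {F}.

Definition OL (F : comNzRingType) := (OK F * OK F)%type.

Section SexticRing.
Variable F : comNzRingType.
HB.instance Definition _ := GRing.Zmodule.copy (OL F) (OK F * OK F)%type.
Implicit Types a b : OL F.

Definition mkL (u v : OK F) : OL F := (u, v).
Definition L0 a : OK F := a.1.
Definition L1 a : OK F := a.2.
Lemma L_ext a b : L0 a = L0 b -> L1 a = L1 b -> a = b.
Proof. by case: a b => [? ?] [? ?]; rewrite /L0 /L1 /= => -> ->. Qed.

Definition L_one : OL F := mkL 1 0.
(** Coordinates in the basis 1, zeta over F[c], reduced by zeta^2 = c zeta - 1. *)
Definition L_mul a b : OL F :=
  mkL (L0 a * L0 b - L1 a * L1 b) (L0 a * L1 b + L1 a * L0 b + Kc * (L1 a * L1 b)).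
Fact L_mulA : associative L_mul.
Proof.
by move=> [a0 a1] [b0 b1] [c0 c1]; apply: L_ext; rewrite /L_mul /mkL /L0 /L1 /=; ring.
Qed.
Fact L_mulC : commutative L_mul.
Proof. by move=> [a0 a1] [b0 b1]; apply: L_ext; rewrite /L_mul /mkL /L0 /L1 /=; ring. Qed.
Fact L_mul1 : left_id L_one L_mul.
Proof. by move=> [a0 a1]; apply: L_ext; rewrite /L_mul /L_one /mkL /L0 /L1 /=; ring. Qed.
Fact L_mulDl : left_distributive L_mul +%R.
Proof.
by move=> [a0 a1] [b0 b1] [c0 c1]; apply: L_ext; rewrite /L_mul /mkL /L0 /L1 /=; ring.
Qed.
Fact L_one_neq0 : L_one != 0.
Proof. by rewrite xpair_eqE oner_eq0. Qed.
HB.instance Definition _ := GRing.Zmodule_isComNzRing.Build (OL F)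
  L_mulA L_mulC L_mul1 L_mulDl L_one_neq0.

Lemma L0M a b : L0 (a * b) = L0 a * L0 b - L1 a * L1 b. Proof. by []. Qed.
Lemma L1M a b : L1 (a * b) = L0 a * L1 b + L1 a * L0 b + Kc * (L1 a * L1 b).
Proof. by []. Qed.
Lemma L0D a b : L0 (a + b) = L0 a + L0 b. Proof. by []. Qed.
Lemma L1D a b : L1 (a + b) = L1 a + L1 b. Proof. by []. Qed.
Lemma L0N a : L0 (- a) = - L0 a. Proof. by []. Qed.
Lemma L1N a : L1 (- a) = - L1 a. Proof. by []. Qed.
Lemma L0_1 : L0 1 = 1. Proof. by []. Qed.
Lemma L1_1 : L1 1 = 0. Proof. by []. Qed.
Lemma L0_0 : L0 0 = 0. Proof. by []. Qed.
Lemma L1_0 : L1 0 = 0. Proof. by []. Qed.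
Lemma L0mk u v : L0 (mkL u v) = u. Proof. by []. Qed.
Lemma L1mk u v : L1 (mkL u v) = v. Proof. by []. Qed.
Definition LE := (L0M, L1M, L0D, L1D, L0N, L1N, L0_1, L1_1, L0_0, L1_0, L0mk, L1mk).

HB.instance Definition _ := GRing.isZmodMorphism.Build (OL F) (OK F) L0 (fun _ _ => erefl).
HB.instance Definition _ := GRing.isZmodMorphism.Build (OL F) (OK F) L1 (fun _ _ => erefl).

Definition LC (r : OK F) : OL F := mkL r 0.
Fact LC_additive : {morph LC : a b / a - b}.
Proof. by move=> a b; apply: L_ext; rewrite /LC !LE; ring. Qed.
Fact LC_multiplicative : monoid_morphism LC.
Proof. by split=> // a b; apply: L_ext; rewrite /LC !LE; ring. Qed.
HB.instance Definition _ := GRing.isZmodMorphism.Build _ _ LC LC_additive.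
HB.instance Definition _ := GRing.isMonoidMorphism.Build _ _ LC LC_multiplicative.

Definition Lz : OL F := mkL 0 1.
Definition Lconj a : OL F := mkL (L0 a + Kc * L1 a) (- L1 a).
Fact Lconj_additive : {morph Lconj : a b / a - b}.
Proof. by move=> a b; apply: L_ext; rewrite /Lconj !LE; ring. Qed.
Fact Lconj_multiplicative : monoid_morphism Lconj.
Proof. by split=> [|a b]; apply: L_ext; rewrite /Lconj !LE; ring. Qed.
HB.instance Definition _ := GRing.isZmodMorphism.Build _ _ Lconj Lconj_additive.
HB.instance Definition _ := GRing.isMonoidMorphism.Build _ _ Lconj Lconj_multiplicative.
Lemma LconjK : involutive Lconj.
Proof. by move=> a; apply: L_ext; rewrite /Lconj !LE; ring. Qed.
Lemma Lconj_C r : Lconj (LC r) = LC r.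
Proof. by apply: L_ext; rewrite /Lconj /LC !LE; ring. Qed.

Definition Lnorm a : OK F := L0 a ^+ 2 + Kc * L0 a * L1 a + L1 a ^+ 2.
Lemma Lnorm_conj a : a * Lconj a = LC (Lnorm a).
Proof. by apply: L_ext; rewrite /Lnorm /Lconj /LC !LE; ring. Qed.
Lemma LnormM a b : Lnorm (a * b) = Lnorm a * Lnorm b.
Proof. by rewrite /Lnorm !LE; ring. Qed.
Lemma Lnorm1 : Lnorm 1 = 1.
Proof. by rewrite /Lnorm !LE; ring. Qed.
Lemma Lnorm_C r : Lnorm (LC r) = r ^+ 2.
Proof. by rewrite /Lnorm /LC !LE; ring. Qed.

Lemma LzE : Lz ^+ 2 = LC Kc * Lz - 1.
Proof. by apply: L_ext; rewrite /Lz /LC expr2 !LE; ring. Qed.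
Lemma Lz_conj : Lz * Lconj Lz = 1.
Proof. by rewrite Lnorm_conj; apply: L_ext; rewrite /Lnorm /LC /Lz !LE; ring. Qed.

Lemma Lz7 : Lz ^+ 7 = 1.
Proof.
have z3 : Lz ^+ 3 = mkL (- Kc) (Kc ^+ 2 - 1).
  by rewrite exprSr LzE; apply: L_ext; rewrite /Lz /LC !LE; ring.
have c0 (a : OK F) : a * (Kc ^+ 3 - (- Kc ^+ 2 + Kc *+ 2 + 1)) = 0.
  by rewrite KcE subrr mulr0.
rewrite -[7%N]/(3 + 3 + 1)%N !exprD z3 expr1 -Lz_conj mulrC; congr (_ * _).
(* What remains is zeta^6 = conj zeta. Both coordinates of the difference are multiples of the cubic
   relation for c, with cofactors 1 - c and c^2 - c - 1. *)
apply: L_ext; rewrite /Lconj /Lz !LE; apply/eqP; rewrite -subr_eq0; apply/eqP.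
  by rewrite -[RHS](c0 (1 - Kc)); ring.
by rewrite -[RHS](c0 (Kc ^+ 2 - Kc - 1)); ring.
Qed.

Lemma L_sum a : a = LC (L0 a) + LC (L1 a) * Lz.
Proof. by apply: L_ext; rewrite /LC /Lz !LE; ring. Qed.
Lemma LcE : LC Kc = Lz + Lconj Lz.
Proof. by apply: L_ext; rewrite /LC /Lconj /Lz !LE; ring. Qed.

End SexticRing.
Arguments Lz {F}.

Section BaseChange.
Variables (F F' : comNzRingType) (f : {rmorphism F -> F'}).
Definition Kmap (a : OK F) : OK F' := mkK (f (K0 a)) (f (K1 a)) (f (K2 a)).
Fact Kmap_additive : {morph Kmap : a b / a - b}.
Proof. by move=> a b; apply: K_ext; rewrite /Kmap !KE !(rmorphB, rmorphD, rmorphN). Qed.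
Fact Kmap_multiplicative : monoid_morphism Kmap.
Proof.
split=> [|a b]; apply: K_ext; rewrite /Kmap !KE ?rmorph1 ?rmorph0 //.
- by rewrite !(rmorphD, rmorphN, rmorphMn, rmorphM).
- by rewrite !(rmorphD, rmorphN, rmorphMn, rmorphM).
by rewrite !(rmorphD, rmorphN, rmorphMn, rmorphM).
Qed.
HB.instance Definition _ := GRing.isZmodMorphism.Build _ _ Kmap Kmap_additive.
HB.instance Definition _ := GRing.isMonoidMorphism.Build _ _ Kmap Kmap_multiplicative.
Lemma Kmap_c : Kmap Kc = Kc.
Proof. by apply: K_ext; rewrite /Kmap /Kc !KE ?rmorph0 ?rmorph1. Qed.
Lemma KN_map a : KN (Kmap a) = f (KN a).
Proof. by rewrite /KN /Kmap !KE !(rmorphD, rmorphN, rmorphM, rmorphMn, rmorphXn). Qed.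
Lemma KT_map a : KT (Kmap a) = f (KT a).
Proof. by rewrite /KT /Kmap !KE !(rmorphD, rmorphN, rmorphM, rmorphMn). Qed.
Lemma Kgal_map a : Kgal (Kmap a) = Kmap (Kgal a).
Proof.
by apply: K_ext; rewrite /Kgal /Kmap !KE !(rmorphD, rmorphN, rmorphM, rmorphMn).
Qed.
Lemma KC_map r : Kmap (KC r) = KC (f r).
Proof. by apply: K_ext; rewrite /Kmap /KC !KE ?rmorph0. Qed.

Definition Lmap (a : OL F) : OL F' := mkL (Kmap (L0 a)) (Kmap (L1 a)).
Fact Lmap_additive : {morph Lmap : a b / a - b}.
Proof. by move=> a b; apply: L_ext; rewrite /Lmap !LE !(rmorphB, rmorphD, rmorphN). Qed.
Fact Lmap_multiplicative : monoid_morphism Lmap.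
Proof.
split=> [|a b]; apply: L_ext; rewrite /Lmap !LE ?rmorph1 ?rmorph0 //.
- by rewrite !(rmorphD, rmorphN, rmorphM).
by rewrite !(rmorphD, rmorphN, rmorphM) /= Kmap_c.
Qed.
HB.instance Definition _ := GRing.isZmodMorphism.Build _ _ Lmap Lmap_additive.
HB.instance Definition _ := GRing.isMonoidMorphism.Build _ _ Lmap Lmap_multiplicative.
Lemma Lmap_z : Lmap Lz = Lz.
Proof. by apply: L_ext; rewrite /Lmap /Lz !LE ?rmorph0 ?rmorph1. Qed.
Lemma LC_map r : Lmap (LC r) = LC (Kmap r).
Proof. by apply: L_ext; rewrite /Lmap /LC !LE ?rmorph0. Qed.
Lemma Lconj_map a : Lmap (Lconj a) = Lconj (Lmap a).
Proof.
by apply: L_ext; rewrite /Lmap /Lconj !LE !(rmorphD, rmorphN, rmorphM) /= ?Kmap_c.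
Qed.
Lemma Lnorm_map a : Lnorm (Lmap a) = Kmap (Lnorm a).
Proof. by rewrite /Lnorm /Lmap !LE !(rmorphD, rmorphM, rmorphXn) /= ?Kmap_c. Qed.
End BaseChange.

Section KEval.
Variables (F F' : comNzRingType) (f : {rmorphism F -> F'}) (r w : F').
Hypothesis hr : r ^+ 3 = - r ^+ 2 + r *+ 2 + 1.
Hypothesis hw : w ^+ 2 = r * w - 1.

Definition Kev & r ^+ 3 = - r ^+ 2 + r *+ 2 + 1 := fun a : OK F =>
  f (K0 a) + f (K1 a) * r + f (K2 a) * r ^+ 2.
Fact Kev_additive : {morph Kev hr : a b / a - b}.
Proof. by move=> a b; rewrite /Kev !KE !rmorphB; ring. Qed.
Fact Kev_multiplicative : monoid_morphism (Kev hr).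
Proof.
have r0 (a : F') : a * (r ^+ 3 - (- r ^+ 2 + r *+ 2 + 1)) = 0.
  by rewrite hr subrr mulr0.
split=> [|a b]; rewrite /Kev !KE ?rmorph1 ?rmorph0; first by ring.
rewrite !(rmorphD, rmorphN, rmorphMn, rmorphM) /=.
apply/eqP; rewrite -subr_eq0; apply/eqP.
rewrite -[RHS](r0 (- (f (K1 a) * f (K2 b) + f (K2 a) * f (K1 b)
   + f (K2 a) * f (K2 b) * (r - 1)))); ring.
Qed.
HB.instance Definition _ := GRing.isZmodMorphism.Build _ _ (Kev hr) Kev_additive.
HB.instance Definition _ := GRing.isMonoidMorphism.Build _ _ (Kev hr) Kev_multiplicative.
Lemma Kev_c : Kev hr Kc = r.
Proof. by rewrite /Kev /Kc !KE rmorph0 rmorph1; ring. Qed.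

Definition Lev & w ^+ 2 = r * w - 1 := fun a : OL F => Kev hr (L0 a) + Kev hr (L1 a) * w.
Fact Lev_additive : {morph Lev hw : a b / a - b}.
Proof. by move=> a b; rewrite /Lev !LE !rmorphB; ring. Qed.
Fact Lev_multiplicative : monoid_morphism (Lev hw).
Proof.
have w0 (a : F') : a * (w ^+ 2 - (r * w - 1)) = 0 by rewrite hw subrr mulr0.
split=> [|a b]; rewrite /Lev !LE ?rmorph1 ?rmorph0; first by ring.
rewrite !(rmorphD, rmorphN, rmorphM) /= Kev_c.
apply/eqP; rewrite -subr_eq0; apply/eqP.
rewrite -[RHS](w0 (- (Kev hr (L1 a) * Kev hr (L1 b)))); ring.
Qed.
HB.instance Definition _ := GRing.isZmodMorphism.Build _ _ (Lev hw) Lev_additive.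
HB.instance Definition _ := GRing.isMonoidMorphism.Build _ _ (Lev hw) Lev_multiplicative.
End KEval.

(** * The integral group ring of Q28 and its four components *)

Section CycInvol.
Variable F : comNzRingType.
Definition cyc_conj (u : cyc F) : cyc F := [ffun i => u (- i)].
Fact cyc_conj_additive : {morph cyc_conj : a b / a - b}.
Proof. by move=> a b; apply/ffunP=> i; rewrite !ffunE. Qed.
Fact cyc_conj_multiplicative : monoid_morphism cyc_conj.
Proof.
split=> [|a b]; apply/ffunP=> i; rewrite !ffunE ?oppr_eq0 //.
rewrite (reindex_inj oppr_inj); apply: eq_bigr => j _.
by rewrite !ffunE opprB opprK addrC.
Qed.
HB.instance Definition _ := GRing.isZmodMorphism.Build _ _ cyc_conj cyc_conj_additive.
HB.instance Definition _ := GRing.isMonoidMorphism.Build _ _ cyc_conj cyc_conj_multiplicative.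
Fact cyc_conjK : involutive cyc_conj.
Proof. by move=> a; apply/ffunP=> i; rewrite !ffunE opprK. Qed.
Lemma cyc_conjX : cyc_conj (cycX F) = cycX F ^+ 13.
Proof. by rewrite cycXn; apply/ffunP=> i; rewrite !ffunE eqr_oppLR. Qed.
Fact cyc_conj_sq : cyc_conj (cycX F ^+ 7) = cycX F ^+ 7.
Proof. by rewrite rmorphXn /= cyc_conjX -exprM -[(13 * 7)%N]/(14 * 6 + 7)%N exprD exprM cycX14 expr1n mul1r. Qed.
Definition cycD : invol := Invol cyc_conjK cyc_conj_sq.
End CycInvol.

Definition QG (F : comNzRingType) := tw (cycD F).
Notation R := (QG int).

(** The boolean records the sign (-1)^b of x^7 = y^2; accordingly x goes to (-1)^b zeta, or to
    (-1)^b in the rational components [FD]. *)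
Definition LD (F : comNzRingType) (b : bool) : invol :=
  @Invol (OL F) (@Lconj F) ((-1) ^+ b) (@LconjK F) (rmorph_sign (@Lconj F) b).
Fact id_invol (F : comNzRingType) : involutive (@idfun F).
Proof. by []. Qed.
Definition FD (F : comNzRingType) (b : bool) : invol :=
  @Invol F idfun ((-1) ^+ b) (@id_invol F) erefl.

Notation Lam := (tw (LD int true)).
Notation Alg := (tw (LD int false)).
Notation Zi := (tw (FD int true)).
Notation ZC2 := (tw (FD int false)).

Lemma sgn_expodd (T : pzRingType) (b : bool) n : odd n -> ((-1) ^+ b : T) ^+ n = (-1) ^+ b.
Proof. by move=> on; rewrite -exprM -[LHS]signr_odd oddM on andbT oddb. Qed.

Fact sgn_z14 (b : bool) : ((-1) ^+ b * Lz : OL int) ^+ 14 = 1.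
Proof.
rewrite exprMn -exprM mulnC exprM -signr_odd /= expr0 expr1n mul1r.
by rewrite -[14%N]/(7 * 2)%N exprM Lz7 expr1n.
Qed.
Fact sgn_14 (b : bool) : ((-1) ^+ b : int) ^+ 14 = 1.
Proof. by rewrite -exprM mulnC exprM -signr_odd /= expr0 expr1n. Qed.

Definition evL (b : bool) : {rmorphism cyc int -> OL int} := cyc_ev (sgn_z14 b).
Definition evZ (b : bool) : {rmorphism cyc int -> int} := cyc_ev (sgn_14 b).

Lemma evLX b : evL b (cycX int) = (-1) ^+ b * Lz. Proof. exact: cyc_evX. Qed.
Lemma evZX b : evZ b (cycX int) = (-1) ^+ b. Proof. exact: cyc_evX. Qed.

Fact evL_conj b a : evL b (inv_conj (cycD int) a) = inv_conj (LD int b) (evL b a).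
Proof.
apply: (@cyc_morph_eq _ (evL b \o @cyc_conj int) (@Lconj int \o evL b)).
rewrite /= cyc_conjX rmorphXn /= evLX rmorphM rmorph_sign /=.
have h : ((-1) ^+ b * Lz) * ((-1) ^+ b * Lconj Lz) = 1 :> OL int.
  by rewrite mulrACA -signr_addb addbb mul1r Lz_conj.
by rewrite -[LHS]mulr1 -[X in _ ^+ 13 * X]h [LHS]mulrA -exprSr sgn_z14 mul1r.
Qed.
Lemma evLX7 (b : bool) : evL b (cycX int ^+ 7) = (-1) ^+ b.
Proof. by rewrite rmorphXn /= evLX exprMn Lz7 mulr1 sgn_expodd. Qed.
Fact evL_sq b : evL b (inv_sq (cycD int)) = inv_sq (LD int b).
Proof. exact: evLX7. Qed.
Definition compL b : imorph (cycD int) (LD int b) := @IMorph (cycD int) (LD int b) (evL b) (@evL_conj b) (@evL_sq b).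

Fact evZ_conj b a : evZ b (inv_conj (cycD int) a) = inv_conj (FD int b) (evZ b a).
Proof.
apply: (@cyc_morph_eq _ (evZ b \o @cyc_conj int) (evZ b)).
by rewrite /= cyc_conjX rmorphXn /= evZX sgn_expodd.
Qed.
Lemma evZX7 (b : bool) : evZ b (cycX int ^+ 7) = (-1) ^+ b.
Proof. by rewrite rmorphXn /= evZX sgn_expodd. Qed.
Fact evZ_sq b : evZ b (inv_sq (cycD int)) = inv_sq (FD int b).
Proof. exact: evZX7. Qed.
Definition compZ b : imorph (cycD int) (FD int b) := @IMorph (cycD int) (FD int b) (evZ b) (@evZ_conj b) (@evZ_sq b).

Definition piL (r : R) : Lam := twmap (compL true) r.
Definition piA (r : R) : Alg := twmap (compL false) r.
Definition piI (r : R) : Zi := twmap (compZ true) r.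
Definition piS (r : R) : ZC2 := twmap (compZ false) r.
HB.instance Definition _ := GRing.RMorphism.copy piL (twmap (compL true)).
HB.instance Definition _ := GRing.RMorphism.copy piA (twmap (compL false)).
HB.instance Definition _ := GRing.RMorphism.copy piI (twmap (compZ true)).
HB.instance Definition _ := GRing.RMorphism.copy piS (twmap (compZ false)).

(** * Residue maps at 7 and at 2 *)

Fact F7_root : (2 : 'F_7) ^+ 3 = - 2 ^+ 2 + 2 *+ 2 + 1.
Proof. by apply/eqP. Qed.
Fact F7_root1 : (1 : 'F_7) ^+ 2 = 2 * 1 - 1.
Proof. by apply/eqP. Qed.
(** Reduction at the prime over 7, where zeta becomes 1 and hence c becomes 2. *)
Definition redK : {rmorphism OK int -> 'F_7} := @Kev int 'F_7 intr 2 F7_root.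
Definition redL : {rmorphism OL int -> 'F_7} := @Lev int 'F_7 intr 2 1 F7_root F7_root1.

Lemma redL_C a : redL (LC a) = redK a.
Proof. by rewrite /redL /= /Lev /LC !LE rmorph0 mul0r addr0. Qed.
Lemma redL_z : redL Lz = 1.
Proof. by rewrite /redL /= /Lev /Lz !LE rmorph0 rmorph1 mul1r add0r. Qed.
Lemma redK_c : redK Kc = 2.
Proof. by rewrite /redK /= Kev_c. Qed.
Lemma redL_conj a : redL (Lconj a) = redL a.
Proof.
rewrite /Lconj /redL /= /Lev !LE !rmorphD rmorphM rmorphN /= Kev_c.
by rewrite !mulr1; ring.
Qed.

Lemma redL_ev (b : bool) u : redL (evL b u) = (evZ b u)%:~R.
Proof.
apply: (@cyc_morph_eq _ (redL \o evL b) (intr \o evZ b)).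
by rewrite /= evLX evZX rmorphM rmorph_sign redL_z mulr1 rmorph_sign.
Qed.

(** F7 with a square root of -1 adjoined. The twisted form lets [Lam] and [Zi] both map to it
    through [twmap]: conjugation of zeta becomes trivial mod 7. *)
Definition F49 := tw (FD 'F_7 true).
HB.instance Definition _ := GRing.NzRing.on F49.

Fact redL_imconj a : redL (inv_conj (LD int true) a) = inv_conj (FD 'F_7 true) (redL a).
Proof. exact: redL_conj. Qed.
Fact redL_imsq : redL (inv_sq (LD int true)) = inv_sq (FD 'F_7 true).
Proof. exact: (rmorph_sign redL true). Qed.
Definition redLam : {rmorphism Lam -> F49} :=
  twmap (@IMorph (LD int true) (FD 'F_7 true) redL redL_imconj redL_imsq).
Fact intr7_imconj a : (inv_conj (FD int true) a)%:~R = inv_conj (FD 'F_7 true) a%:~R.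
Proof. by []. Qed.
Fact intr7_imsq : (inv_sq (FD int true))%:~R = inv_sq (FD 'F_7 true).
Proof. by apply/eqP. Qed.
Definition redZi : {rmorphism Zi -> F49} :=
  twmap (@IMorph (FD int true) (FD 'F_7 true) intr intr7_imconj intr7_imsq).

Lemma red_pi r : redLam (piL r) = redZi (piI r).
Proof.
by apply: injective_projections; [exact: (@redL_ev true r.1) | exact: (@redL_ev true r.2)].
Qed.

Lemma Fp_intr_eq p (m n : int) : prime p ->
  m%:~R = n%:~R :> 'F_p -> exists k, m = n + k * p%:Z.
Proof.
move=> pr_p /eqP; rewrite -subr_eq0 -rmorphB /= -(dvdz_pcharf (pchar_Fp pr_p)).
by move=> /dvdzP[k Ek]; exists k; rewrite -Ek addrC subrK.
Qed.

Fact sgn_F2 (b : bool) : (-1) ^+ b = 1 :> 'F_2.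
Proof. by case: b; apply/eqP. Qed.
Definition intr2 : {rmorphism int -> 'F_2} := intr.
Fact mod2L_conj a :
  Lmap intr2 (inv_conj (LD int true) a) = inv_conj (LD 'F_2 false) (Lmap intr2 a).
Proof. exact: Lconj_map. Qed.
Fact sgn_OL2 b : Lmap intr2 (inv_sq (LD int b)) = inv_sq (LD 'F_2 false).
Proof.
rewrite /= rmorph_sign expr0 signrE; apply: L_ext; first by apply: K_ext; case: b; apply/eqP.
by apply: K_ext; case: b; apply/eqP.
Qed.
Definition mod2L : {rmorphism Lam -> tw (LD 'F_2 false)} :=
  twmap (@IMorph (LD int true) (LD 'F_2 false) (Lmap intr2) mod2L_conj (sgn_OL2 true)).
Fact mod2A_conj a :
  Lmap intr2 (inv_conj (LD int false) a) = inv_conj (LD 'F_2 false) (Lmap intr2 a).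
Proof. exact: Lconj_map. Qed.
Definition mod2A : {rmorphism Alg -> tw (LD 'F_2 false)} :=
  twmap (@IMorph (LD int false) (LD 'F_2 false) (Lmap intr2) mod2A_conj (sgn_OL2 false)).
Fact mod2I_conj a :
  intr2 (inv_conj (FD int true) a) = inv_conj (FD 'F_2 false) (intr2 a).
Proof. by []. Qed.
Fact mod2I_sq : intr2 (inv_sq (FD int true)) = inv_sq (FD 'F_2 false).
Proof. by apply/eqP. Qed.
Definition mod2I : {rmorphism Zi -> tw (FD 'F_2 false)} :=
  twmap (@IMorph (FD int true) (FD 'F_2 false) intr2 mod2I_conj mod2I_sq).
Fact mod2E_conj a :
  intr2 (inv_conj (FD int false) a) = inv_conj (FD 'F_2 false) (intr2 a).
Proof. by []. Qed.
Fact mod2E_sq : intr2 (inv_sq (FD int false)) = inv_sq (FD 'F_2 false).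
Proof. by apply/eqP. Qed.
Definition mod2E : {rmorphism ZC2 -> tw (FD 'F_2 false)} :=
  twmap (@IMorph (FD int false) (FD 'F_2 false) intr2 mod2E_conj mod2E_sq).

Fact redA_conj a : redL (inv_conj (LD int false) a) = inv_conj (FD 'F_7 false) (redL a).
Proof. exact: redL_conj. Qed.
Fact redA_sq : redL (inv_sq (LD int false)) = inv_sq (FD 'F_7 false).
Proof. exact: (rmorph_sign redL false). Qed.
Definition redA : {rmorphism Alg -> tw (FD 'F_7 false)} :=
  twmap (@IMorph (LD int false) (FD 'F_7 false) redL redA_conj redA_sq).
Fact redE_conj a : (inv_conj (FD int false) a)%:~R = inv_conj (FD 'F_7 false) a%:~R.
Proof. by []. Qed.
Fact redE_sq : (inv_sq (FD int false))%:~R = inv_sq (FD 'F_7 false).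
Proof. by apply/eqP. Qed.
Definition redE : {rmorphism ZC2 -> tw (FD 'F_7 false)} :=
  twmap (@IMorph (FD int false) (FD 'F_7 false) intr redE_conj redE_sq).

Lemma redA_pi r : redA (piA r) = redE (piS r).
Proof.
by apply: injective_projections; [exact: (@redL_ev false r.1) | exact: (@redL_ev false r.2)].
Qed.

Lemma mod2_evL (b : bool) u : Lmap intr2 (evL b u) = Lmap intr2 (evL false u).
Proof.
have e b' : (Lmap intr2 \o evL b') (cycX int) = Lz.
  rewrite -[LHS]/(Lmap intr2 (evL b' (cycX int))) evLX rmorphM rmorph_sign.
  have := sgn_OL2 b'; rewrite -[inv_sq (LD int b')]/((-1) ^+ b') rmorph_sign => ->.
  rewrite -[inv_sq _]/1 mul1r; exact: Lmap_z.
by apply: (@cyc_morph_eq _ (Lmap intr2 \o evL b) (Lmap intr2 \o evL false));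
  exact: etrans (e b) (esym (e false)).
Qed.
Lemma mod2_evZ (b : bool) u : intr2 (evZ b u) = intr2 (evZ false u).
Proof.
apply: (@cyc_morph_eq _ (intr2 \o evZ b) (intr2 \o evZ false)).
by rewrite /= evZX [evZ false _]evZX !rmorph_sign !sgn_F2.
Qed.
Lemma mod2_pi r : mod2L (piL r) = mod2A (piA r).
Proof.
by apply: injective_projections; [exact: (@mod2_evL true r.1) | exact: (@mod2_evL true r.2)].
Qed.
Lemma mod2_piZ r : mod2I (piI r) = mod2E (piS r).
Proof.
by apply: injective_projections; [exact: (@mod2_evZ true r.1) | exact: (@mod2_evZ true r.2)].
Qed.

Lemma Kmap2_eq (a b : OK int) : Kmap intr2 a = Kmap intr2 b -> exists d, a = b + d *+ 2.
Proof.
move=> E.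
have /(Fp_intr_eq (isT : prime 2))[k0 E0] : intr2 (K0 a) = intr2 (K0 b) by move: E => [].
have /(Fp_intr_eq (isT : prime 2))[k1 E1] : intr2 (K1 a) = intr2 (K1 b) by move: E => [].
have /(Fp_intr_eq (isT : prime 2))[k2 E2] : intr2 (K2 a) = intr2 (K2 b) by move: E => [].
by exists (mkK k0 k1 k2); apply: K_ext; rewrite mulr2n !KE ?E0 ?E1 ?E2; ring.
Qed.
Lemma Lmap2_eq (a b : OL int) : Lmap intr2 a = Lmap intr2 b -> exists d, a = b + d *+ 2.
Proof.
move=> E.
have /Kmap2_eq[d0 E0] : Kmap intr2 (L0 a) = Kmap intr2 (L0 b) by exact: (congr1 (@L0 _) E).
have /Kmap2_eq[d1 E1] : Kmap intr2 (L1 a) = Kmap intr2 (L1 b) by exact: (congr1 (@L1 _) E).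
by exists (mkL d0 d1); apply: L_ext; rewrite mulr2n !LE ?E0 ?E1; ring.
Qed.

(** * The group ring as a fibre product of its components *)

Lemma sgn_expeven (T : pzRingType) (b : bool) n : ~~ odd n -> ((-1) ^+ b : T) ^+ n = 1.
Proof. by move=> on; rewrite -exprM -[LHS]signr_odd oddM (negPf on) andbF. Qed.

Lemma Lz_powers (F : comNzRingType) :
  [/\ Lz ^+ 2 = mkL (mkK (-1) 0 0) (mkK 0 1 0) :> OL F,
      Lz ^+ 3 = mkL (mkK 0 (-1) 0) (mkK (-1) 0 1) :> OL F,
      Lz ^+ 4 = mkL (mkK 1 0 (-1)) (mkK 1 0 (-1)) :> OL F,
      Lz ^+ 5 = mkL (mkK (-1) 0 1) (mkK 0 (-1) 0) :> OL F &
      Lz ^+ 6 = mkL (mkK 0 1 0) (mkK (-1) 0 0) :> OL F].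
Proof.
have z2 : Lz ^+ 2 = mkL (mkK (-1) 0 0) (mkK 0 1 0) :> OL F.
  by rewrite expr2; apply: L_ext; rewrite /Lz !LE; apply: K_ext; rewrite /Kc !KE; ring.
have z3 : Lz ^+ 3 = mkL (mkK 0 (-1) 0) (mkK (-1) 0 1) :> OL F.
  by rewrite exprS z2; apply: L_ext; rewrite /Lz !LE; apply: K_ext; rewrite /Kc !KE; ring.
have z4 : Lz ^+ 4 = mkL (mkK 1 0 (-1)) (mkK 1 0 (-1)) :> OL F.
  by rewrite exprS z3; apply: L_ext; rewrite /Lz !LE; apply: K_ext; rewrite /Kc !KE; ring.
have z5 : Lz ^+ 5 = mkL (mkK (-1) 0 1) (mkK 0 (-1) 0) :> OL F.
  by rewrite exprS z4; apply: L_ext; rewrite /Lz !LE; apply: K_ext; rewrite /Kc !KE; ring.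
by split=> //; rewrite exprS z5; apply: L_ext; rewrite /Lz !LE; apply: K_ext; rewrite /Kc !KE; ring.
Qed.

Lemma K_intz (n : int) : n%:~R = mkK n 0 0 :> OK int.
Proof. by rewrite -[n in RHS]intz -[RHS]/(KC _) rmorph_int. Qed.
Lemma L_intz (n : int) : n%:~R = mkL (mkK n 0 0) 0 :> OL int.
Proof. by rewrite -K_intz -[RHS]/(LC _) rmorph_int. Qed.

(** The only relation between 1, zeta, ..., zeta^6 is that their sum vanishes; reading off the six
    coordinates in Z[zeta] gives a linear system that says so. *)
Lemma Lz_sum7 (q : nat -> int) :
  \sum_(i < 7) Lz ^+ i *~ q i = 0 :> OL int -> forall i, (i < 7)%N -> q i = q 0%N.
Proof.
have [z2 z3 z4 z5 z6] := Lz_powers int.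
move=> E.
have D (f : {additive OL int -> int}) : \sum_(i < 7) f (Lz ^+ i) * q i = 0.
  transitivity (f 0); last exact: raddf0.
  rewrite -[X in _ = f X]E raddf_sum; apply: eq_bigr => i _.
  by rewrite raddfMz -[in RHS]mulrzr intz.
have {}D (f : {additive OL int -> int}) : f 1 * q 0%N + (f Lz * q 1%N + (f (Lz ^+ 2) * q 2%N
    + (f (Lz ^+ 3) * q 3%N + (f (Lz ^+ 4) * q 4%N + (f (Lz ^+ 5) * q 5%N
    + (f (Lz ^+ 6) * q 6%N + 0)))))) = 0.
  by rewrite -{}[RHS](D f) !big_ord_recl big_ord0.
have := D (@K0 int \o @L0 int); have := D (@K1 int \o @L0 int).
have := D (@K2 int \o @L0 int); have := D (@K0 int \o @L1 int).
have := D (@K1 int \o @L1 int); have := D (@K2 int \o @L1 int).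
rewrite z2 z3 z4 z5 z6 /= {D E z2 z3 z4 z5 z6}.
rewrite /K0 /K1 /K2 /L0 /L1 /Lz /mkL /mkK /=.
by move=> e1 e2 e3 e4 e5 e6 [|[|[|[|[|[|[|i]]]]]]] //= _; lia.
Qed.

Lemma Lz6 F : Lz ^+ 6 = Lconj Lz :> OL F.
Proof.
by rewrite -[LHS]mulr1 -[X in _ * X](Lz_conj F) [LHS]mulrA -exprSr Lz7 mul1r.
Qed.

Section Gluing.
(** x^8 has order 7 and goes to zeta in both cyclotomic components and to 1 in both rational ones,
    while x^7 goes to the two signs. So lifts are written in x^8 and the two signs are then
    separated by means of 1 + x^7. *)
Let cz : cyc int := cycX int ^+ 8.
Let evL_cz b : evL b cz = Lz.
Proof.
have z8 : Lz ^+ 8 = Lz :> OL int by rewrite exprS Lz7 mulr1.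
rewrite -z8 rmorphXn; transitivity (((-1) ^+ b * Lz : OL int) ^+ 8).
  by congr (_ ^+ 8); exact: evLX.
by rewrite exprMn sgn_expeven ?mul1r.
Qed.
Let evZ_cz b : evZ b cz = 1.
Proof.
rewrite rmorphXn; transitivity (((-1) ^+ b : int) ^+ 8).
  by congr (_ ^+ 8); exact: evZX.
by rewrite sgn_expeven.
Qed.

Let lftK (a : OK int) : cyc int :=
  (K0 a)%:~R + (K1 a)%:~R * (cz + cz ^+ 6) + (K2 a)%:~R * (cz + cz ^+ 6) ^+ 2.
Let lft (a : OL int) : cyc int := lftK (L0 a) + lftK (L1 a) * cz.

Let ev_lftK (S : comNzRingType) (f : {rmorphism cyc int -> S}) a :
  f (lftK a) = (K0 a)%:~R + (K1 a)%:~R * (f cz + f cz ^+ 6)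
    + (K2 a)%:~R * (f cz + f cz ^+ 6) ^+ 2.
Proof.
rewrite /lftK; move: (K0 a) (K1 a) (K2 a) cz => n0 n1 n2 u.
by rewrite !(rmorphD, rmorphM, rmorphXn, rmorph_int).
Qed.
Let ev_lft (S : comNzRingType) (f : {rmorphism cyc int -> S}) a :
  f (lft a) = f (lftK (L0 a)) + f (lftK (L1 a)) * f cz.
Proof. by rewrite /lft; move: (lftK _) (lftK _) cz => u v w; rewrite rmorphD rmorphM. Qed.

Let evL_lft b a : evL b (lft a) = a.
Proof.
have lK k : evL b (lftK k) = LC k.
  rewrite (ev_lftK (evL b)) evL_cz Lz6 -LcE.
  have C (n : int) : n%:~R = LC (KC n) :> OL int by exact: L_intz.
  by rewrite !C -rmorphXn -!rmorphM -!rmorphD -K_sum.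
by rewrite (ev_lft (evL b)) !lK evL_cz -L_sum.
Qed.
Lemma evL_surj b a : exists p, evL b p = a.
Proof. by exists (lft a); exact: evL_lft. Qed.
Let evZ_lft b a : evZ b (lft a) = evZ false (lft a).
Proof. by rewrite !(ev_lft (evZ _)) !(ev_lftK (evZ _)) !evZ_cz. Qed.

Let Phi : cyc int := \sum_(i < 7) cz ^+ i.
Let evZ_Phi b : evZ b Phi = 7.
Proof.
rewrite rmorph_sum (eq_bigr (fun=> 1)); first by rewrite sumr_const card_ord.
by move=> i _; rewrite rmorphXn evZ_cz expr1n.
Qed.
Let evL_Phi b : evL b Phi = 0.
Proof.
have -> : evL b Phi = \sum_(i < 7) Lz ^+ i.
  by rewrite rmorph_sum; apply: eq_bigr => i _; rewrite rmorphXn evL_cz.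
have [z2 z3 z4 z5 z6] := Lz_powers int.
rewrite !big_ord_recl big_ord0 /= /bump /= expr0 expr1 z2 z3 z4 z5 z6.
by apply/eqP; vm_compute.
Qed.

(** The element [p1] is right in both cyclotomic components. Adding Phi (k0 + k1 x^7), with Phi the
    sum over the subgroup of order 7, leaves these alone and moves the rational components by 7 (k0
    - k1) and 7 (k0 + k1). *)
Lemma glueC (l a : OL int) (n e : int) :
    redL l = n%:~R -> redL a = e%:~R -> Lmap intr2 l = Lmap intr2 a -> intr2 n = intr2 e ->
  exists p, [/\ evL true p = l, evZ true p = n, evL false p = a & evZ false p = e].
Proof.
move=> rl ra /esym/Lmap2_eq[d ad] /esym/(Fp_intr_eq (isT : prime 2))[k ne].
set s := cycX int ^+ 7; set p1 := lft l + (1 + s) * lft d.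
have G (S : pzRingType) (f : {rmorphism cyc int -> S}) (x y t : cyc int) :
  f (x + (1 + t) * y) = f x + (1 + f t) * f y by rewrite rmorphD rmorphM rmorphD rmorph1.
have H (S : pzRingType) (f : {rmorphism cyc int -> S}) (x y t : cyc int) (m m' : int) :
  f (x + y * (m%:~R + m'%:~R * t)) = f x + f y * (m%:~R + m'%:~R * f t).
  by rewrite rmorphD rmorphM rmorphD rmorphM !rmorph_int.
have sL b : evL b s = (-1) ^+ b := evLX7 b.
have sZ b : evZ b s = (-1) ^+ b := evZX7 b.
have L1 : evL true p1 = l.
  by rewrite /p1 (G _ (evL true)) sL !evL_lft expr1 subrr mul0r addr0.
have A1 : evL false p1 = a.
  by rewrite /p1 (G _ (evL false)) sL !evL_lft expr0 ad -mulr_natl.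
have /(Fp_intr_eq (isT : prime 7))[m Em] : (evZ true p1)%:~R = n%:~R :> 'F_7.
  by rewrite -(redL_ev true) L1.
have /(Fp_intr_eq (isT : prime 7))[m' Em'] : (evZ false p1)%:~R = e%:~R :> 'F_7.
  by rewrite -(redL_ev false) A1.
have E2 : evZ false p1 = evZ true p1 + evZ false (lft d) * 2.
  rewrite /p1 !(G _ (evZ _)) !sZ (evZ_lft true) (evZ_lft true d).
  rewrite expr0 expr1; ring.
(* The two errors m and m' have the same parity, by [E2] and the congruence of n and e mod 2, so
   these halves are exact. *)
have [k0 [k1 [Ek Ek']]] : exists k0 k1 : int, - m = k0 - k1 /\ - m' = k0 + k1.
  exists ((- m - m') %/ 2)%Z, ((m - m') %/ 2)%Z.
  by move: (evZ false (lft d)) (evZ true p1) (evZ false p1) Em Em' E2 => w u v; lia.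
exists (p1 + Phi * (k0%:~R + k1%:~R * s)).
split; rewrite ?(H _ (evL _)) ?(H _ (evZ _)) ?evL_Phi ?evZ_Phi ?mul0r ?addr0 // sZ ?Em ?Em' !intz ?expr1 ?expr0.
  by clear -Ek Ek'; lia.
by clear -Ek Ek'; lia.
Qed.
End Gluing.

Lemma glue (l : Lam) (n : Zi) (a : Alg) (e : ZC2) :
    redLam l = redZi n -> redA a = redE e -> mod2L l = mod2A a -> mod2I n = mod2E e ->
  exists r, [/\ piL r = l, piI r = n, piA r = a & piS r = e].
Proof.
move=> h1 h2 h3 h4.
have [p [p1 p2 p3 p4]] := glueC (congr1 fst h1) (congr1 fst h2) (congr1 fst h3) (congr1 fst h4).
have [q [q1 q2 q3 q4]] := glueC (congr1 snd h1) (congr1 snd h2) (congr1 snd h3) (congr1 snd h4).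
by exists (p, q); split; apply: injective_projections.
Qed.

Lemma cyc_ev_fold (S : pzRingType) (t : S) (ht : t ^+ 14 = 1) (e : int) (u : S) p :
    t = e%:~R * u -> u ^+ 7 = 1 -> e * e = 1 ->
  cyc_ev ht p = \sum_(i < 7) u ^+ i *~ (e ^+ i * (p (inord i) + e * p (inord (7 + i)%N))).
Proof.
move=> tE u7 ee; rewrite /cyc_ev (@big_split_ord _ _ _ 7 7) /= -big_split /=.
have tX n : t ^+ n = u ^+ n *~ e ^+ n.
  rewrite tE exprMn_comm; first by rewrite -rmorphXn mulrzl.
  exact/commr_sym/commr_int.
have e7 : e ^+ 7 = e by rewrite -[7%N]/(2 * 3 + 1)%N exprD exprM expr2 ee expr1n mul1r.
apply: eq_bigr => i _.
have -> : lshift 7 i = inord i :> 'I_14.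
  by apply: val_inj; rewrite /= inordK // (leq_trans (ltn_ord i)).
have -> : rshift 7 i = inord (7 + i)%N :> 'I_14.
  by apply: val_inj; rewrite /= inordK // -[14%N]/(7 + 7)%N ltn_add2l.
rewrite !tX exprD u7 mul1r [e ^+ (_ + _)]exprD e7 -!mulrzA -mulrzDr; congr (_ *~ _).
by ring.
Qed.

(** For each sign the folded coefficients are all equal because of the cyclotomic component, and sum
    to 0 because of the rational one. So both p_i + p_(i+7) and p_i - p_(i+7) vanish. *)
Lemma evL_evZ_inj p : (forall b, evL b p = 0) -> (forall b, evZ b p = 0) -> p = 0.
Proof.
move=> hL hZ.
have q (b : bool) i : (i < 7)%N ->
    p (inord i) + (-1) ^+ b * p (inord (7 + i)%N) = 0.
  pose q i := ((-1) ^+ b : int) ^+ i * (p (inord i) + (-1) ^+ b * p (inord (7 + i)%N)).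
  have ss : (-1) ^+ b * (-1) ^+ b = 1 :> int by rewrite -signr_addb addbb.
  have qe : forall i, (i < 7)%N -> q i = q 0%N.
    apply: Lz_sum7; rewrite -[RHS](hL b); symmetry.
    by apply: cyc_ev_fold; rewrite ?rmorph_sign ?Lz7.
  have q0 : q 0%N = 0.
    have : \sum_(i < 7) (1 : int) ^+ i *~ q i = 0.
      rewrite -[RHS](hZ b); symmetry.
      by apply: cyc_ev_fold; rewrite ?rmorph_sign ?mulr1 ?expr1n.
    rewrite (eq_bigr (fun=> q 0%N)); last first.
      by move=> j _; rewrite expr1n qe // -mulrzr mul1r intz.
    by rewrite sumr_const card_ord => /eqP; rewrite mulrn_eq0 => /eqP.
  move=> /qe; rewrite q0 /q => /eqP; rewrite mulf_eq0 expf_eq0 signr_eq0 andbF /=.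
  by move=> /eqP.
apply/ffunP=> k; rewrite ffunE.
have [lk|lk] := ltnP k 7.
  have := q false _ lk; have := q true _ lk; rewrite inord_val expr0 expr1.
  by move: (p k) (p _) => u v e1 e2; clear -e1 e2; lia.
have lk' : (k - 7 < 7)%N by rewrite ltn_subLR // (leq_trans (ltn_ord k)).
have := q false _ lk'; have := q true _ lk'; rewrite subnKC // inord_val expr0 expr1.
by move: (p k) (p _) => u v e1 e2; clear -e1 e2; lia.
Qed.

Lemma pi_inj r r' : piL r = piL r' -> piI r = piI r' -> piA r = piA r' -> piS r = piS r' -> r = r'.
Proof.
move=> h1 h2 h3 h4; apply/eqP; rewrite -subr_eq0; apply/eqP.
have D (T : zmodType) (f : {additive cyc int -> T}) u v : f u = f v -> f (u - v) = 0.
  by move=> e; rewrite raddfB e subrr.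
apply: injective_projections; apply: evL_evZ_inj => b; apply: D.
- by case: b; [exact: (congr1 fst h1) | exact: (congr1 fst h3)].
- by case: b; [exact: (congr1 fst h2) | exact: (congr1 fst h4)].
- by case: b; [exact: (congr1 snd h1) | exact: (congr1 snd h3)].
by case: b; [exact: (congr1 snd h2) | exact: (congr1 snd h4)].
Qed.

(** * Norms and positivity *)

Lemma F2_case (a : 'F_2) : a = 0 \/ a = 1.
Proof. by case: a => [[|[|n]] h]; [left|right|]; try exact: val_inj. Qed.

(** 2 is inert in Z[c], with residue field of eight elements; the eight cases are computed. *)
Lemma KN_F2 (a : OK 'F_2) : KN a = 0 -> a = 0.
Proof.
case: a => [[a0 a1] a2].
by case: (F2_case a0) (F2_case a1) (F2_case a2) => -> [] -> [] ->;
  move/eqP; vm_compute => // _; apply: K_ext; apply: val_inj.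
Qed.

Lemma KN_even (a : OK int) : (2 %| KN a)%Z -> exists a', a = a' *+ 2.
Proof.
rewrite (dvdz_pcharf (pchar_Fp (isT : prime 2))) => /eqP.
have -> : (KN a)%:~R = KN (Kmap intr2 a) by rewrite KN_map.
move=> /KN_F2 E; have /Kmap2_eq[d ->] : Kmap intr2 a = Kmap intr2 0 by rewrite E rmorph0.
by exists d; rewrite add0r.
Qed.

(** Infinite descent at the inert prime 2: an element of norm 0 is even, and its half again has norm
    0. *)
Lemma KN_int_eq0 (a : OK int) : KN a = 0 -> a = 0.
Proof.
pose m (a : OK int) := (`|K0 a| + `|K1 a| + `|K2 a|)%N.
move: {2}(m a).+1 (ltnSn (m a)) => n; elim: n a => // n IH a ltn a0.
have /KN_even[a' Ea] : (2 %| KN a)%Z by rewrite a0.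
have a'0 : KN a' = 0.
  move: a0; rewrite Ea -mulr_natl KNM => /eqP; rewrite mulf_eq0 => /orP[|/eqP//].
  by move/eqP.
have e0 : K0 a = K0 a' *+ 2 by rewrite Ea mulr2n KE.
have e1 : K1 a = K1 a' *+ 2 by rewrite Ea mulr2n KE.
have e2 : K2 a = K2 a' *+ 2 by rewrite Ea mulr2n KE.
have [z|nz] := eqVneq (m a) 0%N; first by apply: K_ext; rewrite !KE; move: z; rewrite /m; lia.
have -> : a = a' *+ 2 by [].
rewrite (IH a') ?mul0rn //; move: ltn nz; rewrite /m e0 e1 e2; lia.
Qed.

Definition intq : {rmorphism int -> rat} := intr.

Lemma KC_intq_scale (a : OK rat) : exists D : int, exists a' : OK int,
  [/\ 0 < D & KC D%:~R * a = Kmap intq a'].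
Proof.
pose d0 := denq (K0 a); pose d1 := denq (K1 a); pose d2 := denq (K2 a).
pose n0 := numq (K0 a); pose n1 := numq (K1 a); pose n2 := numq (K2 a).
exists (d0 * d1 * d2), (mkK (n0 * d1 * d2) (n1 * d0 * d2) (n2 * d0 * d1)); split.
  by rewrite !mulr_gt0 ?denq_gt0.
have q (r : rat) : (numq r)%:~R = r * (denq r)%:~R by rewrite numqE.
apply: K_ext; rewrite /KC /Kmap !KE /= ?rmorphM /= /n0 /n1 /n2 ?q -/d0 -/d1 -/d2; ring.
Qed.

Lemma Kmap_intq_inj : injective (Kmap intq).
Proof.
move=> a b E; apply: K_ext; apply: (@intr_inj rat).
- exact: (congr1 (@K0 _) E).
- exact: (congr1 (@K1 _) E).
exact: (congr1 (@K2 _) E).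
Qed.

Lemma KCM_eq0 (r : rat) (a : OK rat) : r != 0 -> KC r * a = 0 -> a = 0.
Proof.
move=> r0 E; have : KC r^-1 * (KC r * a) = 0 by rewrite E mulr0.
by rewrite mulrA -rmorphM mulVf // rmorph1 mul1r.
Qed.

Lemma KN_rat_eq0 (a : OK rat) : KN a = 0 -> a = 0.
Proof.
move=> a0; have [D [a' [D0 E]]] := KC_intq_scale a.
have : KN a' = 0.
  by apply: (@intr_inj rat); rewrite -[LHS]/(intq _) -KN_map -E KNM a0 mulr0.
move=> /KN_int_eq0 a'0; move: E; rewrite a'0 rmorph0; apply: KCM_eq0.
by rewrite intr_eq0 gt_eqF.
Qed.

(** The root is 2 cos(2 pi / 7), about 1.24698. The interval is narrow enough for the numerical
    bounds on the conjugates of c and c^-1 in the balancing argument. *)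
Lemma realc_exists : exists c : realalg,
  [&& 623 / 500 < c, c < 156 / 125 & c ^+ 3 == - c ^+ 2 + c *+ 2 + 1].
Proof.
pose p : {poly realalg} := 'X^3 + 'X^2 - 'X *+ 2 - 1.
have pE x : p.[x] = x ^+ 3 + x ^+ 2 - x *+ 2 - 1 by rewrite /p !hornerE.
have [//||c /andP[c1 c2] /rootP pc] := @poly_ivt _ p (623 / 500) (156 / 125).
- by lra.
- by rewrite !pE; apply/andP; split; lra.
move: pc; rewrite pE => pc.
exists c; apply/and3P; split; last by apply/eqP; lra.
  by rewrite lt_neqAle c1 andbT; apply: contraPneq pc => <-; lra.
by rewrite lt_neqAle c2 andbT; apply: contraPneq pc => ->; lra.
Qed.

Definition realc : realalg := xchoose realc_exists.
Lemma realc_gt : 623 / 500 < realc.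
Proof. by have /and3P[] := xchooseP realc_exists. Qed.
Lemma realc_lt : realc < 156 / 125.
Proof. by have /and3P[] := xchooseP realc_exists. Qed.
Fact realcE : realc ^+ 3 = - realc ^+ 2 + realc *+ 2 + 1.
Proof. by have /and3P[_ _ /eqP] := xchooseP realc_exists. Qed.

Definition emb0 : {rmorphism OK rat -> realalg} := @Kev rat realalg ratr realc realcE.
(** For k < 3 these are the three real embeddings, obtained from one of them through the Galois
    group. *)
Definition emb (k : nat) (a : OK rat) : realalg := emb0 (iter k (@Kgal rat) a).

Lemma embM k a b : emb k (a * b) = emb k a * emb k b.
Proof. by rewrite /emb -rmorphM; congr (emb0 _); elim: k => //= k ->; rewrite rmorphM. Qed.
Lemma embD k a b : emb k (a + b) = emb k a + emb k b.
Proof. by rewrite /emb -rmorphD; congr (emb0 _); elim: k => //= k ->; rewrite rmorphD. Qed.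
Lemma embC k r : emb k (KC r) = ratr r.
Proof.
have -> : emb k (KC r) = emb0 (KC r).
  by congr (emb0 _); elim: k => //= k ->; apply: K_ext; rewrite /Kgal /KC !KE; ring.
by rewrite /emb0 /= /Kev /KC !KE rmorph0; ring.
Qed.

Lemma Kgal3 (F : comNzRingType) (a : OK F) : Kgal (Kgal (Kgal a)) = a.
Proof. by apply: K_ext; rewrite /Kgal !KE; ring. Qed.
Lemma KT_gal (F : comNzRingType) (a : OK F) : KC (KT a) = a + Kgal a + Kgal (Kgal a).
Proof. by apply: K_ext; rewrite /Kgal /KC /KT !KE; ring. Qed.

Lemma KT_emb a : ratr (KT a) = emb 0 a + emb 1 a + emb 2 a :> realalg.
Proof. by rewrite -(embC 0) KT_gal !embD. Qed.
Lemma KN_emb a : ratr (KN a) = emb 0 a * emb 1 a * emb 2 a :> realalg.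
Proof. by rewrite -(embC 0) -Kcof_mul embM -mulrA; congr (_ * _); rewrite embM. Qed.

Lemma emb_eq0 k a : emb k a = 0 -> a = 0.
Proof.
move=> ek; have : iter k (@Kgal rat) a = 0.
  apply: KN_rat_eq0; apply/eqP; rewrite -(fmorph_eq0 (@ratr realalg)) /= KN_emb.
  by rewrite -[emb 0 _]/(emb k a) ek !mul0r.
elim: k {ek} a => //= k IH a E; apply: IH.
by rewrite -[LHS]Kgal3 E !raddf0.
Qed.

Lemma emb_c k : (k < 3)%N -> -2 < emb k Kc < 2.
Proof.
have c1 := realc_gt; have c2 := realc_lt.
have e a : emb0 a = ratr (K0 a) + ratr (K1 a) * realc + ratr (K2 a) * realc ^+ 2 by [].
case: k => [|[|[|//]]] _; rewrite /emb e /= /Kgal /Kc !KE ?rmorphD ?rmorphN ?rmorphMn ?rmorph0 ?rmorph1 /=.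
- by apply/andP; split; lra.
- by rewrite expr2; apply/andP; split; nra.
by rewrite expr2; apply/andP; split; nra.
Qed.

Definition tnn (a : OK rat) := forall k, (k < 3)%N -> 0 <= emb k a.

Lemma tnnD a b : tnn a -> tnn b -> tnn (a + b).
Proof. by move=> ha hb k lk; rewrite embD addr_ge0 ?ha ?hb. Qed.
Lemma tnn_sqr a : tnn (a ^+ 2).
Proof. by move=> k _; rewrite expr2 embM -expr2 sqr_ge0. Qed.
(** Every embedding of c lies between -2 and 2, so x^2 + c x y + y^2 is positive definite; complete
    the square. *)
Lemma tnn_Lnorm (a : OL rat) : tnn (Lnorm a).
Proof.
move=> k lk; have /andP[c1 c2] := emb_c lk.
rewrite /Lnorm !embD !expr2 !embM.
move: (emb k Kc) c1 c2 (emb k (L0 a)) (emb k (L1 a)) => c c1 c2 x y.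
have -> : x * x + c * x * y + y * y = (x + c / 2 * y) ^+ 2 + (1 - c ^+ 2 / 4) * y ^+ 2 by field.
by rewrite addr_ge0 ?sqr_ge0 // mulr_ge0 ?sqr_ge0 //; nra.
Qed.

Lemma KN_ge0 a : tnn a -> 0 <= KN a.
Proof.
move=> ha; rewrite -(ler0q realalg) KN_emb.
by rewrite !mulr_ge0 //; exact: ha.
Qed.
Lemma KT_ge0 a : tnn a -> 0 <= KT a.
Proof.
move=> ha; rewrite -(ler0q realalg) KT_emb.
have := ha 0%N isT; have := ha 1%N isT; have := ha 2%N isT; lra.
Qed.
Lemma KT_le0 a : tnn a -> KT a <= 0 -> a = 0.
Proof.
move=> ha; rewrite -(lerq0 realalg) KT_emb => h; apply: (@emb_eq0 0).
have := ha 0%N isT; have := ha 1%N isT; have := ha 2%N isT; lra.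
Qed.
Lemma tnn_add_eq0 a b : tnn a -> tnn b -> a + b = 0 -> a = 0 /\ b = 0.
Proof.
move=> ha hb ab; have := congr1 (@KT rat) ab; rewrite KTD.
have -> : KT (0 : OK rat) = 0 by rewrite /KT !KE; ring.
have ta := KT_ge0 ha; have tb := KT_ge0 hb => t0.
by split; apply: KT_le0 => //; lra.
Qed.
Lemma KN_superadd a b : tnn a -> tnn b -> KN a + KN b <= KN (a + b).
Proof.
move=> ha hb; rewrite -(ler_rat realalg) rmorphD /= !KN_emb !embD.
have := ha 0%N isT; have := ha 1%N isT; have := ha 2%N isT.
have := hb 0%N isT; have := hb 1%N isT; have := hb 2%N isT.
move: (emb 0 a) (emb 1 a) (emb 2 a) (emb 0 b) (emb 1 b) (emb 2 b) => x y z x' y' z'.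
move=> z'0 y'0 x'0 z0 y0 x0.
rewrite -subr_ge0; set d := _ - _.
have -> : d = x * y * z' + x * y' * z + x * y' * z' + x' * y * z + x' * y * z' + x' * y' * z.
  by rewrite /d; ring.
by rewrite !addr_ge0 // !mulr_ge0.
Qed.
Lemma KN_AMGM a : tnn a -> KN a * 27 <= KT a ^+ 3.
Proof.
move=> ha; rewrite -(ler_rat realalg) rmorphM rmorphXn /= !KN_emb KT_emb rmorph_nat.
have := ha 0%N isT; have := ha 1%N isT; have := ha 2%N isT.
move: (emb 0 a) (emb 1 a) (emb 2 a) => x y z z0 y0 x0.
rewrite -subr_ge0; set d := _ - _.
have -> : d = (x + y + z) / 2 * ((x - y) ^+ 2 + (y - z) ^+ 2 + (z - x) ^+ 2)
    + 3 * (x * (y - z) ^+ 2 + y * (z - x) ^+ 2 + z * (x - y) ^+ 2) by rewrite /d; field.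
have q u v : 0 <= u -> 0 <= u * v ^+ 2 :> realalg by move=> u0; rewrite mulr_ge0 ?sqr_ge0.
have := q x (y - z) x0; have := q y (z - x) y0; have := q z (x - y) z0.
have s0 : 0 <= (x + y + z) / 2 by lra.
have := q _ (x - y) s0; have := q _ (y - z) s0; have := q _ (z - x) s0.
by move: ((x + y + z) / 2) => s; rewrite !mulrDr; lra.
Qed.
(** By the AM-GM inequality. Traces of norms are quadratic forms in the coordinates and far easier
    to bound than norms, so the arguments in Z[c], Z[zeta] and [Lam] all bound a trace by 3. *)
Lemma KN_lt1 a : tnn a -> KT a < 3 -> KN a < 1.
Proof.
move=> ha lt3; have := KN_AMGM ha; have := KT_ge0 ha; move: lt3.
move: (KT a) (KN a) => t n t3 t0 h.
have : t ^+ 3 < 27; last by lra.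
have -> : t ^+ 3 = t * t * t by ring.
by nra.
Qed.

Lemma Lnorm_eq0 (a : OL rat) : Lnorm a = 0 -> a = 0.
Proof.
move=> /(congr1 (emb 0)); have /andP[c1 c2] := @emb_c 0 isT.
have e00 : emb 0 0 = 0 := raddf0 emb0.
rewrite /Lnorm !embD !expr2 !embM e00.
have h (c x y : realalg) : -2 < c -> c < 2 -> x * x + c * x * y + y * y = 0 -> y = 0 /\ x = 0.
  move=> h1 h2.
  have -> : x * x + c * x * y + y * y = (x + c / 2 * y) ^+ 2 + (1 - c ^+ 2 / 4) * y ^+ 2 by field.
  have p : 0 < 1 - c ^+ 2 / 4 by nra.
  move=> /eqP; rewrite paddr_eq0 ?sqr_ge0 //; last exact: mulr_ge0 (ltW p) (sqr_ge0 _).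
  rewrite sqrf_eq0 mulf_eq0 (gt_eqF p) sqrf_eq0 /= => /andP[/eqP e /eqP y0].
  by rewrite y0 in e *; split=> //; rewrite mulr0 addr0 in e.
move=> /(h _ _ _ c1 c2)[/emb_eq0 e1 /emb_eq0 e0].
by apply: L_ext.
Qed.

(** * Euclidean division *)

Definition lideal (T : nzRingType) (I : T -> Prop) :=
  [/\ I 0, forall a b, I a -> I b -> I (a + b) & forall r a, I a -> I (r * a)].

Lemma lidealB (T : nzRingType) (I : T -> Prop) a b : lideal I -> I a -> I b -> I (a - b).
Proof. by move=> [_ D M] Ia Ib; apply: D => //; rewrite -mulN1r; apply: M. Qed.

Lemma euclid_principal (T : nzRingType) (N : T -> nat) (I : T -> Prop) :
    (forall a b, b <> 0 -> exists q, (N (a - q * b)%R < N b)%N) -> lideal I ->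
  exists2 g, I g & forall a, I a -> exists q, a = q * g.
Proof.
move=> div hI; have [I0 ID IM] := hI.
case: (classic (exists2 g, I g & g <> 0)) => [[g Ig g0]|no]; last first.
  exists 0 => // a Ia; exists 0; rewrite mul0r; apply: NNPP => a0; apply: no.
  by exists a.
move: {2}(N g).+1 (ltnSn (N g)) => n; elim: n g Ig g0 => // n IH g Ig g0 ltn.
case: (classic (forall a, I a -> exists q, a = q * g)) => [h|]; first by exists g.
move=> /not_all_ex_not[a /(imply_to_and (I a))[Ia nq]].
have [q ltq] := div a g g0.
apply: (IH (a - q * g)).
- by apply: lidealB => //; apply: IM.
- by move=> /eqP; rewrite subr_eq0 => /eqP e; apply: nq; exists q.
by apply: leq_trans ltq _; rewrite -ltnS.
Qed.

Lemma rat_round (r : rat) : exists n : int, -1 / 2 <= r - n%:~R <= 1 / 2.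
Proof.
exists (Num.floor (r + 1 / 2)).
have /andP[h1 h2] := floor_itv (r + 1 / 2); rewrite rmorphD /= in h2.
by apply/andP; split; lra.
Qed.

(** The element q0 + q1 zeta + ... + q6 zeta^6. The redundancy is deliberate: adding the same number
    to all seven coefficients changes nothing, which frees a parameter for the covering bound. *)
Definition zsum (F : comNzRingType) (q0 q1 q2 q3 q4 q5 q6 : F) : OL F :=
  mkL (mkK (q0 - q2 + q4 - q5) (q6 - q3) (q5 - q4)) (mkK (q1 - q3 + q4 - q6) (q2 - q5) (q3 - q4)).

Lemma zsumP (F : comNzRingType) (a : OL F) :
  exists q0 q1 q2 q3 q4 q5 q6, a = zsum q0 q1 q2 q3 q4 q5 q6.
Proof.
pose u0 := K0 (L0 a); pose u1 := K1 (L0 a); pose u2 := K2 (L0 a).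
pose v0 := K0 (L1 a); pose v1 := K1 (L1 a); pose v2 := K2 (L1 a).
exists (u0 + v1 + u2 *+ 2 - u1 - v2), (v0 + v2), (v1 + u2 - u1 - v2), (- u1),
  (- u1 - v2), (u2 - u1 - v2), 0.
by apply: L_ext; apply: K_ext; rewrite /zsum !LE !KE /u0 /u1 /u2 /v0 /v1 /v2; ring.
Qed.

(** The right-hand side is the sum of (q_i - q_j)^2 over all pairs: up to scaling, the form of the
    dual of the root lattice A6. *)
Lemma KT_Lnorm_zsum (F : comNzRingType) (q0 q1 q2 q3 q4 q5 q6 : F) :
  KT (Lnorm (zsum q0 q1 q2 q3 q4 q5 q6)) *+ 2 =
  (q0 ^+ 2 + q1 ^+ 2 + q2 ^+ 2 + q3 ^+ 2 + q4 ^+ 2 + q5 ^+ 2 + q6 ^+ 2) *+ 7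
  - (q0 + q1 + q2 + q3 + q4 + q5 + q6) ^+ 2.
Proof. by rewrite /Lnorm /zsum !LE !expr2 /KT /Kc !KE; ring. Qed.

Lemma sum_centered_squares (d : int) (n : nat) :
  (\sum_(m < n) (m%:Z *+ 2 + 1 - d) ^+ 2) *+ 3 =
  n%:Z * (n%:Z ^+ 2 *+ 4 - 1) - d * n%:Z ^+ 2 *+ 6 + d ^+ 2 * n%:Z *+ 3.
Proof.
elim: n => [|n IH]; first by rewrite big_ord0; ring.
rewrite big_ord_recr /= mulrnDl IH.
have -> : n.+1%:Z = n%:Z + 1 by rewrite -addn1 PoszD.
by ring.
Qed.

(* Averaging over the common translate k: each residue class is equidistributed. *)
Lemma equidistributed_shift (D : nat) (a : 'I_7 -> int) : (0 < D)%N ->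
  exists k : int, (\sum_i (((a i + k) %% D)%Z *+ 2 + 1 - D%:Z) ^+ 2) *+ 3 <= (D%:Z ^+ 2 - 1) *+ 7.
Proof.
case: D => // D _; pose d := D.+1%:Z.
pose f (m : 'I_D.+1) : int := (m%:Z *+ 2 + 1 - d) ^+ 2.
pose S (k : 'I_D.+1) := (\sum_(i < 7) (((a i + k%:Z) %% d)%Z *+ 2 + 1 - d) ^+ 2) *+ 3.
have tot : \sum_k S k = \sum_(k < D.+1) (d ^+ 2 - 1) *+ 7.
  rewrite sumr_const card_ord /S sumrMnl exchange_big /=.
  transitivity ((\sum_(i < 7) \sum_(k < D.+1) f k) *+ 3).
    congr (_ *+ 3); apply: eq_bigr => i _; symmetry.
    rewrite (reindex_inj (addrI (inZp `|(a i %% d)%Z|%N : 'I_D.+1))) /=.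
    apply: eq_bigr => k _; rewrite /f /=; congr ((_ *+ 2 + 1 - d) ^+ 2).
    have ad : (`|(a i %% d)%Z|%N : int) = (a i %% d)%Z by rewrite gez0_abs // modz_ge0.
    by rewrite modnDml -modz_nat PoszD ad modzDml.
  rewrite sumr_const card_ord -mulrnA mulnC mulrnA sum_centered_squares -/d.
  by rewrite -[(_ *+ 7 *+ D.+1)]mulr_natr -[D.+1%:R]/(D.+1%:R) natz -/d; ring.
have [/existsP[k hk]|] := boolP [exists k, S k <= (d ^+ 2 - 1) *+ 7].
  by exists k%:Z.
rewrite negb_exists => /forallP h; exfalso.
have : \sum_(k < D.+1) (d ^+ 2 - 1) *+ 7 < \sum_k S k.
  apply: ltr_sum => [|k _]; first by apply/hasP; exists ord0; rewrite ?mem_index_enum.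
  by rewrite ltNge h.
by rewrite tot ltxx.
Qed.

Lemma common_denom7 (q : 'I_7 -> rat) : exists D : nat, exists a : 'I_7 -> int,
  (0 < D)%N /\ forall i, q i = (a i)%:~R / D%:R.
Proof.
pose D : int := \prod_i denq (q i).
have D0 : 0 < D by apply: prodr_gt0 => i _; rewrite denq_gt0.
exists `|D|%N, (fun i => numq (q i) * \prod_(j | j != i) denq (q j)); split.
  by rewrite absz_gt0 gt_eqF.
move=> i; have -> : `|D|%N%:R = D%:~R :> rat by rewrite -[in RHS](gez0_abs (ltW D0)).
have Di : D%:~R != 0 :> rat by rewrite intr_eq0 gt_eqF.
apply: (mulIf Di); rewrite divfK // /D (bigD1 i) //= !rmorphM /= mulrA numqE //.
Qed.

Lemma big_ord7 (f : 'I_7 -> rat) : \sum_i f i = f (inord 0) + f (inord 1) + f (inord 2)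
  + f (inord 3) + f (inord 4) + f (inord 5) + f (inord 6).
Proof.
rewrite (eq_bigr (fun i : 'I_7 => f (inord i))); last by move=> i _; rewrite inord_val.
by rewrite !big_ord_recr big_ord0 /= add0r.
Qed.

(** After a suitable common shift the seven centred rounding errors have mean square at most 1/12,
    as for a uniform distribution. So their squares sum to at most 7/12, and the trace is at most
    7/2 times that. *)
Lemma L_covering (b : OL rat) :
  exists x : OL int, KT (Lnorm (b - Lmap intq x)) <= 49 / 24.
Proof.
have [q0 [q1 [q2 [q3 [q4 [q5 [q6 ->]]]]]]] := zsumP b.
pose q (i : 'I_7) := nth 0 [:: q0; q1; q2; q3; q4; q5; q6] i.
have [D [a [D0 qa]]] := common_denom7 q.
have [k hk] := equidistributed_shift a D0.
pose x i := ((a i + k) %/ D)%Z; pose m i := ((a i + k) %% D)%Z.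
have Dr : D%:R != 0 :> rat by rewrite pnatr_eq0 -lt0n.
(* [t] is the part common to all seven errors, which drops out of [zsum]; [d i] is a residue mod D,
   centred and divided by D. *)
pose t : rat := (D%:R - k%:~R *+ 2 - 1) / (D%:R *+ 2).
pose d i : rat := ((m i)%:~R *+ 2 + 1 - D%:R) / (D%:R *+ 2).
have qx i : q i - (x i)%:~R = d i + t.
  have e : (a i)%:~R = (x i)%:~R * D%:R + (m i)%:~R - k%:~R :> rat.
    rewrite -[D%:R]/((D : int)%:~R) -rmorphM -rmorphD -rmorphB /=; congr (_%:~R).
    by rewrite -divz_eq addrK.
  by rewrite qa e /d /t; field.
exists (zsum (x (inord 0)) (x (inord 1)) (x (inord 2)) (x (inord 3)) (x (inord 4))
  (x (inord 5)) (x (inord 6))).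
have B (y0 y1 y2 y3 y4 y5 y6 : int) :
  zsum q0 q1 q2 q3 q4 q5 q6 - Lmap intq (zsum y0 y1 y2 y3 y4 y5 y6) =
  zsum (q0 - y0%:~R) (q1 - y1%:~R) (q2 - y2%:~R) (q3 - y3%:~R) (q4 - y4%:~R)
    (q5 - y5%:~R) (q6 - y6%:~R).
  apply: L_ext; apply: K_ext; rewrite /Lmap /zsum !LE /Kmap !KE /= ?rmorphD ?rmorphN /=; ring.
rewrite B.
have qi i (hi : (i < 7)%N) : nth 0 [:: q0; q1; q2; q3; q4; q5; q6] i = q (inord i).
  by rewrite /q inordK.
have := (qi 0%N isT, qi 1%N isT, qi 2%N isT, qi 3%N isT, qi 4%N isT, qi 5%N isT, qi 6%N isT).
rewrite /= => [[[[[[[e0 e1] e2] e3] e4] e5] e6]].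
rewrite {}e0 {}e1 {}e2 {}e3 {}e4 {}e5 {}e6 !qx.
have hd : (\sum_i d i ^+ 2) <= 7 / 12.
  have -> : \sum_i d i ^+ 2 = ((\sum_i ((m i) *+ 2 + 1 - D%:Z) ^+ 2) *+ 3)%:~R / (D%:R ^+ 2 * 12).
    rewrite rmorphMn /= rmorph_sum /= -[X in X / _]mulr_natl big_distrr /= big_distrl /=.
    apply: eq_bigr => i _; rewrite /d !(rmorphXn, rmorphB, rmorphD, rmorphMn) /=.
    by rewrite -pmulrn; field.
  have p12 : 0 < D%:R ^+ 2 * 12 :> rat.
    by apply: mulr_gt0 => //; apply: exprn_gt0; rewrite ltr0n.
  rewrite (ler_pdivrMr _ _ p12).
  apply: le_trans (_ : ((D%:Z ^+ 2 - 1) *+ 7)%:~R <= _); first by rewrite ler_int.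
  rewrite rmorphMn rmorphB rmorphXn /= -pmulrn.
  have -> : 7 / 12 * (D%:R ^+ 2 * 12) = D%:R ^+ 2 *+ 7 :> rat by field.
  by rewrite lerMn2r /= lerBlDr lerDl.
move: hd; rewrite big_ord7.
move: (d _) (d _) (d _) (d _) (d _) (d _) (d _) => d6 d5 d4 d3 d2 d1 d0 hd.
have := KT_Lnorm_zsum (d0 + t) (d1 + t) (d2 + t) (d3 + t) (d4 + t) (d5 + t) (d6 + t).
set T := KT _ => ET; have := sqr_ge0 (d0 + d1 + d2 + d3 + d4 + d5 + d6) => sq.
have : T *+ 2 = (d0 ^+ 2 + d1 ^+ 2 + d2 ^+ 2 + d3 ^+ 2 + d4 ^+ 2 + d5 ^+ 2 + d6 ^+ 2) *+ 7
  - (d0 + d1 + d2 + d3 + d4 + d5 + d6) ^+ 2 by rewrite ET; ring.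
by move: T ((d0 + d1 + d2 + d3 + d4 + d5 + d6) ^+ 2) sq hd {ET} => T w; lra.
Qed.

Lemma Linv (b : OL rat) : b <> 0 -> exists b', b * b' = 1.
Proof.
move=> b0; pose n := KN (Lnorm b).
have n0 : n != 0 by apply/eqP=> /KN_rat_eq0 /Lnorm_eq0.
exists (Lconj b * LC (Kcof (Lnorm b) * KC n^-1)).
by rewrite mulrA Lnorm_conj -rmorphM mulrA Kcof_mul -rmorphM mulfV.
Qed.

Lemma Lmap_intq_inj : injective (Lmap intq).
Proof.
move=> a b E; apply: L_ext; apply: Kmap_intq_inj.
  exact: (congr1 (@L0 _) E).
exact: (congr1 (@L1 _) E).
Qed.

Lemma KN_intq (a : OK int) : (KN a)%:~R = KN (Kmap intq a) :> rat.
Proof. by rewrite KN_map. Qed.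
Lemma KN_Lnorm_intq (a : OL int) : (KN (Lnorm a))%:~R = KN (Lnorm (Lmap intq a)) :> rat.
Proof. by rewrite Lnorm_map KN_map. Qed.

Lemma KN_Lnorm_int (a : OL int) : 0 <= KN (Lnorm a).
Proof.
have := KN_ge0 (tnn_Lnorm (Lmap intq a)).
by rewrite Lnorm_map KN_map /= ler0z.
Qed.

Lemma L_principal (I : OL int -> Prop) : lideal I ->
  exists2 g, I g & forall a, I a -> exists q, a = q * g.
Proof.
apply: (@euclid_principal _ (fun a => `|KN (Lnorm a)|%N)) => a b b0.
have b0' : Lmap intq b <> 0 by rewrite -(rmorph0 (Lmap intq)) => /Lmap_intq_inj.
have [b' bb'] := Linv b0'; have [x hx] := L_covering (Lmap intq a * b').
exists x; have /KN_lt1 lt1 := tnn_Lnorm (Lmap intq a * b' - Lmap intq x).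
have {}lt1 := lt1 (le_lt_trans hx _).
have nb : 0 < KN (Lnorm b).
  rewrite lt_neqAle KN_Lnorm_int andbT eq_sym; apply/eqP=> h; apply: b0'.
  by apply: Lnorm_eq0; apply: KN_rat_eq0; rewrite Lnorm_map KN_map h.
rewrite -ltz_nat !gez0_abs ?KN_Lnorm_int // -(ltr_int rat).
rewrite !KN_Lnorm_intq.
have -> : Lmap intq (a - x * b) = (Lmap intq a * b' - Lmap intq x) * Lmap intq b.
  by rewrite mulrBl -mulrA [b' * _]mulrC bb' mulr1 rmorphB rmorphM.
rewrite LnormM KNM -[X in _ < X]mul1r ltr_pM2r; first by apply: lt1; lra.
by rewrite Lnorm_map KN_map ltr0z.
Qed.

(** The quotient is rounded one coordinate at a time along an orthogonal decomposition of the form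
    KT (e^2). With all three errors at most 1/2 this form is at most 3/4 + 14/3 (1/4 + 3/16), which
    is below 3. *)
Lemma K_principal (I : OK int -> Prop) : lideal I ->
  exists2 g, I g & forall a, I a -> exists q, a = q * g.
Proof.
apply: (@euclid_principal _ (fun a => `|KN a|%N)) => a b b0.
pose bq := Kmap intq b; have nb : KN bq != 0.
  by apply/eqP=> /KN_rat_eq0; rewrite /bq -(rmorph0 (Kmap intq)) => /Kmap_intq_inj.
pose b' := Kcof bq * KC (KN bq)^-1.
have bb' : bq * b' = 1 by rewrite mulrA Kcof_mul -rmorphM mulfV // rmorph1.
have [y yb] : exists y, y * bq = Kmap intq a.
  by exists (Kmap intq a * b'); rewrite -mulrA [b' * _]mulrC bb' mulr1.
have [r /andP[r1 r2]] := rat_round (K2 y).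
have [q /andP[q1 q2]] := rat_round (K1 y - (K2 y - r%:~R) / 2).
have [p /andP[p1 p2]] := rat_round (K0 y + K2 y * 2
    - (K1 y - q%:~R + (K2 y - r%:~R)) / 3).
exists (mkK (p - r *+ 2) q r).
set x := mkK _ _ _.
have [e Ee] : exists e, e = y - Kmap intq x by exists (y - Kmap intq x).
have e0 : K0 e = K0 y - p%:~R + r%:~R * 2.
  by rewrite Ee /x /Kmap !KE /= rmorphB rmorphMn /=; ring.
have e1 : K1 e = K1 y - q%:~R by rewrite Ee /x /Kmap !KE.
have e2 : K2 e = K2 y - r%:~R by rewrite Ee /x /Kmap !KE.
have lt3 : KT (e ^+ 2) < 3.
  pose v := K2 e; pose u := K1 e - K2 e / 2.
  pose w := K0 e + K2 e * 2 - (K1 e + K2 e) / 3.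
  have -> : KT (e ^+ 2) = 3 * w ^+ 2 + 14 / 3 * (u ^+ 2 + 3 / 4 * v ^+ 2).
    by rewrite expr2 /KT !KE /w /u /v; field.
  have sq (s : rat) : -1 / 2 <= s -> s <= 1 / 2 -> s ^+ 2 <= 1 / 4 by move=> h1 h2; nra.
  have hv : v ^+ 2 <= 1 / 4 by apply: sq; rewrite /v e2.
  have hu : u ^+ 2 <= 1 / 4 by apply: sq; rewrite /u e1 e2; move: q1 q2; lra.
  have hw : w ^+ 2 <= 1 / 4 by apply: sq; rewrite /w e0 e1 e2; move: p1 p2; lra.
  by move: (v ^+ 2) (u ^+ 2) (w ^+ 2) hv hu hw => *; lra.
have := KN_lt1 (tnn_sqr e) lt3; rewrite expr2 KNM -expr2 => ltN.
have E : KN (Kmap intq (a - x * b)) = KN e * KN bq.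
  by rewrite -KNM Ee mulrBl yb rmorphB rmorphM.
rewrite -ltz_nat -(ltr_int rat) !abszE !intr_norm.
rewrite !KN_intq E normrM -[X in _ < X]mul1r.
rewrite ltr_pM2r ?normr_gt0 //.
by rewrite -(expr_lt1 (isT : (0 < 2)%N)) ?normr_ge0 // real_normK ?num_real.
Qed.

Definition Zi_norm (a : Zi) : int := a.1 ^+ 2 + a.2 ^+ 2.
Lemma Zi_norm_M a b : Zi_norm (a * b) = Zi_norm a * Zi_norm b.
Proof. by rewrite /Zi_norm twE /= !expr1; ring. Qed.

Lemma Zi_mulC (a b : Zi) : a * b = b * a.
Proof. by rewrite !twE /=; congr pair; ring. Qed.

(** * Balancing by units of Z[c] *)

Section Balance.
Variable F : realFieldType.

(** Convexity of the cube on nonnegative numbers; the factorization of [d] is the gap between chord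
    and graph. *)
Lemma cube_le_chord (a k l u t : F) : 0 <= a -> 0 <= l -> l <= t -> t <= u ->
  (a + l) ^+ 3 <= k * l -> (a + u) ^+ 3 <= k * u -> (a + t) ^+ 3 <= k * t.
Proof.
move=> a0 l0 lt tu hl hu.
have [e|ne] := eqVneq l u; first by have -> : t = l by lra.
have lu : 0 < u - l by rewrite subr_gt0 lt_neqAle ne (le_trans lt).
rewrite -(ler_pM2r lu).
have C : (a + t) ^+ 3 * (u - l) <= (a + l) ^+ 3 * (u - t) + (a + u) ^+ 3 * (t - l).
  rewrite -subr_ge0; set d := _ - _.
  have -> : d = (u - t) * (t - l) * (u - l) * (3 * a + u + t + l) by rewrite /d; ring.
  by rewrite !mulr_ge0 //; lra.
apply: le_trans C _.
have h1 : (a + l) ^+ 3 * (u - t) <= k * l * (u - t) by rewrite ler_wpM2r //; lra.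
have h2 : (a + u) ^+ 3 * (t - l) <= k * u * (t - l) by rewrite ler_wpM2r //; lra.
by apply: le_trans (lerD h1 h2) _; rewrite le_eqVlt; apply/orP; left; apply/eqP; ring.
Qed.

(* By convexity it is enough to check the four corners of a box. *)
Lemma cube_le_box (l1 u1 l2 u2 y z : F) :
  0 <= l1 -> 0 <= l2 -> l1 <= y -> y <= u1 -> l2 <= z -> z <= u2 ->
  (1 + l1 + l2) ^+ 3 <= 140 * l1 * l2 -> (1 + l1 + u2) ^+ 3 <= 140 * l1 * u2 ->
  (1 + u1 + l2) ^+ 3 <= 140 * u1 * l2 -> (1 + u1 + u2) ^+ 3 <= 140 * u1 * u2 ->
  (1 + y + z) ^+ 3 <= 140 * y * z.
Proof.
move=> l10 l20 ly yu lz zu h1 h2 h3 h4.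
have g1 : (1 + l1 + z) ^+ 3 <= 140 * l1 * z by apply: (@cube_le_chord _ _ l2 u2) => //; lra.
have g2 : (1 + u1 + z) ^+ 3 <= 140 * u1 * z by apply: (@cube_le_chord _ _ l2 u2) => //; lra.
have -> : 1 + y + z = (1 + z) + y by ring.
have -> : 140 * y * z = 140 * z * y by ring.
apply: (@cube_le_chord _ _ l1 u1) => //; first lra.
  have -> : 1 + z + l1 = 1 + l1 + z by ring.
  by have -> : 140 * z * l1 = 140 * l1 * z by ring.
have -> : 1 + z + u1 = 1 + u1 + z by ring.
by have -> : 140 * z * u1 = 140 * u1 * z by ring.
Qed.

(** Scale the largest variable to 1. The two linear conditions are two of the six in [cube_le_sum3]
    with like terms collected (79/100 = 1 - 21/100, 227/100 = 327/100 - 1, and so on). They confine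
    the other two variables to one of two boxes. *)
Lemma cube_le_balanced (x y z : F) : 0 <= y -> 0 <= z -> y <= x -> z <= x ->
  79 / 100 * x <= 227 / 100 * y + 56 / 100 * z ->
  68 / 100 * x + 35 / 100 * y <= 412 / 100 * z ->
  (x + y + z) ^+ 3 <= 140 * (x * y * z).
Proof.
move=> y0 z0 yx zx h1 h2.
have [x0|x0] := eqVneq x 0.
  have -> : x = 0 by []. have -> : y = 0 by lra. have -> : z = 0 by lra.
  by rewrite !addr0 expr0n !mulr0.
have xp : 0 < x by rewrite lt_neqAle eq_sym x0 (le_trans y0).
pose Y := y / x; pose Z := z / x.
have Ey : y = Y * x by rewrite /Y divfK.
have Ez : z = Z * x by rewrite /Z divfK.
suff : (1 + Y + Z) ^+ 3 <= 140 * Y * Z.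
  move=> h; have x3 : 0 <= x ^+ 3 by rewrite exprn_ge0 // ltW.
  have := ler_wpM2r x3 h; rewrite Ey Ez.
  have -> : (1 + Y + Z) ^+ 3 * x ^+ 3 = (x + Y * x + Z * x) ^+ 3 by ring.
  by have -> : 140 * Y * Z * x ^+ 3 = 140 * (x * (Y * x) * (Z * x)) by ring.
have Y0 : 0 <= Y by rewrite divr_ge0 // ltW.
have Z0 : 0 <= Z by rewrite divr_ge0 // ltW.
have Y1 : Y <= 1 by rewrite ler_pdivrMr // mul1r.
have Z1 : Z <= 1 by rewrite ler_pdivrMr // mul1r.
have {}h1 : 79 / 100 <= 227 / 100 * Y + 56 / 100 * Z.
  by rewrite -(ler_pM2r xp); move: h1; rewrite {1}Ey {1}Ez; lra.
have {}h2 : 68 / 100 + 35 / 100 * Y <= 412 / 100 * Z.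
  by rewrite -(ler_pM2r xp); move: h2; rewrite {1}Ey {1}Ez; lra.
have [Zh|Zh] := lerP Z (1 / 2).
  by apply: (@cube_le_box (22 / 100) 1 (16 / 100) (1 / 2)); lra.
by apply: (@cube_le_box (1 / 10) 1 (1 / 2) 1); lra.
Qed.

(** Here x, y, z will be the squared embeddings of an element, and the six inequalities say that no
    conjugate of c or c^-1 shortens it. The best constant in AM-GM would be 27; 140 is what the
    boxes afford while staying below 169 (23/24)^3, about 148.7, as [cube_lt] requires. *)
Lemma cube_le_sum3 (a b c a' b' c' x y z : F) :
    a < 156 / 100 -> b < 21 / 100 -> c < 327 / 100 ->
    a' < 65 / 100 -> b' < 512 / 100 -> c' < 32 / 100 ->
    0 <= x -> 0 <= y -> 0 <= z ->
    x + y + z <= a * x + b * y + c * z ->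
    x + y + z <= b * x + c * y + a * z ->
    x + y + z <= c * x + a * y + b * z ->
    x + y + z <= a' * x + b' * y + c' * z ->
    x + y + z <= b' * x + c' * y + a' * z ->
    x + y + z <= c' * x + a' * y + b' * z ->
  (x + y + z) ^+ 3 <= 140 * (x * y * z).
Proof.
move=> ha hb hc ha' hb' hc' x0 y0 z0.
have m (u v w U V W : F) : u < U -> v < V -> w < W ->
    x + y + z <= u * x + v * y + w * z -> x + y + z <= U * x + V * y + W * z.
  by move=> /ltW h1 /ltW h2 /ltW h3 h; apply: le_trans h _; rewrite !lerD // ler_wpM2r.
move=> /(m _ _ _ _ _ _ ha hb hc) e1 /(m _ _ _ _ _ _ hb hc ha) e2 /(m _ _ _ _ _ _ hc ha hb) e3.
move=> /(m _ _ _ _ _ _ ha' hb' hc') e4 /(m _ _ _ _ _ _ hb' hc' ha') e5.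
move=> /(m _ _ _ _ _ _ hc' ha' hb') e6 {m}; clear a b c a' b' c' ha hb hc ha' hb' hc'.
have [hx|hx] := lerP x y.
  have [hy|hy] := lerP y z.
    have -> : x + y + z = z + x + y by ring.
    have -> : x * y * z = z * x * y by ring.
    by apply: cube_le_balanced; lra.
  have -> : x + y + z = y + z + x by ring.
  have -> : x * y * z = y * z * x by ring.
  by apply: cube_le_balanced; lra.
have [hy|hy] := lerP x z; last by apply: cube_le_balanced; lra.
have -> : x + y + z = z + x + y by ring.
have -> : x * y * z = z * x * y by ring.
by apply: cube_le_balanced; lra.
Qed.

Lemma c_bounds (c : F) : 623 / 500 < c -> c < 156 / 125 ->
  [/\ c ^+ 2 < 156 / 100, (c ^+ 2 - 2) ^+ 2 < 21 / 100 & (1 - c - c ^+ 2) ^+ 2 < 327 / 100] /\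
  [/\ (c ^+ 2 + c - 2) ^+ 2 < 65 / 100, (- c - 1) ^+ 2 < 512 / 100 &
      (1 - c ^+ 2) ^+ 2 < 32 / 100].
Proof.
move=> c1 c2.
have cc1 : 155 / 100 < c ^+ 2 by rewrite expr2; nra.
have cc2 : c ^+ 2 < 1558 / 1000 by rewrite expr2; nra.
by split; split; nra.
Qed.
End Balance.

Definition Kci (F : comNzRingType) : OK F := mkK (-2) 1 1.
Arguments Kci {F}.
Lemma Kc_unit (F : comNzRingType) : Kc * Kci = 1 :> OK F.
Proof. by apply: K_ext; rewrite /Kc /Kci !KE; ring. Qed.

Lemma emb0E a : emb0 a = ratr (K0 a) + ratr (K1 a) * realc + ratr (K2 a) * realc ^+ 2.
Proof. by []. Qed.

Lemma ratr_cube_le (F : realFieldType) (T N : rat) (k : nat) :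
  (T ^+ 3 <= k%:R * N ^+ 2) = ((ratr T : F) ^+ 3 <= k%:R * ratr N ^+ 2).
Proof.
rewrite -(ler_rat F).
have -> : ratr (T ^+ 3) = ratr T ^+ 3 :> F by exact: rmorphXn.
have -> // : ratr (k%:R * N ^+ 2) = k%:R * ratr N ^+ 2 :> F.
by rewrite (rmorphM (@ratr F) k%:R) (rmorphXn (@ratr F)) /= ratr_nat.
Qed.

Lemma balanced_rat (y : OK rat) :
    (forall k, (k < 3)%N -> KT (y ^+ 2) <= KT ((iter k (@Kgal rat) Kc * y) ^+ 2)) ->
    (forall k, (k < 3)%N -> KT (y ^+ 2) <= KT ((iter k (@Kgal rat) Kci * y) ^+ 2)) ->
  KT (y ^+ 2) ^+ 3 <= 140 * KN y ^+ 2.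
Proof.
move=> hc hi.
pose u k := emb k y ^+ 2.
have u0 k : 0 <= u k by exact: sqr_ge0.
have TE (g : OK rat) : ratr (KT ((g * y) ^+ 2)) =
    emb 0 g ^+ 2 * u 0%N + emb 1 g ^+ 2 * u 1%N + emb 2 g ^+ 2 * u 2%N :> realalg.
  by rewrite KT_emb expr2 !embM /u; ring.
have Ty : ratr (KT (y ^+ 2)) = u 0%N + u 1%N + u 2%N :> realalg.
  by rewrite KT_emb expr2 !embM /u !expr2.
rewrite (ratr_cube_le realalg _ _ 140) Ty KN_emb.
have -> : 140 * (emb 0 y * emb 1 y * emb 2 y) ^+ 2 = 140 * (u 0%N * u 1%N * u 2%N) :> realalg.
  by rewrite /u; ring.
pose c := realc; have c1 : 623 / 500 < c := realc_gt; have c2 : c < 156 / 125 := realc_lt.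
have hc' k (lk : (k < 3)%N) : u 0%N + u 1%N + u 2%N <= emb k Kc ^+ 2 * u 0%N
   + emb k.+1 Kc ^+ 2 * u 1%N + emb k.+2 Kc ^+ 2 * u 2%N.
  by have := hc k lk; rewrite -(ler_rat realalg) Ty TE.
have hi' k (lk : (k < 3)%N) : u 0%N + u 1%N + u 2%N <= emb k Kci ^+ 2 * u 0%N
   + emb k.+1 Kci ^+ 2 * u 1%N + emb k.+2 Kci ^+ 2 * u 2%N.
  by have := hi k lk; rewrite -(ler_rat realalg) Ty TE.
have per k a : emb k.+3 a = emb k a by rewrite /emb -(addn3 k) iterD /= Kgal3.
have g0 : emb 0 Kc = c.
  by rewrite /emb emb0E /= /Kc !KE !rmorph0 rmorph1; rewrite /c; ring.
have g1 : emb 1 Kc = c ^+ 2 - 2.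
  rewrite /emb emb0E /= /Kgal /Kc !KE ?rmorphD ?rmorphN ?rmorphMn ?rmorph0 ?rmorph1 /=.
  by rewrite /c; ring.
have g2 : emb 2 Kc = 1 - c - c ^+ 2.
  rewrite /emb emb0E /= /Kgal /Kc !KE ?rmorphD ?rmorphN ?rmorphMn ?rmorph0 ?rmorph1 /=.
  by rewrite /c; ring.
have i0 : emb 0 Kci = c ^+ 2 + c - 2.
  rewrite /emb emb0E /= /Kci !KE ?rmorphN ?rmorph_nat ?rmorph1 /=.
  by rewrite /c; ring.
have i1 : emb 1 Kci = - c - 1.
  rewrite /emb emb0E /= /Kgal /Kci !KE ?rmorphD ?rmorphN ?rmorphMn ?rmorph_nat ?rmorph1 /=.
  by rewrite /c; ring.
have i2 : emb 2 Kci = 1 - c ^+ 2.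
  rewrite /emb emb0E /= /Kgal /Kci !KE ?rmorphD ?rmorphN ?rmorphMn ?rmorph_nat ?rmorph1 /=.
  by rewrite /c; ring.
move: (hc' 0%N isT) (hc' 1%N isT) (hc' 2%N isT) (hi' 0%N isT) (hi' 1%N isT) (hi' 2%N isT).
rewrite !per g0 g1 g2 i0 i1 i2.
have [[b0 b1 b2] [d0 d1 d2]] := c_bounds c1 c2.
exact: (cube_le_sum3 b0 b1 b2 d0 d1 d2 (u0 0%N) (u0 1%N) (u0 2%N)).
Qed.

Definition Kunit (u : OK int) := exists u', u * u' = 1.

Lemma KunitM u v : Kunit u -> Kunit v -> Kunit (u * v).
Proof. by move=> [u' e] [v' e']; exists (u' * v'); rewrite mulrACA e e' mulr1. Qed.
Lemma Kunit_gal k u : Kunit u -> Kunit (iter k (@Kgal int) u).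
Proof.
move=> [u' e]; exists (iter k (@Kgal int) u'); elim: k => //= k IH.
by rewrite -rmorphM IH rmorph1.
Qed.

Lemma KT_intq (a : OK int) : (KT a)%:~R = KT (Kmap intq a) :> rat.
Proof. by rewrite KT_map. Qed.
Lemma Kgal_intq k (a : OK int) : Kmap intq (iter k (@Kgal int) a) = iter k (@Kgal rat) (Kmap intq a).
Proof. by elim: k => //= k <-; rewrite Kgal_map. Qed.

Lemma KT_sqr_ge0 (a : OK int) : 0 <= KT (a ^+ 2).
Proof.
have := KT_ge0 (tnn_sqr (Kmap intq a)).
by rewrite -(rmorphXn (Kmap intq)) /= -KT_intq ler0z.
Qed.

(** Multiply by conjugates of c and c^-1 as long as the trace of the square drops. It is a
    nonnegative integer, so the process ends, at an element to which [balanced_rat] applies. *)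
Lemma balanced_int (y : OK int) :
  exists2 u, Kunit u & KT ((u * y) ^+ 2) ^+ 3 <= 140 * KN y ^+ 2.
Proof.
have N1 u : Kunit u -> KN u ^+ 2 = 1.
  move=> [u' e]; have := congr1 (@KN int) e; rewrite KNM KN1 => /(congr1 absz).
  rewrite abszM => /eqP; rewrite muln_eq1 => /andP[/eqP h _].
  by have [->|->] : KN u = 1 \/ KN u = -1 by lia.
have cu : Kunit Kc by exists Kci; exact: Kc_unit.
have ciu : Kunit Kci by exists Kc; rewrite mulrC; exact: Kc_unit.
move: {2}(`|KT (y ^+ 2)|%N).+1 (ltnSn `|KT (y ^+ 2)|%N) => n.
elim: n y => // n IH y ltn.
have step g : Kunit g -> KT ((g * y) ^+ 2) < KT (y ^+ 2) ->
  exists2 u, Kunit u & KT ((u * y) ^+ 2) ^+ 3 <= 140 * KN y ^+ 2.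
  move=> gu lt; have [|u uu hu] := IH (g * y).
    move: lt ltn (KT_sqr_ge0 (g * y)) (KT_sqr_ge0 y).
    by move: (KT _) (KT _) => s t; lia.
  exists (u * g); first exact: KunitM.
  have -> : KN y ^+ 2 = KN (g * y) ^+ 2 by rewrite KNM exprMn (N1 _ gu) mul1r.
  by rewrite -(mulrA u g y).
have [/existsP[k hk]|] := boolP [exists k : 'I_3, KT ((iter k (@Kgal int) Kc * y) ^+ 2) < KT (y ^+ 2)].
  by apply: step hk; apply: Kunit_gal.
rewrite negb_exists => /forallP hc.
have [/existsP[k hk]|] := boolP [exists k : 'I_3, KT ((iter k (@Kgal int) Kci * y) ^+ 2) < KT (y ^+ 2)].
  by apply: step hk; apply: Kunit_gal.
rewrite negb_exists => /forallP hi.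
exists 1; first by exists 1; rewrite mulr1.
rewrite mul1r.
have q (a : OK int) : KT (Kmap intq a ^+ 2) = (KT (a ^+ 2))%:~R.
  by rewrite -(rmorphXn (Kmap intq)) KT_intq.
have e (a b : OK int) : ~~ (KT (a ^+ 2) < KT (b ^+ 2)) ->
    KT (Kmap intq b ^+ 2) <= KT (Kmap intq a ^+ 2).
  by rewrite -leNgt !q ler_int.
have := @balanced_rat (Kmap intq y); rewrite q -KN_intq => h.
suff : (KT (y ^+ 2))%:~R ^+ 3 <= 140 * (KN y)%:~R ^+ 2 :> rat.
  move: (KT _) (KN y) => T N.
  have -> : T%:~R ^+ 3 = (T ^+ 3)%:~R :> rat by rewrite rmorphXn.
  have -> : 140 * N%:~R ^+ 2 = (140 * N ^+ 2)%:~R :> rat by rewrite rmorphM rmorphXn.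
  by rewrite ler_int.
apply: h => k lk; rewrite -q.
  by have := e _ _ (hc (Ordinal lk)); rewrite rmorphM /= Kgal_intq Kmap_c.
have := e _ _ (hi (Ordinal lk)); rewrite rmorphM /= Kgal_intq.
suff -> : Kmap intq Kci = Kci by [].
by apply: K_ext; rewrite /Kmap /Kci !KE.
Qed.

(** * Units of Z[zeta] of absolute value one *)

(** 7 is totally ramified in Z[c], so the Galois group acts trivially on the residue field. Hence
    norms reduce to cubes in [redK_norm]. *)
Lemma redK_gal a : redK (Kgal a) = redK a.
Proof.
have s7 : 7 = 0 :> 'F_7 by apply/eqP.
rewrite /redK /= /Kev /Kgal !KE rmorphD rmorphB rmorphN rmorphB !rmorphMn /=.
move: ((K0 a)%:~R : 'F_7) ((K1 a)%:~R : 'F_7) ((K2 a)%:~R : 'F_7) => u v w.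
rewrite -[RHS]subr0 -(mul0r w) -s7; ring.
Qed.

Lemma redK_norm a : redK a ^+ 3 = (KN a)%:~R.
Proof.
have <- : redK (KC (KN a)) = (KN a)%:~R.
  by rewrite -[in RHS](rmorph_int redK) -[in LHS](intz (KN a)) (rmorph_int (@KC int)).
by rewrite -Kcof_mul rmorphM rmorphM !redK_gal; ring.
Qed.

Lemma Kunit_norm (m : OK int) : `|KN m|%N = 1%N -> Kunit m.
Proof.
move=> h; have [e|e] : KN m = 1 \/ KN m = -1 by lia.
  by exists (Kcof m); rewrite Kcof_mul e.
exists (- Kcof m); rewrite mulrN Kcof_mul e.
by apply: K_ext; rewrite /KC !KE; ring.
Qed.

Lemma cube_lt (F : realFieldType) (T M : F) : T ^+ 3 <= 140 * M ^+ 2 -> 169 <= M -> T < 23 / 24 * M.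
Proof.
move=> hT M1; rewrite ltNge; apply/negP => h.
have M0 : 0 <= 23 / 24 * M by lra.
have : (23 / 24 * M) ^+ 3 <= 140 * M ^+ 2.
  by apply: le_trans hT; rewrite lerXn2r // nnegrE // (le_trans M0).
have -> : (23 / 24 * M) ^+ 3 = (23 / 24) ^+ 3 * M * M ^+ 2 by ring.
by rewrite ler_pM2r ?exprn_gt0; lra.
Qed.

(** A fraction u / m short enough to fit beside the covering bound, as 49/24 + 23/24 = 3. The norm
    of m is a nonzero cube mod 7, so it is 1 or -1 there, and its absolute value is 6, 8 or at least
    13 when m is not a unit. *)
Lemma K_short (m : OK int) : redK m != 0 -> ~ Kunit m ->
  exists u : OK int, exists r : OK rat,
   [/\ u <> 0, Kmap intq m * r = Kmap intq u & KT (r ^+ 2) < 23 / 24].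
Proof.
move=> rm nu.
have n7 : (KN m == 1 %[mod 7])%Z || (KN m == -1 %[mod 7])%Z.
  have := redK_norm m; move: (redK m) rm => x x0 e.
  have : x ^+ 3 = 1 \/ x ^+ 3 = (-1) by case: x x0 {e} => [[|[|[|[|[|[|[|n]]]]]]] //= hn] _;
    (try by left; apply/eqP); (try by right; apply/eqP).
  rewrite e => -[] h.
    have [k ->] : exists k, KN m = 1 + k * 7 by apply: (@Fp_intr_eq 7).
    by rewrite addrC modzMDl eqxx.
  have [k ->] : exists k, KN m = -1 + k * 7 by apply: (@Fp_intr_eq 7).
  by rewrite addrC modzMDl eqxx orbT.
have n1 : `|KN m|%N != 1%N by apply/eqP=> /Kunit_norm.
have [big|small] := leqP 13 `|KN m|.
  (* u is a unit that balances [Kcof m], and r = u / m is u [Kcof m] divided by the norm of m. *)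
  have [u uu hu] := balanced_int (Kcof m).
  have N0 : KN m != 0 by lia.
  have Nc : KN (Kcof m) = KN m ^+ 2.
    by apply: (mulfI N0); rewrite -KNM Kcof_mul KN_C -exprS.
  pose N : rat := (KN m)%:~R; have Nq : N != 0 by rewrite intr_eq0.
  exists u, (KC N^-1 * Kmap intq (u * Kcof m)); split.
  - by move=> u0; have [u' ] := uu; rewrite u0 mul0r => /eqP; rewrite eq_sym oner_eq0.
  - rewrite mulrCA -rmorphM mulrCA Kcof_mul rmorphM /= KC_map mulrCA -rmorphM.
    by rewrite mulVf // rmorph1 mulr1.
  rewrite exprMn -(rmorphXn (Kmap intq)) -(rmorphXn (@KC rat)) KTZ /= -KT_intq.
  move: hu; rewrite Nc; set T := KT _ => hT.
  have hT' : (T%:~R : rat) ^+ 3 <= 140 * N ^+ 4.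
    have -> : T%:~R ^+ 3 = (T ^+ 3)%:~R :> rat by rewrite rmorphXn.
    have -> : 140 * N ^+ 4 = (140 * (KN m ^+ 2) ^+ 2)%:~R :> rat.
      by rewrite /N rmorphM !rmorphXn /= -exprM.
    by rewrite ler_int.
  have N2 : 169 <= N ^+ 2.
    rewrite -[169]/(169%:~R) -rmorphXn ler_int.
    by move: big; move: (KN m) => n hn; clear -hn; nia.
  have Np : 0 < N ^+ 2 by rewrite exprn_even_gt0.
  rewrite exprVn mulrC (ltr_pdivrMr _ _ Np); apply: (cube_lt _ N2).
  by rewrite -exprM.
(* Only 6 and 8 are left, both even. So 2 divides m, and the fraction 1/2 has a square of trace
   3/4. *)
have ev : (2 %| KN m)%Z by lia.
have [m' Em] := KN_even ev.
have {}Em : m = KC 2 * m' by rewrite Em; apply: K_ext; rewrite mulr2n /KC !KE; ring.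
have N8 : KN m = 8 * KN m' by rewrite Em KNM KN_C.
have m'0 : KN m' != 0 by lia.
exists m', (KC (1 / 2)); split.
- by move=> e; move: m'0; rewrite e.
- rewrite Em rmorphM /= KC_map mulrAC -rmorphM.
  have -> : intq 2 * (1 / 2) = 1 by apply/eqP.
  by rewrite rmorph1 mul1r.
rewrite -(rmorphXn (@KC rat)) KT_C; lra.
Qed.

Lemma sq_le6 (q : int) : q ^+ 2 <= 6 -> q \in [:: -2; -1; 0; 1; 2].
Proof.
rewrite expr2 => h; have h1 : q <= 2 by nia. have h2 : -2 <= q by nia.
have : q = -2 \/ q = -1 \/ q = 0 \/ q = 1 \/ q = 2 by lia.
by move=> [->|[->|[->|[->|->]]]].
Qed.

Lemma sum6_le (a b c d e f k : int) :
  0 <= a -> 0 <= b -> 0 <= c -> 0 <= d -> 0 <= e -> 0 <= f -> a + b + c + d + e + f <= k ->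
  [&& a <= k, b <= k, c <= k, d <= k, e <= k & f <= k].
Proof. lia. Qed.

(** With q6 normalized to 0 the trace form gives 6 = sum of q_i^2 + sum of (q_i - q_j)^2 over pairs,
    so every |q_i| is at most 2 and a finite search finds the fourteen roots of unity. The constant
    vectors stand for zeta^6 and its negative. *)
Lemma Lnorm1_root (e : OL int) : Lnorm e = 1 -> exists k, e = Lz ^+ k \/ e = - Lz ^+ k.
Proof.
have [q0 [q1 [q2 [q3 [q4 [q5 ->]]]]]] : exists q0 q1 q2 q3 q4 q5, e = zsum q0 q1 q2 q3 q4 q5 0.
  pose u0 := K0 (L0 e); pose u1 := K1 (L0 e); pose u2 := K2 (L0 e).
  pose v0 := K0 (L1 e); pose v1 := K1 (L1 e); pose v2 := K2 (L1 e).
  exists (u0 + v1 + u2 *+ 2 - u1 - v2), (v0 + v2), (v1 + u2 - u1 - v2), (- u1),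
    (- u1 - v2), (u2 - u1 - v2).
  by apply: L_ext; apply: K_ext; rewrite /zsum !LE !KE /u0 /u1 /u2 /v0 /v1 /v2; ring.
move=> N1; have := KT_Lnorm_zsum q0 q1 q2 q3 q4 q5 0.
rewrite N1 => E.
have {}E : (q0 ^+ 2 + q1 ^+ 2 + q2 ^+ 2 + q3 ^+ 2 + q4 ^+ 2 + q5 ^+ 2 + 0 ^+ 2) *+ 7
  - (q0 + q1 + q2 + q3 + q4 + q5 + 0) ^+ 2 = 6 by rewrite -E.
pose r : seq int := [:: -2; -1; 0; 1; 2].
have F : q0 ^+ 2 + q1 ^+ 2 + q2 ^+ 2 + q3 ^+ 2 + q4 ^+ 2 + q5 ^+ 2 <= 6.
  have -> : 6 = q0 ^+ 2 + q1 ^+ 2 + q2 ^+ 2 + q3 ^+ 2 + q4 ^+ 2 + q5 ^+ 2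
    + ((q0 - q1) ^+ 2 + (q0 - q2) ^+ 2 + (q0 - q3) ^+ 2 + (q0 - q4) ^+ 2 + (q0 - q5) ^+ 2
    + (q1 - q2) ^+ 2 + (q1 - q3) ^+ 2 + (q1 - q4) ^+ 2 + (q1 - q5) ^+ 2
    + (q2 - q3) ^+ 2 + (q2 - q4) ^+ 2 + (q2 - q5) ^+ 2
    + (q3 - q4) ^+ 2 + (q3 - q5) ^+ 2 + (q4 - q5) ^+ 2) by rewrite -E; ring.
  by rewrite lerDl !addr_ge0 // sqr_ge0.
have inr q : q ^+ 2 <= 6 -> q \in r := @sq_le6 q.
have /and5P[/inr h0 /inr h1 /inr h2 /inr h3 /andP[/inr h4 /inr h5]] :=
  sum6_le (sqr_ge0 q0) (sqr_ge0 q1) (sqr_ge0 q2) (sqr_ge0 q3) (sqr_ge0 q4) (sqr_ge0 q5) F.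
pose P (a0 a1 a2 a3 a4 a5 : int) :=
  ((a0 ^+ 2 + a1 ^+ 2 + a2 ^+ 2 + a3 ^+ 2 + a4 ^+ 2 + a5 ^+ 2 + 0 ^+ 2) *+ 7
    - (a0 + a1 + a2 + a3 + a4 + a5 + 0) ^+ 2 == 6) ==>
  ([:: a0; a1; a2; a3; a4; a5] \in
    [seq [seq (if i == j then 1 else 0 : int) | j <- iota 0 6] | i <- iota 0 6]
    ++ [seq [seq (if i == j then -1 else 0 : int) | j <- iota 0 6] | i <- iota 0 6]
    ++ [:: nseq 6 1; nseq 6 (-1)]).
have C : all (fun a0 => all (fun a1 => all (fun a2 => all (fun a3 => all (fun a4 =>
    all (fun a5 => P a0 a1 a2 a3 a4 a5) r) r) r) r) r) r by vm_compute.
have := allP (allP (allP (allP (allP (allP C _ h0) _ h1) _ h2) _ h3) _ h4) _ h5.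
rewrite /P E eqxx /=; clear; rewrite !inE => H.
have pos k (a : OL int) : a == Lz ^+ k -> exists k, a = Lz ^+ k \/ a = - Lz ^+ k.
  by move/eqP; exists k; left.
have neg k (a : OL int) : a == - Lz ^+ k -> exists k, a = Lz ^+ k \/ a = - Lz ^+ k.
  by move/eqP; exists k; right.
case/orP: H => [/eqP[-> -> -> -> -> ->]|H]; first by apply: (pos 0%N); vm_compute.
case/orP: H => [/eqP[-> -> -> -> -> ->]|H]; first by apply: (pos 1%N); vm_compute.
case/orP: H => [/eqP[-> -> -> -> -> ->]|H]; first by apply: (pos 2%N); vm_compute.
case/orP: H => [/eqP[-> -> -> -> -> ->]|H]; first by apply: (pos 3%N); vm_compute.
case/orP: H => [/eqP[-> -> -> -> -> ->]|H]; first by apply: (pos 4%N); vm_compute.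
case/orP: H => [/eqP[-> -> -> -> -> ->]|H]; first by apply: (pos 5%N); vm_compute.
case/orP: H => [/eqP[-> -> -> -> -> ->]|H]; first by apply: (neg 0%N); vm_compute.
case/orP: H => [/eqP[-> -> -> -> -> ->]|H]; first by apply: (neg 1%N); vm_compute.
case/orP: H => [/eqP[-> -> -> -> -> ->]|H]; first by apply: (neg 2%N); vm_compute.
case/orP: H => [/eqP[-> -> -> -> -> ->]|H]; first by apply: (neg 3%N); vm_compute.
case/orP: H => [/eqP[-> -> -> -> -> ->]|H]; first by apply: (neg 4%N); vm_compute.
case/orP: H => [/eqP[-> -> -> -> -> ->]|H]; first by apply: (neg 5%N); vm_compute.
case/orP: H => [/eqP[-> -> -> -> -> ->]|/eqP[-> -> -> -> -> ->]].
  by apply: (neg 6%N); vm_compute.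
by apply: (pos 6%N); vm_compute.
Qed.

(** * The quaternion order Lam is a principal left ideal ring *)

Section Quaternion.
Variable F : comNzRingType.
Local Notation D := (tw (LD F true)).
Implicit Types u v : D.

Definition nr u : OK F := Lnorm u.1 + Lnorm u.2.
Definition star u : D := (Lconj u.1, - u.2).
Definition DK (a : OK F) : D := (LC a, 0).

Lemma quatE u v :
  u * v = (u.1 * v.1 - u.2 * Lconj v.2, u.1 * v.2 + u.2 * Lconj v.1).
Proof. by rewrite twE /=; congr pair; rewrite expr1 mulrN1. Qed.

Lemma nrM u v : nr (u * v) = nr u * nr v.
Proof.
rewrite quatE /nr /=; case: u v => [a b] [c d] /=.
rewrite /Lnorm /Lconj !LE; move: (L0 a) (L1 a) (L0 b) (L1 b) (L0 c) (L1 c) (L0 d) (L1 d).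
by move=> *; ring.
Qed.
Lemma nr1 : nr 1 = 1.
Proof. by rewrite /nr /= Lnorm1 /Lnorm !LE; ring. Qed.
Lemma nr_star u : u * star u = DK (nr u).
Proof.
rewrite quatE /star /DK /nr /= rmorphN mulrN opprK !Lnorm_conj LconjK -rmorphD.
by congr pair; ring.
Qed.

Lemma DK_M a b : DK (a * b) = DK a * DK b.
Proof. by rewrite quatE /DK /= rmorphM rmorph0; congr pair; ring. Qed.
Lemma DK1 : DK 1 = 1.
Proof. by rewrite /DK rmorph1. Qed.
Lemma DK_central a u : DK a * u = u * DK a.
Proof. by rewrite !quatE /DK /= rmorph0 Lconj_C; congr pair; ring. Qed.
Lemma mulDK a u : DK a * u = (LC a * u.1, LC a * u.2).
Proof. by rewrite quatE /DK /=; congr pair; ring. Qed.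
End Quaternion.

Fact quatq_conj a :
  Lmap intq (inv_conj (LD int true) a) = inv_conj (LD rat true) (Lmap intq a).
Proof. exact: Lconj_map. Qed.
Fact quatq_sq : Lmap intq (inv_sq (LD int true)) = inv_sq (LD rat true).
Proof. exact: (rmorph_sign (Lmap intq) true). Qed.
Definition quatq : {rmorphism Lam -> tw (LD rat true)} :=
  twmap (@IMorph (LD int true) (LD rat true) (Lmap intq) quatq_conj quatq_sq).
Lemma quatqE u : quatq u = (Lmap intq u.1, Lmap intq u.2). Proof. by []. Qed.
Lemma quatq_inj : injective quatq.
Proof.
move=> u v E; apply: injective_projections; apply: Lmap_intq_inj.
  exact: (congr1 fst E).
exact: (congr1 snd E).
Qed.

Lemma nr_quatq u : nr (quatq u) = Kmap intq (nr u).
Proof. by rewrite /nr /= !Lnorm_map -(rmorphD (Kmap intq)). Qed.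
Lemma KN_nr_intq u : (KN (nr u))%:~R = KN (nr (quatq u)) :> rat.
Proof. by rewrite nr_quatq KN_map. Qed.
Lemma tnn_nr (u : tw (LD rat true)) : tnn (nr u).
Proof. by apply: tnnD; apply: tnn_Lnorm. Qed.
Lemma KN_nr_ge0 (u : Lam) : 0 <= KN (nr u).
Proof. by have := KN_ge0 (tnn_nr (quatq u)); rewrite -KN_nr_intq ler0z. Qed.

Lemma nr_eq0 (u : tw (LD rat true)) : nr u = 0 -> u = 0.
Proof.
move=> /(tnn_add_eq0 (tnn_Lnorm _) (tnn_Lnorm _)) [/Lnorm_eq0 h1 /Lnorm_eq0 h2].
exact: injective_projections.
Qed.
Lemma KN_nr_gt0 (u : Lam) : u <> 0 -> 0 < KN (nr u).
Proof.
move=> u0; rewrite lt_neqAle KN_nr_ge0 andbT eq_sym; apply/eqP=> h; apply: u0.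
apply: quatq_inj; rewrite rmorph0; apply: nr_eq0; apply: KN_rat_eq0.
by rewrite -KN_nr_intq h.
Qed.

(** [star] gives a right inverse, which itself has a right inverse; so the first one is
    two-sided. *)
Lemma quat_inv (u : tw (LD rat true)) : u <> 0 -> exists u', u * u' = 1 /\ u' * u = 1.
Proof.
move=> u0; have n0 : KN (nr u) != 0 by apply/eqP=> /KN_rat_eq0 /nr_eq0.
have inv (v : tw (LD rat true)) : KN (nr v) != 0 -> exists v', v * v' = 1.
  move=> m0; exists (star v * DK (Kcof (nr v) * KC (KN (nr v))^-1)).
  by rewrite mulrA nr_star -DK_M mulrA Kcof_mul -rmorphM mulfV // rmorph1 DK1.
have [u' e] := inv u n0.
have n0' : KN (nr u') != 0.
  have := congr1 (fun v => KN (nr v)) e; rewrite /= nrM KNM nr1 KN1.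
  by move=> h; apply/eqP=> z; move: h; rewrite z mulr0 => /eqP; rewrite eq_sym oner_eq0.
have [u2 e2] := inv u' n0'.
have E : u = u2 by rewrite -[u]mulr1 -e2 mulrA e mul1r.
by exists u'; split=> //; rewrite E e2.
Qed.

Lemma int_mul_eq1 (a b : int) : 0 <= a -> 0 <= b -> a * b = 1 -> a = 1.
Proof.
move=> a0 b0 /(congr1 absz); rewrite abszM => /eqP; rewrite muln_eq1 => /andP[/eqP h _].
by lia.
Qed.
Lemma int_sum_le1 (a b : int) : 0 <= a -> 0 <= b -> a + b <= 1 -> a = 0 \/ b = 0.
Proof. lia. Qed.

(* Superadditivity of the norm forces one coordinate of a unit to vanish. *)
Lemma Lam_unit (u v : Lam) : u * v = 1 -> u.1 = 0 \/ u.2 = 0.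
Proof.
move=> uv; have := congr1 (fun w => KN (nr w)) uv; rewrite /= nrM KNM nr1 KN1 => e.
have e1 : KN (nr u) = 1.
  exact: int_mul_eq1 (KN_nr_ge0 u) (KN_nr_ge0 v) e.
have := KN_superadd (tnn_Lnorm (Lmap intq u.1)) (tnn_Lnorm (Lmap intq u.2)).
rewrite -[_ + Lnorm _]/(nr (quatq u)) -KN_nr_intq e1 -!KN_Lnorm_intq -rmorphD ler_int => h.
have [] : KN (Lnorm u.1) = 0 \/ KN (Lnorm u.2) = 0.
- exact: int_sum_le1 (KN_Lnorm_int u.1) (KN_Lnorm_int u.2) h.
- move=> z; left; apply: Lmap_intq_inj; rewrite rmorph0; apply: Lnorm_eq0; apply: KN_rat_eq0.
  by rewrite -KN_Lnorm_intq z.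
move=> z; right; apply: Lmap_intq_inj; rewrite rmorph0; apply: Lnorm_eq0; apply: KN_rat_eq0.
by rewrite -KN_Lnorm_intq z.
Qed.

Local Notation DQ := (tw (LD rat true)).

Lemma int_oppr_id (n : int) : - n = n -> n = 0.
Proof. lia. Qed.

Section MinimalVector.
Variables (I : Lam -> Prop) (g : Lam).
Hypothesis hI : lideal I.
Hypothesis Ig : I g.
Hypothesis g0 : g <> 0.
Hypothesis gmin : forall a, I a -> a <> 0 -> KN (nr g) <= KN (nr a).

(* The fractional ideal I g^-1, which contains Lam. *)
Let J (d : DQ) := exists2 b, I b & d * quatq g = quatq b.

Let JD d d' : J d -> J d' -> J (d + d').
Proof.
have [_ D _] := hI; move=> [b Ib e] [b' Ib' e']; exists (b + b'); first exact: D.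
by rewrite mulrDl e e' rmorphD.
Qed.
Let JM r d : J d -> J (quatq r * d).
Proof.
have [_ _ M] := hI; move=> [b Ib e]; exists (r * b); first exact: M.
by rewrite -mulrA e rmorphM.
Qed.
Let J1 r : J (quatq r).
Proof. by have [_ _ M] := hI; exists (r * g); [exact: M | rewrite rmorphM]. Qed.
Let JB d d' : J d -> J d' -> J (d - d').
Proof.
move=> Jd Jd'; apply: JD => //.
have -> : - d' = quatq (-1) * d' by rewrite rmorphN1 mulN1r.
exact: JM.
Qed.

(** This is the minimality of g: a nonzero d in J gives d g in I, of norm at least that of g, so the
    norm of d is at least 1. *)
Let J_small d : J d -> KT (nr d) < 3 -> d = 0.
Proof.
move=> [b Ib e] lt3; apply: NNPP => d0.
have gq0 : quatq g <> 0 by rewrite -(rmorph0 quatq) => /quatq_inj.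
have b0 : b <> 0.
  move=> b0; apply: d0; have [g' [gg' _]] := quat_inv gq0.
  by rewrite -[d]mulr1 -gg' mulrA e b0 rmorph0 mul0r.
have := gmin Ib b0; apply/negP; rewrite -ltNge -(ltr_int rat) !KN_nr_intq -e nrM KNM.
rewrite -[X in _ < X]mul1r ltr_pM2r; first exact: KN_lt1 (tnn_nr d) lt3.
by rewrite -KN_nr_intq ltr0z; exact: KN_nr_gt0.
Qed.

Let Lq (a : OL int) := Lmap intq a.
Let LqM a b : Lq (a * b) = Lq a * Lq b. Proof. exact: rmorphM. Qed.
Let LqD a b : Lq (a + b) = Lq a + Lq b. Proof. exact: rmorphD. Qed.
Let LqN a : Lq (- a) = - Lq a. Proof. exact: rmorphN. Qed.
Let Lq1 : Lq 1 = 1. Proof. exact: rmorph1. Qed.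
Let Lq_inj : injective Lq. Proof. exact: Lmap_intq_inj. Qed.
Let LqC a : Lq (Lconj a) = Lconj (Lq a). Proof. exact: Lconj_map. Qed.

Let quatM (a : OL int) (d : DQ) : quatq (a, 0) * d = (Lq a * d.1, Lq a * d.2).
Proof. by rewrite quatE quatqE /= rmorph0; congr pair; ring. Qed.

(** Subtract a nearby integral element: the difference is still in J and has trace at most 49/24, so
    it vanishes. *)
Let J_L a : J (a, 0) -> exists x, a = Lq x.
Proof.
move=> Ja; have [x hx] := L_covering a; exists x.
have Jx : J ((a, 0) - quatq (x, 0)) by exact: JB.
have e : (a, 0) - quatq (x, 0) = (a - Lq x, 0) :> DQ.
  by rewrite quatqE /= rmorph0; apply: injective_projections; rewrite /= ?subrr.
have lt3 : KT (nr ((a - Lq x, 0) : DQ)) < 3.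
  have -> : nr ((a - Lq x, 0) : DQ) = Lnorm (a - Lq x).
    by rewrite /nr /= {2}/Lnorm !LE; ring.
  by apply: le_lt_trans hx _; lra.
rewrite e in Jx; have /(congr1 fst)/eqP := J_small Jx lt3.
by rewrite /= subr_eq0 => /eqP.
Qed.
Let J_Lj b : J (0, b) -> exists x, b = Lq x.
Proof.
move=> Jb; have [x hx] := L_covering b; exists x.
have Jx : J ((0, b) - quatq (0, x)) by exact: JB.
have e : (0, b) - quatq (0, x) = (0, b - Lq x) :> DQ.
  by rewrite quatqE /= rmorph0; apply: injective_projections; rewrite /= ?subrr.
have lt3 : KT (nr ((0, b - Lq x) : DQ)) < 3.
  have -> : nr ((0, b - Lq x) : DQ) = Lnorm (b - Lq x).
    by rewrite /nr /= {1}/Lnorm !LE; ring.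
  by apply: le_lt_trans hx _; lra.
rewrite e in Jx; have /(congr1 snd)/eqP := J_small Jx lt3.
by rewrite /= subr_eq0 => /eqP.
Qed.

Let N : int := KN (nr g).
Let N0 : (N%:~R : rat) != 0. Proof. by rewrite intr_eq0 gt_eqF // KN_nr_gt0. Qed.
Let NL : OL int := LC (KC N).
Let NLq : Lq NL = LC (KC N%:~R).
Proof. by rewrite /Lq /NL LC_map KC_map. Qed.
Let NLq_reg (a b : OL rat) : Lq NL * a = Lq NL * b -> a = b.
Proof.
move=> h; have u : LC (KC N%:~R^-1) * Lq NL = 1.
  by rewrite NLq -rmorphM -rmorphM mulVf // !rmorph1.
by rewrite -[a]mul1r -[b]mul1r -u -!mulrA h.
Qed.

Let J_denom d : J d -> exists y, Lq NL * d.2 = Lq y.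
Proof.
move=> [b Ib e]; exists (b * star g * DK (Kcof (nr g))).2.
have E : d * quatq (g * (star g * DK (Kcof (nr g)))) = quatq (b * star g * DK (Kcof (nr g))).
  by rewrite rmorphM mulrA e -rmorphM mulrA.
transitivity (d * quatq (g * (star g * DK (Kcof (nr g))))).2; last by rewrite E.
rewrite mulrA nr_star -DK_M Kcof_mul.
have -> : quatq (DK (KC N)) = DK (KC N%:~R).
  by rewrite quatqE /DK /= rmorph0; congr pair; exact: NLq.
by rewrite -DK_central mulDK NLq.
Qed.

Let B (y : OL int) := exists2 d, J d & Lq NL * d.2 = Lq y.
Let B_ideal : lideal B.
Proof.
split.
- by exists 0; [rewrite -(rmorph0 quatq); exact: J1 | rewrite /= mulr0 /Lq rmorph0].
- move=> y y' [d Jd e] [d' Jd' e']; exists (d + d'); first exact: JD.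
  by rewrite LqD -e -e' /= mulrDr.
move=> r y [d Jd e]; exists (quatq (r, 0) * d); first exact: JM.
by rewrite quatM /= LqM -e mulrCA.
Qed.

(** Second coordinates of J form a fractional ideal of Z[zeta], with denominators dividing the norm
    of g. It contains 1 because J contains j, so its generator is 1 / delta. Then delta w - j lies
    in J with second coordinate 0, whence delta w.1 is integral by [J_L]. *)
Let structure : exists (delta a0 : OL int) (w : DQ),
  [/\ J w, Lq delta * w.2 = 1, Lq delta * w.1 = Lq a0 &
      forall d, J d -> exists q, d.2 = Lq q * w.2].
Proof.
have [gam [w Jw ew] hB] := L_principal B_ideal.
have [del eN] : exists q, NL = q * gam.
  apply: hB; exists (quatq (0, 1)); first exact: J1.
  by rewrite quatqE /= rmorph1 mulr1.
have e1 : Lq del * w.2 = 1.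
  by apply: NLq_reg; rewrite mulrCA ew -LqM -eN mulr1.
have [a0 ea] : exists x, Lq del * w.1 = Lq x.
  apply: J_L; have -> : (Lq del * w.1, 0) = quatq (del, 0) * w - quatq (0, 1) :> DQ.
    rewrite quatM quatqE /= rmorph0 rmorph1 e1.
    by apply: injective_projections; rewrite /= ?subrr ?subr0.
  by apply: JB; [exact: JM | exact: J1].
exists del, a0, w; split=> // d Jd.
have [y ey] := J_denom Jd; have [q eq] : exists q, y = q * gam by apply: hB; exists d.
by exists q; apply: NLq_reg; rewrite ey eq LqM -ew mulrCA.
Qed.

(** The claim amounts to J = Lam. Stability of J under left multiplication by j forces del to be
    real up to a root of unity; if it were not a unit, [K_short] would give a nonzero element of J
    of trace below 3. Once del is a unit, [J_L] makes both coordinates integral. *)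
Lemma minimal_generates b : I b -> exists q, b = q * g.
Proof.
have [del [a0 [w [Jw e2 e1 hw]]]] := structure.
set a := w.1 in e1; set be := w.2 in e2 hw.
have delreg (x y : OL rat) : Lq del * x = Lq del * y -> x = y.
  move=> h; rewrite -[x]mul1r -[y]mul1r -e2 -!(mulrC be) -!mulrA.
  by rewrite h.

(* A common divisor h is a unit: if del = d' h and a0 = c' h, then d' w - c' in J equals (0, d' be),
   so d' be is integral, and its product with h is 1. *)
have [u [v bez]] : exists u v, u * del + v * a0 = 1.
  pose I2 x := exists u v, x = u * del + v * a0.
  have hI2 : lideal I2.
    split; first by exists 0, 0; ring.
      by move=> x y [p [q ->]] [p' [q' ->]]; exists (p + p'), (q + q'); ring.
    by move=> r x [p [q ->]]; exists (r * p), (r * q); ring.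
  have [h [p [q eh]] hh] := L_principal hI2.
  have [d' ed] : exists q, del = q * h by apply: hh; exists 1, 0; ring.
  have [c' ec] : exists q, a0 = q * h by apply: hh; exists 0, 1; ring.
  have hreg : Lq h * (Lq d' * be) = 1 by rewrite mulrA -LqM [h * _]mulrC -ed e2.
  have ea : Lq d' * a = Lq c'.
    have eq : Lq h * (Lq d' * a) = Lq h * Lq c'.
      by rewrite mulrA -!LqM [h * d']mulrC [h * c']mulrC -ed -ec.
    transitivity (Lq d' * be * (Lq h * (Lq d' * a))).
      by rewrite -[LHS]mul1r -hreg; ring.
    rewrite eq; transitivity (Lq h * (Lq d' * be) * Lq c'); first by ring.
    by rewrite hreg mul1r.
  have [e ee] : exists x, Lq d' * be = Lq x.
    apply: J_Lj; have -> : (0, Lq d' * be) = quatq (d', 0) * w - quatq (c', 0) :> DQ.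
      rewrite quatM quatqE /= rmorph0 -/a -/be ea.
      by apply: injective_projections; rewrite /= ?subrr ?subr0.
    by apply: JB; [exact: JM | exact: J1].
  exists (e * p), (e * q).
  by rewrite -!mulrA -mulrDr -eh; apply: Lq_inj; rewrite LqM Lq1 -ee mulrC.
have jw : quatq (0, 1) * w = (- Lconj be, Lconj a).
  by rewrite quatE quatqE /= rmorph0 rmorph1; congr pair; rewrite /a /be; ring.
have Jjw : J (- Lconj be, Lconj a) by rewrite -jw; exact: JM.
have [kap ek] := hw _ Jjw; rewrite /= in ek.
have e2c : Lconj (Lq del) * Lconj be = 1 by rewrite -rmorphM e2 rmorph1.
have a0c : Lconj (Lq a0) = Lconj (Lq del) * (Lq kap * be) by rewrite -e1 rmorphM /= ek.
(* eta is del / conj del; the Bezout relation, conjugated, exhibits it as integral. *)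
pose eta := Lconj u * del + Lconj v * kap.
have Eeta : Lq eta = Lq del * Lconj be.
  have b1 : Lconj (Lq u) * Lconj (Lq del) + Lconj (Lq v) * Lconj (Lq a0) = 1.
    have := congr1 (fun x => Lconj (Lq x)) bez.
    by rewrite /= LqD !LqM Lq1 (rmorphD (@Lconj rat)) !(rmorphM (@Lconj rat)) rmorph1.
  rewrite /eta LqD !LqM !LqC -[RHS]mul1r -b1 a0c.
  move: e2 e2c; move: (Lconj (Lq u)) (Lconj (Lq v)) (Lconj (Lq del)) (Lconj be) => U V D bb.
  move: (Lq del) (Lq kap) => d k h1 h2.
  transitivity (U * d * (D * bb) + V * k * (D * bb) * (d * be)); last by ring.
  by rewrite h1 h2 !mulr1.
have eta_del : del = eta * Lconj del.
  by apply: Lq_inj; rewrite LqM Eeta LqC -mulrA [Lconj be * _]mulrC e2c mulr1.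
have Neta : Lnorm eta = 1.
  apply: Kmap_intq_inj; rewrite rmorph1 -Lnorm_map.
  have : LC (Lnorm (Lq eta)) = LC 1.
    rewrite -Lnorm_conj Eeta rmorphM /= LconjK rmorph1.
    by rewrite -mulrA [Lconj be * _]mulrA [Lconj be * _]mulrC e2c mul1r e2.
  by move/(congr1 (@L0 rat)).
have [X eX] : exists x, - Lconj be - Lq kap * a = Lq x.
  apply: J_L; have -> : (- Lconj be - Lq kap * a, 0) =
      quatq (0, 1) * w - quatq (kap, 0) * w :> DQ.
    rewrite jw quatM -/a -/be; apply: injective_projections; rewrite //= ek subrr //.
  by apply: JB; exact: JM.
have sumsq : 1 + a0 * Lconj a0 = - (X * Lconj del).
  apply: Lq_inj; rewrite LqD LqN !LqM !LqC Lq1 a0c -eX -e1.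
  transitivity (Lconj (Lq del) * Lconj be + Lq kap * a * Lconj (Lq del) * (Lq del * be)).
    by rewrite e2c; ring.
  by rewrite e2; ring.
have F7sq (r : 'F_7) : 1 + r * r != 0.
  by case: r => [[|[|[|[|[|[|[|n]]]]]]] //= hn].
(* -1 is not a square mod 7, so del is outside the prime over 7. Hence eta has residue 1, which
   rules out the negatives of powers of zeta. *)
have rdel : redL del != 0.
  apply/eqP => h; have := congr1 redL sumsq.
  rewrite rmorphD rmorphN !rmorphM rmorph1 !redL_conj h mulr0 oppr0.
  by apply/eqP; exact: F7sq.
have reta : redL eta = 1.
  have := congr1 redL eta_del; rewrite rmorphM redL_conj -{1}[redL del]mul1r.
  by move/(mulIf rdel).
have [k ez] : exists k, eta = Lz ^+ k.
  have [k [->|e]] := Lnorm1_root Neta; first by exists k.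
  by move: reta; rewrite e rmorphN rmorphXn redL_z expr1n => /eqP.
(* As del = zeta^k conj del and 3 is -1/2 mod 7, this multiple of del is fixed by conjugation. *)
pose m0 := Lz ^+ (3 * k) * del.
have m0c : Lconj m0 = m0.
  have zc n : Lz ^+ n * Lconj (Lz ^+ n) = 1 :> OL int.
    by rewrite rmorphXn /= -exprMn Lz_conj expr1n.
  have z7 n : Lz ^+ (7 * n) = 1 :> OL int by rewrite exprM Lz7 expr1n.
  rewrite /m0 rmorphM /= {2}eta_del ez.
  have -> : Lz ^+ (3 * k) * (Lz ^+ k * Lconj del) = Lz ^+ (4 * k) * Lconj del.
    by rewrite mulrA -exprD addnC -mulSn.
  congr (_ * _).
  rewrite -[LHS]mul1r -(z7 k) (mulnDl 4 3 k) exprD -mulrA zc mulr1 //.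
have [m em] : exists m, m0 = LC m.
  exists (L0 m0); apply: L_ext; rewrite /LC !LE //.
  have h : - L1 m0 = L1 m0 := congr1 (@L1 int) m0c.
  apply: K_ext.
  - by apply: int_oppr_id; exact: (congr1 (@K0 int) h).
  - by apply: int_oppr_id; exact: (congr1 (@K1 int) h).
  by apply: int_oppr_id; exact: (congr1 (@K2 int) h).
have rm : redK m != 0.
  by rewrite -redL_C -em /m0 rmorphM rmorphXn redL_z expr1n mul1r.
have mbe : Lq (LC m) * be = Lq (Lz ^+ (3 * k)).
  by rewrite -em /m0 LqM -mulrA e2 mulr1.
have [[m' mm']|nu] := classic (Kunit m); last first.
  have [y [r [y0 er hr]]] := K_short rm nu; exfalso.
  (* m be is zeta^(3k), so the second coordinate of y' w is exactly the short fraction y / m; the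
     first one is then reduced by an integral element. *)
  pose y' := LC y * Lz ^+ (4 * k).
  have yb : Lq y' * be = LC r.
    have mreg (p q : OL rat) : Lq (LC m) * p = Lq (LC m) * q -> p = q.
      move=> h; have m0' : Lq (LC m) * (be * Lconj (Lq (Lz ^+ (3 * k)))) = 1.
        by rewrite mulrA mbe -LqC -LqM rmorphXn /= -exprMn Lz_conj expr1n Lq1.
      rewrite -[p]mul1r -[q]mul1r -m0' -!(mulrC (be * _)) -!mulrA h //.
    apply: mreg; rewrite mulrCA mbe -LqM /y' -mulrA -exprD -mulnDl.
    by rewrite exprM Lz7 expr1n mulr1 /Lq !LC_map -rmorphM er.
  have [x hx] := L_covering (Lq y' * a).
  have Jd : J (quatq (y', 0) * w - quatq (x, 0)) by apply: JB; [exact: JM | exact: J1].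
  have ed : quatq (y', 0) * w - quatq (x, 0) = (Lq y' * a - Lq x, LC r) :> DQ.
    rewrite quatM quatqE /= rmorph0 -/a -/be yb.
    by apply: injective_projections; rewrite //= subr0.
  have lt3 : KT (nr ((Lq y' * a - Lq x, LC r) : DQ)) < 3.
    rewrite /nr /= Lnorm_C KTD; move: hx hr; move: (KT _) (KT _) => s t; lra.
  rewrite ed in Jd; have /(congr1 snd) := J_small Jd lt3.
  move=> /(congr1 (@L0 rat)) r0; rewrite /= in r0.
  apply: y0; apply: Kmap_intq_inj; rewrite -er (_ : r = 0) ?mulr0 ?rmorph0 //.
have [bi ebi] : exists x, be = Lq x.
  exists (LC m' * Lz ^+ (3 * k)); rewrite LqM -mbe mulrA -LqM -rmorphM.
  by rewrite [m' * m]mulrC mm' rmorph1 Lq1 mul1r.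
move=> Ib; have gq0 : quatq g <> 0 by rewrite -(rmorph0 quatq) => /quatq_inj.
have [g' [gg' g'g]] := quat_inv gq0.
pose d := quatq b * g'.
have dg : d * quatq g = quatq b by rewrite /d -mulrA g'g mulr1.
have Jd : J d by exists b.
have [q eq] := hw _ Jd; rewrite ebi -LqM in eq.
have [p ep] : exists p, d.1 = Lq p.
  apply: J_L; have -> : (d.1, 0) = d - quatq (0, q * bi) :> DQ.
    rewrite quatqE /= rmorph0; apply: injective_projections; rewrite /= ?subr0 //.
    by rewrite -[Lmap intq _]/(Lq _) -eq subrr.
  by apply: JB => //; exact: J1.
pose r : Lam := (p, q * bi).
have dr : d = quatq r by apply: injective_projections.
exists r; apply: quatq_inj; rewrite -dg dr; exact: esym (rmorphM quatq r g).
Qed.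
End MinimalVector.

Lemma Lam_principal (I : Lam -> Prop) : lideal I ->
  exists2 g, I g & forall a, I a -> exists q, a = q * g.
Proof.
move=> hI; have [I0 ID IM] := hI.
case: (classic (exists2 g, I g & g <> 0)) => [[g Ig g0]|no]; last first.
  exists 0 => // a Ia; exists 0; rewrite mul0r; apply: NNPP => a0; apply: no.
  by exists a.
move: {2}(`|KN (nr g)|%N).+1 (ltnSn `|KN (nr g)|%N) => n.
elim: n g Ig g0 => // n IH g Ig g0 ltn.
case: (classic (exists a, [/\ I a, a <> 0 & KN (nr a) < KN (nr g)])) => [[a [Ia a0 lt]]|no].
  apply: (IH a) => //; apply: leq_trans (_ : `|KN (nr g)| <= n)%N => //.
  by move: lt (KN_nr_ge0 a) (KN_nr_ge0 g); move: (KN _) (KN _) => s t; lia.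
exists g => // b; apply: minimal_generates => // a Ia a0.
by rewrite leNgt; apply/negP => lt; apply: no; exists a.
Qed.

(** * Left ideals of the twisted group ring Z[zeta] o C2 *)

Notation KK := (OK int).
Definition red2 : {rmorphism KK -> OK 'F_2} := Kmap intr2.

(** One unit for each pair of a nonzero residue mod 2 and a nonzero residue mod the prime over 7: 42
    = 7 times 6 entries. *)
Definition K_units : seq KK := [seq mkK t.1.1 t.1.2 t.2 | t <- [::
 (-1, -1, 0); (-1, -1, 1); (-1, 0, 0); (-1, 0, 1); (-1, 1, 0); (-1, 1, 1); (0, -1, -1);
 (0, -1, 0); (0, -1, 1); (0, 0, -1); (0, 0, 1); (0, 1, -1); (0, 1, 0); (0, 1, 1); (1, -1, -1);
 (1, -1, 0); (1, 0, -1); (1, 0, 0); (1, 1, -1); (1, 1, 0); (-2, -1, 0); (-2, -1, 2); (-2, 0, 1);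
 (-2, 1, 1); (-1, -2, -1); (-1, -2, 0); (-1, -2, 1); (-1, -2, 2); (-1, -1, 2); (0, -2, -1);
 (0, 2, 1); (1, -2, 1); (1, 1, -2); (1, 2, -2); (1, 2, 0); (1, 2, 1); (2, -1, -1); (2, 0, -1);
 (-3, 1, 1); (1, 3, 1); (-4, 1, 2); (-2, -3, 4 : int)]].

Lemma K_units_unit u : u \in K_units -> Kunit u.
Proof.
have C : all (fun u => `|KN u|%N == 1%N) K_units by vm_compute.
by move=> /(allP C)/eqP/Kunit_norm.
Qed.

Lemma F7_case (r : 'F_7) : r \in [:: 0; 1; 2; 3; 4; 5; 6].
Proof. by case: r => [[|[|[|[|[|[|[|n]]]]]]] h]; vm_compute. Qed.

Lemma K_units_surj (d : OK 'F_2) (r : 'F_7) : d != 0 -> r != 0 ->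
  exists u, [/\ Kunit u, red2 u = d & redK u = r].
Proof.
move=> d0 r0.
suff /hasP[u uU /andP[/eqP e1 /eqP e2]] :
    has (fun u => (red2 u == d) && (redK u == r)) K_units.
  by exists u; split=> //; exact: K_units_unit.
pose f2 : seq 'F_2 := [:: 0; 1].
pose D : seq (OK 'F_2) := [seq mkK t.1.1 t.1.2 t.2 | t <- [seq (s.1, s.2, c) | s <- [seq (a, b) | a <- f2, b <- f2], c <- f2]].
have dD : d \in D.
  case: d d0 => [[a b] c] _.
  by case: (F2_case a) (F2_case b) (F2_case c) => -> [] -> [] ->; vm_compute.
have C : all (fun d => all (fun r => (d != 0) ==> ((r != 0) ==>
    has (fun u => (red2 u == d) && (redK u == r)) K_units)) [:: 0; 1; 2; 3; 4; 5; 6]) D.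
  by vm_compute.
by have := allP (allP C _ dD) _ (F7_case r); rewrite d0 r0.
Qed.

(** (1 - zeta) (1 - zeta^-1), a generator of the prime over 7. *)
Definition pi7 : KK := 2 - Kc.

Lemma redK_pi7 : redK pi7 = 0.
Proof. by rewrite rmorphB rmorph_nat redK_c subrr. Qed.

Lemma K_intE (n : int) : n%:~R = KC n :> KK.
Proof. exact: K_intz. Qed.

Lemma redK_eq0 x : redK x = 0 -> exists y, x = pi7 * y.
Proof.
move=> r0.
have [k hk] : exists k, K0 x + K1 x * 2 + K2 x * 4 = 0 + k * 7.
  apply: (@Fp_intr_eq 7) => //; rewrite rmorph0 -[RHS]r0 /redK /= /Kev !rmorphD !rmorphM /=.
  by congr (_ + _ * _ + _ * _); apply/eqP.
exists (mkK (k * 4) (k * 3) k - (mkK (K1 x + K2 x * 2) (K2 x) 0)).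
by apply: K_ext; rewrite /pi7 mulr2n /Kc !KE; lia.
Qed.

Lemma K_coprime14 (d : KK) : red2 d != 0 -> redK d != 0 -> coprimez (KN d) 14.
Proof.
move=> d2 d7.
have n2 : ~~ (2 %| KN d)%Z.
  apply/negP=> /KN_even[d' e]; move: d2; rewrite e rmorphMn -mulr_natl.
  by have -> : 2%:R = 0 :> OK 'F_2 by [apply/eqP]; rewrite mul0r eqxx.
have n7 : ~~ (7 %| KN d)%Z.
  rewrite (dvdz_pcharf (pchar_Fp (isT : prime 7))) -redK_norm.
  by rewrite expf_eq0.
by rewrite coprimez_sym (_ : 14 = 2 * 7) // coprimezMl !coprimezE !prime_coprime // n2 n7.
Qed.

Lemma K_double (d : KK) : d *+ 2 = KC 2 * d.
Proof. by apply: K_ext; rewrite mulr2n /KC !KE; ring. Qed.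

Lemma K_coprime14_red (d : KK) : coprimez (KN d) 14 -> red2 d != 0 /\ redK d != 0.
Proof.
rewrite coprimez_sym (_ : 14 = 2 * 7) // coprimezMl !coprimezE !prime_coprime //.
move=> /andP[n2 n7]; split.
  apply: contra n2 => /eqP e.
  have /Kmap2_eq[d' ->] : Kmap intr2 d = Kmap intr2 0 by rewrite rmorph0.
  by rewrite add0r K_double KNM KN_C abszM dvdn_mulr.
apply: contra n7 => /eqP e.
rewrite -[(7 %| _)%N]/(7 %| KN d)%Z (dvdz_pcharf (pchar_Fp (isT : prime 7))).
by rewrite -redK_norm e expr0n.
Qed.

Lemma K_inv14 (d : KK) : red2 d != 0 -> redK d != 0 ->
  exists d', red2 (d * d') = 1 /\ redK (d * d') = 1.
Proof.
move=> d2 d7; have /coprimezP[[u v] /= e] := K_coprime14 d2 d7.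
have E : d * (KC u * Kcof d) = (1 - v * 14)%:~R.
  have -> : 1 - v * 14 = u * KN d by move: (u * KN d) e => x; lia.
  by rewrite mulrCA Kcof_mul K_intE -(rmorphM (@KC int)).
have H (S : pzRingType) (f : {rmorphism KK -> S}) :
  f (d * (KC u * Kcof d)) = 1 - v%:~R * 14%:~R.
  by rewrite E (rmorph_int f) rmorphB rmorphM.
exists (KC u * Kcof d); rewrite !H.
have -> : 14%:~R = 0 :> OK 'F_2 by apply/eqP.
have -> : 14%:~R = 0 :> 'F_7 by apply/eqP.
by rewrite !mulr0 !subr0.
Qed.

Section SL2.
Variables (S : comNzRingType) (f : {rmorphism KK -> S}).
(** Whitehead's lemma: the matrix with rows (a (2 - w), w - 1) and (1 - w, a') has determinant
    exactly 1 and reduces to the diagonal matrix of a and its inverse. A row operation by c a' and a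
    column operation by b a' turn it into a lift of the given matrix. *)
Lemma Whitehead_red (a b c d a' : KK) : f (a * a') = 1 -> f (a * d - b * c) = 1 ->
  let w := a * a' in
  let A := a * (2 - w) in let B := w - 1 in
  let C := c * a' * A + (1 - w) in let D := c * a' * B + a' in
  [/\ f A = f a, f (A * (b * a') + B) = f b, f C = f c & f (C * (b * a') + D) = f d].
Proof.
move=> /=; rewrite !(rmorphD, rmorphN, rmorphM, rmorph1).
move: (f a) (f b) (f c) (f d) (f a') => x y z t x' h1 h2; rewrite !h1; split.
- by ring.
- by transitivity (y * (x * x')); [ring | rewrite h1 mulr1].
- by transitivity (z * (x * x')); [ring | rewrite h1 mulr1].
transitivity (x * x' * (z * y) * x' + x'); first by ring.
have -> : z * y = x * t - 1 by rewrite -h2; ring.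
by rewrite h1; transitivity (x * x' * t); [ring | rewrite h1 mul1r].
Qed.
Lemma shear_red (a c t A C : KK) : f A = f (a + t * c) -> f C = f c -> f (A - t * C) = f a.
Proof. by rewrite !(rmorphB, rmorphD, rmorphM) => -> ->; rewrite addrK. Qed.
End SL2.

(** A shear makes the upper left corner invertible at 2 and at 7 at once; then [Whitehead_red] gives
    one formula that lifts both residues, and the shear is undone. *)
Lemma SL2_lift (a b c d : KK) :
    red2 (a * d - b * c) = 1 -> redK (a * d - b * c) = 1 ->
  exists A B C D, [/\ A * D - B * C = 1,
    [/\ red2 A = red2 a, red2 B = red2 b, red2 C = red2 c & red2 D = red2 d] &
    [/\ redK A = redK a, redK B = redK b, redK C = redK c & redK D = redK d]].
Proof.
move=> h2 h7.
have [t t2 t7] : exists2 t : int, red2 (a + t%:~R * c) != 0 & redK (a + t%:~R * c) != 0.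
  have c2 : red2 a = 0 -> red2 c != 0.
    move=> a0; apply/eqP=> c0; move: h2; rewrite rmorphB !rmorphM a0 c0 mul0r mulr0 subr0.
    by move=> /eqP; rewrite eq_sym oner_eq0.
  have c7 : redK a = 0 -> redK c != 0.
    move=> a0; apply/eqP=> c0; move: h7; rewrite rmorphB !rmorphM a0 c0 mul0r mulr0 subr0.
    by move=> /eqP; rewrite eq_sym oner_eq0.
  (* By the Chinese remainder theorem 7 acts only at 2 and 8 only at 7, so one of 0, 1, 7, 8 repairs
     exactly the corners that vanish. *)
  have [i0 i1 i7 i8] : [/\ (0 : int)%:~R = 0 :> OK 'F_2, 1%:~R = 1 :> OK 'F_2,
    7%:~R = 1 :> OK 'F_2 & 8%:~R = 0 :> OK 'F_2] by split; apply/eqP.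
  have [j0 j1 j7 j8] : [/\ (0 : int)%:~R = 0 :> 'F_7, 1%:~R = 1 :> 'F_7,
    7%:~R = 0 :> 'F_7 & 8%:~R = 1 :> 'F_7] by split; apply/eqP.
  have [a2|a2] := eqVneq (red2 a) 0; have [a7|a7] := eqVneq (redK a) 0.
  - exists 1; rewrite rmorphD rmorphM rmorph_int ?a2 ?a7 ?i1 ?j1 mul1r add0r; [exact: c2 | exact: c7].
  - exists 7; rewrite rmorphD rmorphM rmorph_int ?a2 ?i7 ?j7; first by rewrite mul1r add0r c2.
    by rewrite mul0r addr0.
  - exists 8; rewrite rmorphD rmorphM rmorph_int ?a7 ?i8 ?j8; first by rewrite mul0r addr0.
    by rewrite mul1r add0r c7.
  by exists 0; rewrite mul0r addr0.
set a1 := a + t%:~R * c in t2 t7; set b1 := b + t%:~R * d.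
have [a' [e2 e7]] := K_inv14 t2 t7.
have E : a1 * d - b1 * c = a * d - b * c by rewrite /a1 /b1; ring.
have [A2 B2 C2 D2] := @Whitehead_red _ red2 a1 b1 c d a' e2 (etrans (congr1 _ E) h2).
have [A7 B7 C7 D7] := @Whitehead_red _ redK a1 b1 c d a' e7 (etrans (congr1 _ E) h7).
move: A2 B2 C2 D2 A7 B7 C7 D7.
set A := a1 * _; set B := A * _ + _; set C := c * a' * A + _; set D := C * _ + _.
move=> A2 B2 C2 D2 A7 B7 C7 D7.
exists (A - t%:~R * C), (B - t%:~R * D), C, D; split.
- by rewrite /D /B /C /A; ring.
- by split; [exact: (shear_red A2 C2) | exact: (shear_red B2 D2) | exact: C2 | exact: D2].
by split; [exact: (shear_red A7 C7) | exact: (shear_red B7 D7) | exact: C7 | exact: D7].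
Qed.

(* An element of the twisted group ring acts on Z[zeta] = Z[c] + Z[c](1 - zeta) by a 2x2 matrix
   whose upper right entry lies in the prime over 7; [toM] lists m11, m12 / pi7, m21, m22. *)
Definition toM (x : Alg) : KK * KK * KK * KK :=
  (L0 x.1 + L1 x.1 + L0 x.2 + L1 x.2, L1 x.1 + L0 x.2, - (L1 x.1 + L1 x.2),
   L0 x.1 - L1 x.1 + Kc * L1 x.1 - L0 x.2 - L1 x.2).
Definition fromM (a p c d : KK) : Alg :=
  let t := (Kc ^+ 2 - Kc) * (d - a - c *+ 2 + p *+ 2) in
  (mkL (a + c - p + t) t, mkL (p - t) (- c - t)).
Definition m11 x := (toM x).1.1.1.
Definition m12 x := (toM x).1.1.2.
Definition m21 x := (toM x).1.2.
Definition m22 x := (toM x).2.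

Lemma m11E (u v : OL int) : m11 (u, v) = L0 u + L1 u + L0 v + L1 v. Proof. by []. Qed.
Lemma m12E (u v : OL int) : m12 (u, v) = L1 u + L0 v. Proof. by []. Qed.
Lemma m21E (u v : OL int) : m21 (u, v) = - (L1 u + L1 v). Proof. by []. Qed.
Lemma m22E (u v : OL int) : m22 (u, v) = L0 u - L1 u + Kc * L1 u - L0 v - L1 v. Proof. by []. Qed.
Definition mE := (m11E, m12E, m21E, m22E).

Lemma Kc2_unit : (Kc ^+ 2 - Kc) * (Kc + 2) = 1 :> KK.
Proof.
transitivity (Kc ^+ 3 + Kc ^+ 2 - Kc *+ 2 : KK); first by ring.
by rewrite KcE; ring.
Qed.

Lemma fromMK x : fromM (m11 x) (m12 x) (m21 x) (m22 x) = x.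
Proof.
have E : (Kc ^+ 2 - Kc) * (m22 x - m11 x - m21 x *+ 2 + m12 x *+ 2) = L1 x.1.
  rewrite -[RHS]mul1r -Kc2_unit -mulrA; congr (_ * _).
  by rewrite /m11 /m12 /m21 /m22 /toM /=; ring.
rewrite /fromM E /m11 /m12 /m21 /=.
by apply: injective_projections; apply: L_ext; rewrite /= /L0 /L1 /=; ring.
Qed.

Lemma toMK a p c d : [/\ m11 (fromM a p c d) = a, m12 (fromM a p c d) = p,
  m21 (fromM a p c d) = c & m22 (fromM a p c d) = d].
Proof.
have : (Kc ^+ 2 - Kc) * (d - a - c *+ 2 + p *+ 2) * (Kc + 2) = d - a - c *+ 2 + p *+ 2.
  by rewrite mulrAC Kc2_unit mul1r.
rewrite /fromM; move: (_ * (d - a - c *+ 2 + p *+ 2)) => t E.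
rewrite !mE !LE; split; try by ring.
transitivity (a + c *+ 2 - p *+ 2 + t * (Kc + 2)); first by ring.
by rewrite E; ring.
Qed.

Lemma AlgE (u v : Alg) : u * v = (u.1 * v.1 + u.2 * Lconj v.2, u.1 * v.2 + u.2 * Lconj v.1).
Proof. by rewrite twE /=; congr pair; rewrite expr0 mulr1. Qed.

Lemma toM_mul x y : [/\ m11 (x * y) = m11 x * m11 y + pi7 * m12 x * m21 y,
  m12 (x * y) = m11 x * m12 y + m12 x * m22 y,
  m21 (x * y) = m21 x * m11 y + m22 x * m21 y &
  m22 (x * y) = pi7 * m21 x * m12 y + m22 x * m22 y].
Proof.
case: x y => [x1 x2] [y1 y2]; rewrite AlgE -[(x1, x2).1]/x1 -[(x1, x2).2]/x2 -[(y1, y2).1]/y1 -[(y1, y2).2]/y2.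
rewrite !mE /Lconj !LE /pi7.
move: (L0 x1) (L1 x1) (L0 x2) (L1 x2) (L0 y1) (L1 y1) (L0 y2) (L1 y2) => *.
by split; ring.
Qed.

Lemma toM_add x y : [/\ m11 (x + y) = m11 x + m11 y, m12 (x + y) = m12 x + m12 y,
  m21 (x + y) = m21 x + m21 y & m22 (x + y) = m22 x + m22 y].
Proof.
case: x y => [x1 x2] [y1 y2]; rewrite -[(x1, x2) + _]/(x1 + y1, x2 + y2) !mE !LE.
by split; ring.
Qed.

Lemma toM_ext x y : m11 x = m11 y -> m12 x = m12 y -> m21 x = m21 y -> m22 x = m22 y -> x = y.
Proof. by move=> h1 h2 h3 h4; rewrite -(fromMK x) -(fromMK y) h1 h2 h3 h4. Qed.

Definition nrA (x : Alg) : KK := Lnorm x.1 - Lnorm x.2.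
Lemma nrA_det x : m11 x * m22 x - pi7 * m12 x * m21 x = nrA x.
Proof. by rewrite /nrA /Lnorm /m11 /m12 /m21 /m22 /toM /pi7 /=; ring. Qed.

Lemma toM_int (n : int) : [/\ m11 n%:~R = n%:~R, m12 n%:~R = 0, m21 n%:~R = 0 & m22 n%:~R = n%:~R].
Proof.
have -> : n%:~R = (LC n%:~R, 0) :> Alg.
  by rewrite -[RHS]/(@twC (LD int false) _) rmorph_int rmorph_int.
by rewrite !mE /LC !LE; split; ring.
Qed.

Lemma red2_pi7_unit : red2 pi7 * red2 (Kcof pi7) = 1.
Proof. by rewrite -rmorphM; apply/eqP; vm_compute. Qed.

Lemma mod2A_ext x y : red2 (m11 x) = red2 (m11 y) -> red2 (m12 x) = red2 (m12 y) ->
  red2 (m21 x) = red2 (m21 y) -> red2 (m22 x) = red2 (m22 y) -> mod2A x = mod2A y.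
Proof.
move=> h1 h2 h3 h4; rewrite -(fromMK x) -(fromMK y) /fromM.
move: (m11 x) (m12 x) (m21 x) (m22 x) (m11 y) (m12 y) (m21 y) (m22 y) h1 h2 h3 h4.
move=> a p c d a' p' c' d' h1 h2 h3 h4.
have T : red2 ((Kc ^+ 2 - Kc) * (d - a - c *+ 2 + p *+ 2)) =
         red2 ((Kc ^+ 2 - Kc) * (d' - a' - c' *+ 2 + p' *+ 2)).
  by rewrite !(rmorphM red2) !(rmorphD red2) !(rmorphN red2) !(rmorphMn red2) h1 h2 h3 h4.
move: ((Kc ^+ 2 - Kc) * (d - a - c *+ 2 + p *+ 2)) ((Kc ^+ 2 - Kc) * (d' - a' - c' *+ 2 + p' *+ 2)) T.
move=> t t' T.
have E (a0 a1 b0 b1 : KK) : mod2A (mkL a0 a1, mkL b0 b1) =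
  (mkL (red2 a0) (red2 a1), mkL (red2 b0) (red2 b1)) by [].
by rewrite !E T !(rmorphD red2) !(rmorphN red2) h1 h2 h3 T.
Qed.

Lemma redA_toM x : redK (m11 x) = redL x.1 + redL x.2 /\ redK (m22 x) = redL x.1 - redL x.2.
Proof.
have E (v : OL int) : redL v = redK (L0 v) + redK (L1 v).
  by rewrite [in LHS](L_sum v) rmorphD rmorphM redL_z !redL_C mulr1.
rewrite /m11 /m22 /toM /= !E; split.
  by rewrite !(rmorphD redK); ring.
by rewrite !(rmorphD redK) !(rmorphN redK) (rmorphM redK) redK_c; ring.
Qed.

Lemma redA_ext x y : redK (m11 x) = redK (m11 y) -> redK (m22 x) = redK (m22 y) ->
  redA x = redA y.
Proof.
have [-> ->] := redA_toM x; have [-> ->] := redA_toM y.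
move=> h1 h2.
have two (a b : 'F_7) : a + a = b + b -> a = b.
  have E (c : 'F_7) : (c + c) * 4 = c.
    by transitivity (c * 8); [ring | rewrite (_ : 8 = 1) ?mulr1 //; apply/eqP].
  by move=> h; rewrite -(E a) h E.
have E u : redA u = (redL u.1, redL u.2) by [].
rewrite !E; congr pair; apply: two.
  transitivity (redL x.1 + redL x.2 + (redL x.1 - redL x.2)); first by ring.
  by rewrite h1 h2; ring.
transitivity (redL x.1 + redL x.2 - (redL x.1 - redL x.2)); first by ring.
by rewrite h1 h2; ring.
Qed.

Lemma KCint_eq0 (n : int) (a : KK) : n != 0 -> KC n * a = 0 -> a = 0.
Proof.
move=> n0 E; apply: KN_int_eq0; have := congr1 (@KN _) E; rewrite KNM KN_C.
have -> : KN (0 : KK) = 0 by [].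
by move=> /eqP; rewrite mulf_eq0 expf_eq0 (negPf n0) /= => /eqP.
Qed.

Section AlgGenerator.
Variables (I : Alg -> Prop) (N : int) (tau : Alg).
Hypothesis hI : lideal I.
Hypothesis IN : I N%:~R.
Hypothesis cN : coprimez N 14.
Hypothesis ct : coprimez (KN (nrA tau)) 14.

(** The matrix with upper row 0 and lower row (w1, w2). Left multiplication moves either row of an
    element of I into this position, so I is studied through the module W of such rows. *)
Let om (w1 w2 : KK) : Alg := fromM 0 0 w1 w2.
Let W w1 w2 := I (om w1 w2).

Let fromM_om (a p c d w1 w2 : KK) :
  fromM a p c d * om w1 w2 = fromM (pi7 * p * w1) (p * w2) (d * w1) (d * w2).
Proof.
have [e1 e2 e3 e4] := toM_mul (fromM a p c d) (om w1 w2).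
have [f1 f2 f3 f4] := toMK a p c d; have [g1 g2 g3 g4] := toMK 0 0 w1 w2.
have [h1 h2 h3 h4] := toMK (pi7 * p * w1) (p * w2) (d * w1) (d * w2).
by apply: toM_ext; rewrite ?h1 ?h2 ?h3 ?h4 ?e1 ?e2 ?e3 ?e4 ?f1 ?f2 ?f3 ?f4 /om ?g1 ?g2 ?g3 ?g4; ring.
Qed.

Let WD w1 w2 w1' w2' : W w1 w2 -> W w1' w2' -> W (w1 + w1') (w2 + w2').
Proof.
move=> h h'; have [_ D _] := hI; have := D _ _ h h'; rewrite /W.
suff -> : om w1 w2 + om w1' w2' = om (w1 + w1') (w2 + w2') by [].
have [e1 e2 e3 e4] := toM_add (om w1 w2) (om w1' w2').
have [f1 f2 f3 f4] := toMK 0 0 w1 w2; have [g1 g2 g3 g4] := toMK 0 0 w1' w2'.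
have [h1 h2 h3 h4] := toMK 0 0 (w1 + w1') (w2 + w2').
by apply: toM_ext; rewrite ?h1 ?h2 ?h3 ?h4 ?e1 ?e2 ?e3 ?e4 /om ?f1 ?f2 ?f3 ?f4 ?g1 ?g2 ?g3 ?g4 ?addr0.
Qed.
Let WM k w1 w2 : W w1 w2 -> W (k * w1) (k * w2).
Proof.
move=> h; have [_ _ M] := hI; have := M (fromM 0 0 0 k) _ h.
by rewrite fromM_om mulr0 !mul0r.
Qed.
Let W2 b : I b -> W (m21 b) (m22 b).
Proof.
move=> h; have [_ _ M] := hI; have := M (fromM 0 0 0 1) _ h; rewrite /W; congr I.
have [e1 e2 e3 e4] := toM_mul (fromM 0 0 0 1) b.
have [f1 f2 f3 f4] := toMK 0 0 0 1; have [g1 g2 g3 g4] := toMK 0 0 (m21 b) (m22 b).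
by apply: toM_ext; rewrite /om ?e1 ?e2 ?e3 ?e4 ?f1 ?f2 ?f3 ?f4 ?g1 ?g2 ?g3 ?g4; ring.
Qed.
Let W1 b : I b -> W (m11 b) (pi7 * m12 b).
Proof.
move=> h; have [_ _ M] := hI; have := M (fromM 0 0 1 0) _ h; rewrite /W; congr I.
have [e1 e2 e3 e4] := toM_mul (fromM 0 0 1 0) b.
have [f1 f2 f3 f4] := toMK 0 0 1 0; have [g1 g2 g3 g4] := toMK 0 0 (m11 b) (pi7 * m12 b).
by apply: toM_ext; rewrite /om ?e1 ?e2 ?e3 ?e4 ?f1 ?f2 ?f3 ?f4 ?g1 ?g2 ?g3 ?g4; ring.
Qed.

Let Hermite : exists d1 u d2, [/\ W d1 0, W u d2 &
  forall w1 w2, W w1 w2 -> exists p q, w1 = p * d1 + q * u /\ w2 = q * d2].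
Proof.
have h1 : lideal (fun w1 => W w1 0).
  split.
  - by have := WM 0 (W2 IN); rewrite !mul0r.
  - by move=> a b ha hb; have := WD ha hb; rewrite addr0.
  by move=> r a ha; have := WM r ha; rewrite mulr0.
have h2 : lideal (fun w2 => exists w1, W w1 w2).
  split.
  - by exists 0; have := WM 0 (W2 IN); rewrite !mul0r.
  - by move=> a b [a' ha] [b' hb]; exists (a' + b'); exact: WD ha hb.
  by move=> r a [a' ha]; exists (r * a'); exact: WM.
have [d1 Wd1 g1] := K_principal h1; have [d2 [u Wu] g2] := K_principal h2.
exists d1, u, d2; split=> // w1 w2 h; have [q eq] := g2 w2 (ex_intro _ w1 h).
have [p ep] : exists p, w1 - q * u = p * d1.
  apply: g1; have := WD h (WM (- q) Wu); rewrite eq.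
  by rewrite (_ : _ + - q * u = w1 - q * u) 1?(_ : q * d2 + _ = 0) //; ring.
by exists p, q; split=> //; rewrite -ep subrK.
Qed.

(** Let H be the Hermite basis of the rows. Mod 2 and mod the prime over 7 the quotient tau H^-1
    exists since N is prime to 14. Its determinant is the residue of a unit by [K_units_surj]; after
    division by that unit it lifts by [SL2_lift] to an exact change of basis. *)
Lemma Alg_generator : exists al, [/\ I al, forall b, I b -> exists q, b = q * al,
  mod2A al = mod2A tau & redA al = redA tau].
Proof.
have [_ ID IM] := hI.
have [d1 [u [d2 [Wd1 Wu Wgen]]]] := Hermite.
have [i11 i12 i21 i22] := toM_int N.
have [q2 e2] : exists q, N%:~R = q * d2.
  by have [p [q [_ e]]] := Wgen _ _ (W2 IN); exists q; rewrite -e i22.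
have [q1 e1] : exists q, N%:~R = q * d1 :> KK.
  have [p [q [e e']]] := Wgen _ _ (W1 IN).
  have q0 : q * (q2 * d2) = 0 by rewrite mulrCA -e' i12 !mulr0.
  have {}q0 : q = 0.
    move: q0; rewrite -e2 K_intE mulrC => /KCint_eq0; apply; apply/eqP=> N0.
    by move: cN; rewrite N0 /coprimez gcd0z.
  by exists p; rewrite -i11 e q0 mul0r addr0.
have cNN : coprimez (KN (N%:~R * N%:~R : KK)) 14.
  by rewrite KNM K_intE KN_C coprimezMl coprimezXl.
have [NN2 NN7] := K_coprime14_red cNN.
have EN : N%:~R * N%:~R = q1 * q2 * (d1 * d2) by rewrite {1}e1 e2; ring.
have nz2 : red2 (d1 * d2) != 0.
  by apply: contraNneq NN2 => h; rewrite EN rmorphM h mulr0.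
have nz7 : redK (d1 * d2) != 0.
  by apply: contraNneq NN7 => h; rewrite EN rmorphM h mulr0.
have [de [de2 de7]] := K_inv14 nz2 nz7.
set t11 := m11 tau; set t12 := m12 tau; set t21 := m21 tau; set t22 := m22 tau.
have [T2 T7] := K_coprime14_red ct.
have detE (S : comNzRingType) (f : {rmorphism KK -> S}) : f (d1 * d2 * de) = 1 ->
    f (nrA tau * de) * f (d1 * d2) = f (nrA tau).
  by move=> h; rewrite -rmorphM -mulrA [de * _]mulrC rmorphM h mulr1.
have [ep [uep ep2 ep7]] : exists u, [/\ Kunit u, red2 u = red2 (nrA tau * de) & redK u = redK (nrA tau * de)].
  apply: K_units_surj.
    by apply: contraNneq T2 => h; rewrite -(detE _ red2 de2) h mul0r.
  by apply: contraNneq T7 => h; rewrite -(detE _ redK de7) h mul0r.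
have [ep' epK] := uep.
(* tau times the adjugate of H, whose rows are (d1, 0) and (u, d2), times the inverse [de] of its
   determinant at 2 and 7. *)
pose y11 := (t11 * d2 - pi7 * t12 * u) * de; pose y12 := pi7 * t12 * d1 * de.
pose y21 := (t21 * d2 - t22 * u) * de; pose y22 := t22 * d1 * de.
have detY (S : comNzRingType) (f : {rmorphism KK -> S}) : f (d1 * d2 * de) = 1 ->
    f ep = f (nrA tau * de) -> f (ep' * y11 * y22 - ep' * y12 * y21) = 1.
  move=> h h'.
  have -> : ep' * y11 * y22 - ep' * y12 * y21 = ep' * (nrA tau * de) * (d1 * d2 * de).
    by rewrite -nrA_det /y11 /y12 /y21 /y22 -/t11 -/t12 -/t21 -/t22; ring.
  by rewrite rmorphM h mulr1 rmorphM -h' -rmorphM mulrC epK rmorph1.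
have [A [B [C [D [det1 c2 c7]]]]] := SL2_lift (detY _ red2 de2 ep2) (detY _ redK de7 ep7).
have congM (S : comNzRingType) (f : {rmorphism KK -> S}) : f (d1 * d2 * de) = 1 ->
   [/\ f A = f (ep' * y11), f B = f (ep' * y12), f C = f y21 & f D = f y22] ->
   [/\ f (ep * (A * d1 + B * u)) = f t11, f (ep * (B * d2)) = f (pi7 * t12),
       f (C * d1 + D * u) = f t21 & f (D * d2) = f t22].
  move=> h [hA hB hC hD].
  have k (z w z' : KK) : z = w * (d1 * d2 * de) -> w = z' -> f z = f z'.
    by move=> -> ->; rewrite rmorphM h mulr1.
  split.
  - transitivity (f (ep * (ep' * y11 * d1 + ep' * y12 * u))).
      by rewrite (rmorphM f ep) (rmorphD f (A * d1)) (rmorphM f A) (rmorphM f B) hA hB -!rmorphM -rmorphD -rmorphM.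
    apply: (k _ (ep * ep' * t11)); last by rewrite epK mul1r.
    by rewrite /y11 /y12; ring.
  - transitivity (f (ep * (ep' * y12 * d2))); first by rewrite (rmorphM f ep) (rmorphM f B) hB -!rmorphM.
    apply: (k _ (ep * ep' * (pi7 * t12))); last by rewrite epK mul1r.
    by rewrite /y12; ring.
  - transitivity (f (y21 * d1 + y22 * u)); first by rewrite (rmorphD f (C * d1)) (rmorphM f C) (rmorphM f D) hC hD -!rmorphM -rmorphD.
    by apply: (k _ t21) => //; rewrite /y21 /y22; ring.
  transitivity (f (y22 * d2)); first by rewrite (rmorphM f D) hD -rmorphM.
  by apply: (k _ t22) => //; rewrite /y22; ring.
have [k11 k12 k21 k22] := congM _ red2 de2 c2.
have [l11 l12 l21 l22] := congM _ redK de7 c7.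
move: k11 k12 k21 k22 l11 l12 l21 l22.
set M11 := ep * (A * d1 + B * u); set M12 := ep * (B * d2).
set M21 := C * d1 + D * u; set M22 := D * d2.
move=> k11 k12 k21 k22 l11 l12 l21 l22.
have [m em] : exists m, M12 = pi7 * m.
  by apply: redK_eq0; rewrite l12 rmorphM redK_pi7 mul0r.
have km : red2 m = red2 t12.
  have E : red2 pi7 * red2 m = red2 pi7 * red2 t12.
    by rewrite -(rmorphM red2 pi7 m) -em k12; exact: rmorphM.
  have := congr1 ( *%R (red2 (Kcof pi7))) E.
  by rewrite !mulrA [red2 (Kcof _) * _]mulrC red2_pi7_unit !mul1r.
have l22n : redK M22 != 0.
  rewrite l22; apply: contraNneq T7 => h.
  by rewrite -nrA_det rmorphB !rmorphM redK_pi7 -/t22 h mulr0 !mul0r subr0.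
exists (fromM M11 m M21 M22).
have [f1 f2 f3 f4] := toMK M11 m M21 M22.
have Wrow1 : W M11 M12.
  rewrite /M11 /M12; apply: WM; have := WD (WM A Wd1) (WM B Wu).
  by rewrite mulr0 add0r.
have Wrow2 : W M21 M22.
  by rewrite /M21 /M22; have := WD (WM C Wd1) (WM D Wu); rewrite mulr0 add0r.
have rows w1 w2 : W w1 w2 -> exists Q1 Q2, w1 = Q1 * M11 + Q2 * M21 /\ w2 = Q1 * M12 + Q2 * M22.
  move=> /Wgen[p [q [-> ->]]]; exists (ep' * (p * D - q * C)), (q * A - p * B).
  rewrite /M11 /M12 /M21 /M22; split.
    transitivity ((p * D - q * C) * (A * d1 + B * u) * (ep * ep') + (q * A - p * B) * (C * d1 + D * u)); last by ring.
    rewrite epK mulr1; transitivity ((A * D - B * C) * (p * d1 + q * u)); first by rewrite det1 mul1r.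
    by ring.
  transitivity ((p * D - q * C) * (B * d2) * (ep * ep') + (q * A - p * B) * (D * d2)); last by ring.
  rewrite epK mulr1; transitivity ((A * D - B * C) * (q * d2)); first by rewrite det1 mul1r.
  by ring.
clearbody M11 M12 M21 M22.
split.
- have -> : fromM M11 m M21 M22 = fromM M11 m 0 0 + om M21 M22.
    have [g1 g2 g3 g4] := toMK M11 m 0 0; have [h1 h2 h3 h4] := toMK 0 0 M21 M22.
    have [a1 a2 a3 a4] := toM_add (fromM M11 m 0 0) (om M21 M22).
    apply: toM_ext; rewrite ?f1 ?f2 ?f3 ?f4 ?a1 ?a2 ?a3 ?a4 ?g1 ?g2 ?g3 ?g4.
    + by rewrite h1 addr0.
    + by rewrite h2 addr0.
    + by rewrite h3 add0r.
    by rewrite h4 add0r.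
  (* W only returns pi7 times the upper row to its place, hence 7 times it. As I contains N, which
     is prime to 7, nothing is lost. *)
  apply: (ID) => //; set x0 := fromM M11 m 0 0.
  have Ip : I (fromM pi7 0 0 pi7 * x0).
    have := IM (fromM 0 1 0 0) _ Wrow1; rewrite fromM_om; congr I.
    have [g1 g2 g3 g4] := toMK M11 m 0 0; have [h1 h2 h3 h4] := toMK pi7 0 0 pi7.
    have [a1 a2 a3 a4] := toM_mul (fromM pi7 0 0 pi7) x0.
    have [b1 b2 b3 b4] := toMK (pi7 * 1 * M11) (1 * M12) (0 * M11) (0 * M12).
    apply: toM_ext; rewrite ?b1 ?b2 ?b3 ?b4 ?a1 ?a2 ?a3 ?a4 /x0 ?g1 ?g2 ?g3 ?g4 ?h1 ?h2 ?h3 ?h4 ?em; by ring.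
  have I7 : I ((7 : int)%:~R * x0).
    have := IM (fromM (Kcof pi7) 0 0 (Kcof pi7)) _ Ip; rewrite mulrA.
    suff -> : fromM (Kcof pi7) 0 0 (Kcof pi7) * fromM pi7 0 0 pi7 = (7 : int)%:~R by [].
    have [g1 g2 g3 g4] := toMK (Kcof pi7) 0 0 (Kcof pi7).
    have [h1 h2 h3 h4] := toMK pi7 0 0 pi7.
    have [a1 a2 a3 a4] := toM_mul (fromM (Kcof pi7) 0 0 (Kcof pi7)) (fromM pi7 0 0 pi7).
    have [b1 b2 b3 b4] := toM_int 7.
    have E7 : Kcof pi7 * pi7 = (7 : int)%:~R by rewrite mulrC Kcof_mul K_intE.
    apply: toM_ext; rewrite ?b1 ?b2 ?b3 ?b4 ?a1 ?a2 ?a3 ?a4 ?g1 ?g2 ?g3 ?g4 ?h1 ?h2 ?h3 ?h4 -?E7; by ring.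
  have /coprimezP[[a b] /= eab] : coprimez N 7.
    by move: cN; rewrite (_ : 14 = 2 * 7) // coprimezMr => /andP[].
  have E : x0 = (a%:~R * x0) * N%:~R + b%:~R * (7%:~R * x0).
    rewrite -mulrA (commr_int x0 N : x0 * N%:~R = _) !mulrA -!rmorphM -mulrDl -rmorphD.
    by rewrite eab mul1r.
  by rewrite E; exact: (ID _ _ (IM (a%:~R * x0) _ IN) (IM b%:~R _ I7)).
- move=> b Ib; have [p1 [p2 [r11 r12]]] := rows _ _ (W1 Ib).
  have [s1 [s2 [r21 r22]]] := rows _ _ (W2 Ib).
  have [q eq] : exists q, p2 = pi7 * q.
    apply: redK_eq0; have := congr1 redK r12; rewrite em rmorphD !rmorphM redK_pi7 !mul0r mulr0 add0r.
    by move=> /esym/eqP; rewrite mulf_eq0 (negPf l22n) orbF => /eqP.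
  exists (fromM p1 q s1 s2 * 1); rewrite mulr1.
  have [g1 g2 g3 g4] := toMK p1 q s1 s2.
  have [a1 a2 a3 a4] := toM_mul (fromM p1 q s1 s2) (fromM M11 m M21 M22).
  apply: toM_ext; rewrite ?a1 ?a2 ?a3 ?a4 ?g1 ?g2 ?g3 ?g4 ?f1 ?f2 ?f3 ?f4.
  + by rewrite r11 eq; ring.
  + apply/eqP; rewrite -subr_eq0; apply/eqP; apply: (@KCint_eq0 7) => //.
    have <- : Kcof pi7 * pi7 = KC 7 by rewrite mulrC Kcof_mul.
    rewrite -mulrA mulrBr r12 em eq; ring.
  + by rewrite r21.
  by rewrite r22 em; ring.
- by apply: mod2A_ext; rewrite ?f1 ?f2 ?f3 ?f4.
by apply: redA_ext; rewrite ?f1 ?f4.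
Qed.
End AlgGenerator.

(** * Left ideals of the group ring that are locally principal *)

Lemma int_principal (I : int -> Prop) : lideal I ->
  exists2 g, I g & forall a, I a -> exists q, a = q * g.
Proof.
apply: (@euclid_principal _ (fun a : int => `|a|%N)) => a b b0.
exists (a %/ b)%Z; have -> : a - (a %/ b)%Z * b = (a %% b)%Z.
  by rewrite {1}(divz_eq a b) addrC addKr.
by move/eqP: b0 => b0; have := ltz_mod a b0; have := modz_ge0 a b0; lia.
Qed.

Lemma ZC2E (u v : ZC2) : u * v = (u.1 * v.1 + u.2 * v.2, u.1 * v.2 + u.2 * v.1).
Proof. by rewrite twE /=; congr pair; rewrite expr0 mulr1. Qed.
Lemma ZC2_int (n : int) : n%:~R = (n, 0) :> ZC2.
Proof. by rewrite -[RHS]/(@twC (FD int false) n) -[in RHS](intz n) rmorph_int. Qed.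
Lemma Zi_int (n : int) : n%:~R = (n, 0) :> Zi.
Proof. by rewrite -[RHS]/(@twC (FD int true) n) -[in RHS](intz n) rmorph_int. Qed.
Lemma Lam_int (n : int) : n%:~R = DK (KC n) :> Lam.
Proof.
have -> : KC n = n%:~R by rewrite -[in LHS](intz n) (rmorph_int (@KC int)).
by rewrite -[RHS]/(@twC (LD int true) (LC n%:~R)) (rmorph_int (@LC int)) rmorph_int.
Qed.

Definition dC2 (e : ZC2) : int := e.1 ^+ 2 - e.2 ^+ 2.
Lemma dC2M u v : dC2 (u * v) = dC2 u * dC2 v.
Proof. by rewrite /dC2 ZC2E /=; ring. Qed.

Lemma coprimez_mulr (x y z : int) : x * y = z -> coprimez z 14 -> coprimez y 14.
Proof. by move=> <-; rewrite coprimezMl => /andP[]. Qed.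

Lemma dC2_coprime (q e : ZC2) (n : int) : n%:~R = q * e -> coprimez n 14 -> coprimez (dC2 e) 14.
Proof.
move=> /(congr1 dC2); rewrite dC2M ZC2_int /dC2 /= => E cn.
by apply: (coprimez_mulr (esym E)); rewrite expr0n subr0 coprimezXl.
Qed.

Lemma odd_factor (n q g : int) : n = q * g -> ~~ (2 %| n)%Z -> exists k, g = k * 2 + 1.
Proof.
move=> -> h; have g2 : ~~ (2 %| g)%Z by apply: contra h => /dvdz_mull.
by exists (g %/ 2)%Z; clear h; lia.
Qed.

Lemma ZC2_quotient (a b p1 p2 k1 k2 : int) :
    a + 1 * b = p1 * (k1 * 2 + 1) -> a + -1 * b = p2 * (k2 * 2 + 1) ->
  exists k, a = (p2 + k) * (k1 + k2 + 1) + k * (k1 - k2) /\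
            b = (p2 + k) * (k1 - k2) + k * (k1 + k2 + 1).
Proof.
move=> h1 h2; exists (p2 * k2 - p1 * k1 + b).
have E : p1 = p2 + (p2 * k2 - p1 * k1 + b) * 2 by lia.
by move: (p2 * k2 - p1 * k1 + b) E => k E; move: h1 h2; rewrite E => h1 h2; split; lia.
Qed.

(** Z[C2] is the ring of pairs of integers congruent mod 2. The images of J at y = 1 and y = -1 have
    generators dividing n, hence odd, so these form an element e of Z[C2]; J contains 2 e and the
    odd n, therefore e. *)
Lemma ZC2_generator (J : ZC2 -> Prop) (n : int) : lideal J -> J n%:~R -> ~~ (2 %| n)%Z ->
  exists2 e, J e & forall j, J j -> exists q, j = q * e.
Proof.
move=> hJ Jn on; have [J0 JD JM] := hJ.
have hs (c : int) : lideal (fun m => exists2 j, J j & m = j.1 + c * j.2).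
  split; first by exists 0 => //=; ring.
    move=> a b [i Ji ->] [j Jj ->]; exists (i + j); [exact: JD | rewrite /=; ring].
  move=> r a [i Ji ->]; exists (r%:~R * i); first exact: JM.
  by rewrite ZC2_int ZC2E /=; ring.
have [g1 [i1 Ji1 E1] G1] := int_principal (hs 1).
have [g2 [i2 Ji2 E2] G2] := int_principal (hs (-1)).
have nE (c : int) : n = (n%:~R : ZC2).1 + c * (n%:~R : ZC2).2 by rewrite ZC2_int /=; ring.
have [q1 Q1] := G1 n (ex_intro2 _ _ _ Jn (nE 1)).
have [q2 Q2] := G2 n (ex_intro2 _ _ _ Jn (nE (-1))).
have [k1 o1] := odd_factor Q1 on; have [k2 o2] := odd_factor Q2 on.
pose e : ZC2 := (k1 + k2 + 1, k1 - k2).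
exists e.
  pose y1 : ZC2 := (1, 1); pose y2 : ZC2 := (1, -1).
  have J2 : J (2%:~R * e).
    have := JD _ _ (JM y1 _ Ji1) (JM y2 _ Ji2).
    suff -> : y1 * i1 + y2 * i2 = 2%:~R * e by [].
    move: E1 E2; rewrite ZC2_int !ZC2E /y1 /y2 /e o1 o2; case: (i1) (i2) => [a b] [a' b'] /= E1 E2.
    apply: injective_projections => /=; clear -E1 E2.
      transitivity ((a + 1 * b) + (a' + -1 * b')); [ring | rewrite -E1 -E2; ring].
    transitivity ((a + 1 * b) - (a' + -1 * b')); [ring | rewrite -E1 -E2; ring].
  have /coprimezP[[a b] /= eab] : coprimez n 2.
    by rewrite coprimez_sym coprimezE prime_coprime.
  have E : e = (a%:~R * e) * n%:~R + b%:~R * (2%:~R * e).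
    rewrite -mulrA (commr_int e n : e * n%:~R = _) !mulrA -!rmorphM -mulrDl -rmorphD.
    by rewrite eab mul1r.
  by rewrite E; exact: (JD _ _ (JM (a%:~R * e) _ Jn) (JM b%:~R _ J2)).
move=> j Jj.
have [p1 P1] := G1 _ (ex_intro2 _ _ _ Jj erefl).
have [p2 P2] := G2 _ (ex_intro2 _ _ _ Jj erefl).
have [k [Ek1 Ek2]] := ZC2_quotient (etrans P1 (congr1 _ o1)) (etrans P2 (congr1 _ o2)).
pose q : ZC2 := (p2 + k, k); exists q; rewrite ZC2E /q /e.
by apply: injective_projections; [exact: Ek1 | exact: Ek2].
Qed.

Lemma piLM r s : piL (r * s) = piL r * piL s. Proof. exact: (rmorphM piL). Qed.
Lemma piIM r s : piI (r * s) = piI r * piI s. Proof. exact: (rmorphM piI). Qed.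
Lemma piAM r s : piA (r * s) = piA r * piA s. Proof. exact: (rmorphM piA). Qed.
Lemma piSM r s : piS (r * s) = piS r * piS s. Proof. exact: (rmorphM piS). Qed.

Lemma piL_surj l : exists r, piL r = l.
Proof.
by have [p P] := evL_surj true l.1; have [q Q] := evL_surj true l.2; exists (p, q); apply: injective_projections.
Qed.
Lemma piA_surj l : exists r, piA r = l.
Proof.
by have [p P] := evL_surj false l.1; have [q Q] := evL_surj false l.2; exists (p, q); apply: injective_projections.
Qed.
Lemma evZ_int b (n : int) : evZ b n%:~R = n.
Proof. by rewrite rmorph_int intz. Qed.
Lemma piI_surj l : exists r, piI r = l.
Proof.
by exists (l.1%:~R, l.2%:~R); apply: injective_projections; exact: (evZ_int true).
Qed.
Lemma piS_surj l : exists r, piS r = l.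
Proof.
by exists (l.1%:~R, l.2%:~R); apply: injective_projections; exact: (evZ_int false).
Qed.

Definition img (T : nzRingType) (f : R -> T) (I : R -> Prop) (t : T) := exists2 i, I i & f i = t.
Lemma img_lideal (T : nzRingType) (f : {rmorphism R -> T}) (I : R -> Prop) :
  (forall t, exists r, f r = t) -> lideal I -> lideal (img f I).
Proof.
move=> fs [I0 ID IM]; split; first by exists 0; rewrite ?rmorph0.
  by move=> a b [i Ii <-] [j Ij <-]; exists (i + j); [exact: ID | rewrite rmorphD].
by move=> r a [i Ii <-]; have [s <-] := fs r; exists (s * i); [exact: IM | rewrite rmorphM].
Qed.

Lemma int_char (S : pzRingType) (m x y : int) : m%:~R = 0 :> S -> x + y * m = 1 -> x%:~R = 1 :> S.
Proof.
move=> c e; transitivity ((x + y * m)%:~R : S); last by rewrite e.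
by rewrite rmorphD rmorphM /= c mulr0 addr0.
Qed.

Lemma char14 : [/\ (14 : int)%:~R = 0 :> F49, (14 : int)%:~R = 0 :> tw (LD 'F_2 false),
  (14 : int)%:~R = 0 :> tw (FD 'F_7 false) & (14 : int)%:~R = 0 :> tw (FD 'F_2 false)].
Proof.
split.
- by rewrite -(rmorph_int redZi) Zi_int; apply: injective_projections; apply/eqP.
- rewrite -(rmorph_int mod2L) Lam_int; apply: injective_projections; apply: L_ext; apply: K_ext; by apply/eqP.
- by rewrite -(rmorph_int redE) ZC2_int; apply: injective_projections; apply/eqP.
by rewrite -(rmorph_int mod2E) ZC2_int; apply: injective_projections; apply/eqP.
Qed.

Lemma Lam_inv14 (l : Lam) : coprimez (KN (nr l)) 14 ->
  exists x, redLam (l * x) = 1 /\ mod2L (l * x) = 1.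
Proof.
move=> /coprimezP[[u v] /= e]; exists (star l * DK (Kcof (nr l) * KC u)).
have -> : l * (star l * DK (Kcof (nr l) * KC u)) = (u * KN (nr l))%:~R.
  by rewrite mulrA nr_star -DK_M mulrA Kcof_mul -(rmorphM (@KC int)) Lam_int mulrC.
have [c1 c2 _ _] := char14.
by rewrite (rmorph_int redLam) (rmorph_int mod2L); split; [exact: (int_char c1 e) | exact: (int_char c2 e)].
Qed.

Lemma ZC2_inv14 (e : ZC2) : coprimez (dC2 e) 14 ->
  exists x, redE (e * x) = 1 /\ mod2E (e * x) = 1.
Proof.
move=> /coprimezP[[u v] /= h]; pose e' : ZC2 := (e.1, - e.2); exists (e' * u%:~R).
have -> : e * (e' * u%:~R) = (u * dC2 e)%:~R.
  by rewrite !ZC2_int !ZC2E /e' /dC2; apply: injective_projections => /=; ring.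
have [_ _ c1 c2] := char14.
by rewrite (rmorph_int redE) (rmorph_int mod2E); split; [exact: (int_char c1 h) | exact: (int_char c2 h)].
Qed.

Lemma cancel_inv (T S : pzRingType) (f : {rmorphism T -> S}) (x y : T) (a b : S) :
  f (x * y) = 1 -> a * f x = b * f x -> a = b.
Proof.
rewrite rmorphM => e /(congr1 ( *%R^~ (f y))) /=.
by rewrite -!mulrA e !mulr1.
Qed.

(** By [glue], R contains 14 times each of the four idempotents of the product of components, so 14
    x is in I; and n x is in I with n prime to 14. *)
Lemma comp_mem (I : R -> Prop) (n : int) x : lideal I -> I n%:~R -> coprimez n 14 ->
  img piL I (piL x) -> img piI I (piI x) -> img piA I (piA x) -> img piS I (piS x) -> I x.
Proof.
move=> [I0 ID IM] In cn [i1 I1 e1] [i2 I2 e2] [i3 I3 e3] [i4 I4 e4].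
have [c1 c2 c3 c4] := char14.
have [E1 [a1 a2 a3 a4]] : exists r, [/\ piL r = 14%:~R, piI r = 0, piA r = 0 & piS r = 0].
  by apply: glue; rewrite ?(rmorph_int redLam) ?(rmorph_int mod2L) ?rmorph0.
have [E2 [b1 b2 b3 b4]] : exists r, [/\ piL r = 0, piI r = 14%:~R, piA r = 0 & piS r = 0].
  by apply: glue; rewrite ?(rmorph_int redZi) ?(rmorph_int mod2I) ?rmorph0.
have [E3 [d1 d2 d3 d4]] : exists r, [/\ piL r = 0, piI r = 0, piA r = 14%:~R & piS r = 0].
  by apply: glue; rewrite ?(rmorph_int redA) ?(rmorph_int mod2A) ?rmorph0.
have [E4 [f1 f2 f3 f4]] : exists r, [/\ piL r = 0, piI r = 0, piA r = 0 & piS r = 14%:~R].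
  by apply: glue; rewrite ?(rmorph_int redE) ?(rmorph_int mod2E) ?rmorph0.
have I14 : I (14%:~R * x).
  have -> : 14%:~R * x = (E1 * i1 + E2 * i2) + (E3 * i3 + E4 * i4).
    have H (T : nzRingType) (f : {rmorphism R -> T}) t1 t2 t3 t4 :
        f E1 = t1 -> f E2 = t2 -> f E3 = t3 -> f E4 = t4 ->
        14%:~R * f x = t1 * f i1 + t2 * f i2 + (t3 * f i3 + t4 * f i4) ->
        f (14%:~R * x) = f ((E1 * i1 + E2 * i2) + (E3 * i3 + E4 * i4)).
      by move=> <- <- <- <- h; rewrite rmorphM rmorph_int h !rmorphD !rmorphM.
    apply: pi_inj.
    - by apply: (H _ piL _ _ _ _ a1 b1 d1 f1); rewrite !mul0r ?addr0 ?add0r; congr (_ * _); exact: esym e1.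
    - by apply: (H _ piI _ _ _ _ a2 b2 d2 f2); rewrite !mul0r ?addr0 ?add0r; congr (_ * _); exact: esym e2.
    - by apply: (H _ piA _ _ _ _ a3 b3 d3 f3); rewrite !mul0r ?addr0 ?add0r; congr (_ * _); exact: esym e3.
    by apply: (H _ piS _ _ _ _ a4 b4 d4 f4); rewrite !mul0r ?addr0 ?add0r; congr (_ * _); exact: esym e4.
  by apply: (ID); apply: (ID); apply: IM.
have /coprimezP[[a b] /= eab] := cn.
have -> : x = (a%:~R * x) * n%:~R + b%:~R * (14%:~R * x).
  rewrite -mulrA (commr_int x n : x * n%:~R = _) !mulrA -!rmorphM -mulrDl -rmorphD.
  by rewrite eab mul1r.
exact: (ID _ _ (IM _ _ In) (IM _ _ I14)).
Qed.

Lemma Lam_coprime (q l : Lam) (n : int) : n%:~R = q * l -> coprimez n 14 ->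
  coprimez (KN (nr l)) 14.
Proof.
move=> /(congr1 (fun u => KN (nr u))); rewrite nrM KNM => e cn; apply: (coprimez_mulr (esym e)).
rewrite Lam_int /DK /nr /= Lnorm_C.
have -> : Lnorm 0 = 0 :> OK int by rewrite /Lnorm !LE; ring.
by rewrite addr0 expr2 KNM KN_C coprimezMl !coprimezXl.
Qed.

Lemma Zi_coprime (q l : Zi) (n : int) : n%:~R = q * l -> coprimez n 14 ->
  coprimez (Zi_norm l) 14.
Proof.
move=> /(congr1 Zi_norm); rewrite Zi_norm_M => e cn; apply: (coprimez_mulr (esym e)).
by rewrite Zi_int /Zi_norm /= expr0n addr0 coprimezXl.
Qed.

Definition Zij : Zi := (0, 1).
Definition C2y : ZC2 := (0, 1).

(** Odd norm means a unit of F2[C2], and the units of that ring are 1 and y. *)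
Lemma mod2_odd (u : Zi) (e : ZC2) : coprimez (Zi_norm u) 14 -> coprimez (dC2 e) 14 ->
  mod2I u = mod2E e \/ mod2I u = mod2E (C2y * e).
Proof.
have par (a : int) : intr2 a = ((2 %| a)%Z == false)%:R.
  rewrite (dvdz_pcharf (pchar_Fp (isT : prime 2))) -[a%:~R]/(intr2 a).
  by case: (F2_case (intr2 a)) => ->.
have c2 (n : int) : coprimez n 14 -> ~~ (2 %| n)%Z.
  rewrite coprimez_sym (_ : 14 = 2 * 7) // coprimezMl coprimezE prime_coprime //.
  by move=> /andP[].
case: u e => a b [c d] /c2 h1 /c2 h2.
have -> : C2y * ((c, d) : ZC2) = (d, c) by rewrite ZC2E /=; congr pair; ring.
rewrite -[mod2I _]/(intr2 a, intr2 b) -![mod2E _]/(intr2 _, intr2 _) /=.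
rewrite !par; move: h1 h2; rewrite /Zi_norm /dC2 /=.
have D z : (2 %| z)%Z = (intr2 z == 0) by exact: dvdz_pcharf (pchar_Fp (isT : prime 2)) z.
have sq (x y : int) : (2 %| x ^+ 2 + y ^+ 2)%Z = (2 %| x + y)%Z.
  rewrite !D !(rmorphD intr2) !(rmorphXn intr2).
  by move: (intr2 x) (intr2 y) => u v; case: (F2_case u) (F2_case v) => -> [] ->; vm_compute.
have sq' (x y : int) : (2 %| x ^+ 2 - y ^+ 2)%Z = (2 %| x + y)%Z.
  rewrite !D (rmorphB intr2) (rmorphD intr2) !(rmorphXn intr2).
  by move: (intr2 x) (intr2 y) => u v; case: (F2_case u) (F2_case v) => -> [] ->; vm_compute.
rewrite sq sq' => h1 h2.
by case: (boolP (2 %| a)%Z) (boolP (2 %| b)%Z) (boolP (2 %| c)%Z) (boolP (2 %| d)%Z)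
  => ? [] ? [] ? [] ?; first [left; done | right; done | exfalso; lia].
Qed.

Lemma redLam_DK a : redLam (DK a) = (redK a, 0).
Proof. by apply: injective_projections; rewrite /= ?redL_C ?rmorph0. Qed.
Lemma F49_int (n : int) : n%:~R = (n%:~R, 0) :> F49.
Proof. by rewrite -(rmorph_int redZi) Zi_int. Qed.
Lemma F49_scal (a : 'F_7) (u : F49) : ((a, 0) : F49) * u = (a * u.1, a * u.2).
Proof. by rewrite twE /=; congr pair; ring. Qed.

Lemma red2_nrA (t : Alg) (l : Lam) : mod2A t = mod2L l -> red2 (nrA t) = red2 (nr l).
Proof.
case: t l => [t1 t2] [l1 l2] h.
have h1 : Lmap intr2 t1 = Lmap intr2 l1 := congr1 fst h.
have h2 : Lmap intr2 t2 = Lmap intr2 l2 := congr1 snd h.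
transitivity (Lnorm (Lmap intr2 t1) - Lnorm (Lmap intr2 t2)).
  by rewrite !Lnorm_map; exact: (rmorphB red2 (Lnorm t1) (Lnorm t2)).
rewrite h1 h2; transitivity (Lnorm (Lmap intr2 l1) + Lnorm (Lmap intr2 l2)); last first.
  by rewrite !Lnorm_map; exact: esym (rmorphD red2 (Lnorm l1) (Lnorm l2)).
move: (Lnorm (Lmap intr2 l1)) (Lnorm (Lmap intr2 l2)) => u v; congr (_ + _).
have o (c : 'F_2) : - c = c by case: (F2_case c) => ->; apply/eqP.
by apply: K_ext; rewrite !KE o.
Qed.

Lemma redK_nrA (t : Alg) (e : ZC2) : redA t = redE e -> redK (nrA t) = (dC2 e)%:~R.
Proof.
case: t e => [t1 t2] [e1 e2] h.
have h1 : redL t1 = e1%:~R := congr1 fst h.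
have h2 : redL t2 = e2%:~R := congr1 snd h.
have sq x : redK (Lnorm x) = redL x ^+ 2.
  by rewrite -redL_C -Lnorm_conj (rmorphM redL) redL_conj.
transitivity (redK (Lnorm t1) - redK (Lnorm t2)); first exact: (rmorphB redK (Lnorm t1) (Lnorm t2)).
by rewrite !sq h1 h2 /dC2 /= rmorphB !rmorphXn.
Qed.

(** Component generators glue to an element h of R only if they are congruent at 2 and 7, so they
    are adjusted by units: of Z[c] in [Lam], by powers of i in Z[i], by y in Z[C2]; in [Alg] the
    residues can be prescribed. The last hypothesis is the part at 7 that such units cannot repair.
    The factor [rho] is kept out of h, so that I becomes the right multiple by h of the ideal of
    those p whose Z[i]-component is divisible by [rho]. *)
Lemma locally_principal (I : R -> Prop) (N : int) (lam : Lam) (rho nu : Zi) :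
    lideal I -> I N%:~R -> coprimez N 14 ->
    img piL I lam -> (forall i, I i -> exists q, piL i = q * lam) ->
    img piI I (rho * nu) -> (forall i, I i -> exists q, piI i = q * (rho * nu)) ->
    (exists (n : int) (b : bool), redLam lam = n%:~R * redZi (Zij ^+ b * nu)) ->
  exists h, (forall p, (exists q, piI p = q * rho) -> I (p * h)) /\
    (forall i, I i -> exists2 p, (exists q, piI p = q * rho) & i = p * h).
Proof.
move=> hI IN cN lamI Ilam nuI Inu [n [b Hk]].
have [_ ID IM] := hI.
have [ql Eql] := Ilam _ IN; rewrite (rmorph_int piL) in Eql.
have cl := Lam_coprime Eql cN.
have [qn Eqn] := Inu _ IN; rewrite (rmorph_int piI) mulrA in Eqn.
have cn := Zi_coprime Eqn cN.
have [xl [xl7 _]] := Lam_inv14 cl.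
have n7 : n%:~R != 0 :> 'F_7.
  apply/eqP=> n0; have : (1 : F49) = 0; last by move=> /(congr1 fst)/eqP; rewrite oner_eq0.
  by rewrite -xl7 rmorphM Hk F49_int n0 -[(0, 0)]/(0 : F49) !mul0r.
have [ep [uep _ ep7]] : exists u, [/\ Kunit u, red2 u = 1 & redK u = (n%:~R)^-1].
  by apply: K_units_surj; rewrite ?oner_eq0 // invr_eq0.
have [ep' epK] := uep.
have DKK : DK ep' * DK ep = 1 :> Lam by rewrite -DK_M mulrC epK DK1.
set lam' := DK ep * lam; set nu' := Zij ^+ b * nu.
have r1 : redLam lam' = redZi nu'.
  rewrite /lam' (rmorphM redLam) Hk mulrA redLam_DK F49_int -/nu'.
  have -> : ((redK ep, 0) : F49) * (n%:~R, 0) = 1.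
    by rewrite F49_scal; apply: injective_projections; rewrite /= ?mulr0 ?ep7 ?mulVf.
  by rewrite mul1r.
have cl' : coprimez (KN (nr lam')) 14.
  by apply: (Lam_coprime (q := ql * DK ep')) cN; rewrite /lam' mulrA -[_ * DK ep' * _]mulrA DKK mulr1.
have cn' : coprimez (Zi_norm nu') 14.
  by rewrite /nu' Zi_norm_M coprimezMl cn; case: (b); rewrite ?expr0 ?expr1.
have hS : lideal (img piS I) by apply: (img_lideal (f := piS)); [exact: piS_surj | exact: hI].
have SN : img piS I N%:~R by exists N%:~R => //; rewrite (rmorph_int piS).
have on : ~~ (2 %| N)%Z.
  by move: cN; rewrite coprimez_sym (_ : 14 = 2 * 7) // coprimezMl coprimezE prime_coprime // => /andP[].
have [e0 Se0 Ge0] := ZC2_generator hS SN on.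
have [qe Eqe] := Ge0 _ SN; have ce0 := dC2_coprime Eqe cN.
have [e [Se Ge e2]] : exists e, [/\ img piS I e, forall j, img piS I j -> exists q, j = q * e & mod2I nu' = mod2E e].
  have [h|h] := mod2_odd cn' ce0; first by exists e0.
  have [_ _ SM] := hS; exists (C2y * e0); split=> //; first exact: SM.
  move=> j /Ge0[q ->]; exists (q * C2y); rewrite mulrA -[q * _ * _]mulrA.
  by have -> : C2y * C2y = 1; [rewrite ZC2E /=; congr pair | rewrite mulr1].
have {e0 Se0 Ge0 qe Eqe ce0} [qe Eqe] := Ge _ SN; have ce := dC2_coprime Eqe cN.
(* Chinese remainder: 7 and 8 are 1 and 0 mod 2, but 0 and 1 mod 7, so tau is lam' mod 2 and e mod
   7. *)
pose tau : Alg := (lam'.1 *+ 7 + (e.1)%:~R *+ 8, lam'.2 *+ 7 + (e.2)%:~R *+ 8).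
have [i71 i80] : 7%:R = 1 :> OL 'F_2 /\ 8%:R = 0 :> OL 'F_2.
  by split; apply: L_ext; apply: K_ext; apply/eqP.
have tau2 : mod2A tau = mod2L lam'.
  have E (x : OL int) (y : int) : Lmap intr2 (x *+ 7 + y%:~R *+ 8) = Lmap intr2 x.
    rewrite (rmorphD (Lmap intr2)) !(rmorphMn (Lmap intr2)) -[in X in X + _]mulr_natr -[in X in _ + X]mulr_natr.
    by rewrite i71 i80 mulr1 mulr0 addr0.
  by apply: injective_projections; exact: E.
have tau7 : redA tau = redE e.
  have E (x : OL int) (y : int) : redL (x *+ 7 + y%:~R *+ 8) = y%:~R.
    rewrite (rmorphD redL) !(rmorphMn redL) (rmorph_int redL) -[in X in X + _]mulr_natr -[in X in _ + X]mulr_natr.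
    have -> : 7%:R = 0 :> 'F_7 by apply/eqP.
    by have -> : 8%:R = 1 :> 'F_7; [apply/eqP | rewrite mulr0 mulr1 add0r].
  by apply: injective_projections; exact: E.
have ctau : coprimez (KN (nrA tau)) 14.
  have [l2 _] := K_coprime14_red cl'.
  apply: K_coprime14.
    by rewrite (red2_nrA tau2).
  rewrite (redK_nrA tau7).
  rewrite -(dvdz_pcharf (pchar_Fp (isT : prime 7))).
  by move: ce; rewrite coprimez_sym (_ : 14 = 2 * 7) // coprimezMl [coprimez 7 _]coprimezE prime_coprime // => /andP[].
have hA : lideal (img piA I) by apply: (img_lideal (f := piA)); [exact: piA_surj | exact: hI].
have AN : img piA I N%:~R by exists N%:~R => //; rewrite (rmorph_int piA).
have [al [Aal Gal al2 al7]] := Alg_generator hA AN cN ctau.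
have [h [h1 h2 h3 h4]] : exists r, [/\ piL r = lam', piI r = nu', piA r = al & piS r = e].
  by apply: glue => //; [rewrite al7 tau7 | rewrite al2 tau2].
exists h; split=> [p [q Ep]|i Ii].
  apply: (comp_mem hI IN cN).
  - have [_ _ LM] := img_lideal (f := piL) piL_surj hI.
    rewrite piLM h1 /lam' mulrA; exact: LM.
  - have [_ _ LM] := img_lideal (f := piI) piI_surj hI.
    rewrite piIM h2 /nu' Ep -mulrA [rho * _]mulrA [rho * _]Zi_mulC -[_ * rho * _]mulrA !mulrA -[_ * rho * _]mulrA.
    exact: LM.
  - have [_ _ LM] := hA.
    by rewrite piAM h3; exact: LM.
  have [_ _ LM] := hS.
  by rewrite piSM h4; exact: LM.
have [q1 Q1] := Ilam _ Ii; have [q2 Q2] := Inu _ Ii.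
have [q3 Q3] := Gal _ (ex_intro2 _ _ _ Ii erefl).
have [q4 Q4] := Ge _ (ex_intro2 _ _ _ Ii erefl).
pose p1 := q1 * DK ep'; have P1 : piL i = p1 * lam'.
  by rewrite /p1 /lam' mulrA -[q1 * _ * _]mulrA DKK mulr1.
have [p2 P2] : exists p2, piI i = p2 * rho * nu'.
  have [J JJ] : exists J, J * Zij ^+ b = 1.
    exists (Zij ^+ b * Zij ^+ b * Zij ^+ b).
    by case: (b); rewrite ?expr0 ?mulr1 ?expr1 //; apply: injective_projections.
  exists (q2 * J); rewrite Q2 /nu'; transitivity (q2 * (rho * (J * Zij ^+ b) * nu)).
    by rewrite JJ mulr1.
  by rewrite -[q2 * J * rho]mulrA [J * rho]Zi_mulC !mulrA.
(* The four quotients glue as well: the products are congruent, and the generators, being invertible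
   mod 14, can be cancelled. *)
have [x1 [x17 x12]] := Lam_inv14 cl'; have [x2 [x27 x22]] := ZC2_inv14 ce.
have [p [g1 g2 g3 g4]] : exists r, [/\ piL r = p1, piI r = p2 * rho, piA r = q3 & piS r = q4].
  apply: glue.
  - apply: (cancel_inv x17); rewrite {2}r1 -(rmorphM redLam) -(rmorphM redZi) -P1 -P2.
    exact: red_pi.
  - by apply: (cancel_inv x27); rewrite -{1}tau7 -al7 -(rmorphM redA) -(rmorphM redE) -Q3 -Q4; exact: redA_pi.
  - apply: (cancel_inv x12); rewrite -{2}tau2 -al2 -(rmorphM mod2L) -(rmorphM mod2A) -P1 -Q3.
    exact: mod2_pi.
  by apply: (cancel_inv x22); rewrite -{1}e2 -(rmorphM mod2I) -(rmorphM mod2E) -P2 -Q4; exact: mod2_piZ.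
exists p; first by exists p2.
apply: pi_inj.
- by rewrite piLM g1 h1 -P1.
- by rewrite piIM g2 h2 -P2.
- by rewrite piAM g3 h3 -Q3.
by rewrite piSM g4 h4 -Q4.
Qed.

(** * Finite rings have stable rank one *)

Definition unit2 (S : pzRingType) (x : S) := exists c, c * x = 1 /\ x * c = 1.
Definition sr1 (S : pzRingType) := forall u b d : S, u * b + d = 1 -> exists s, unit2 (b + s * d).

Lemma unit2M (S : pzRingType) (x y : S) : unit2 x -> unit2 y -> unit2 (x * y).
Proof.
move=> [c [cx xc]] [c' [cy yc]]; exists (c' * c); split.
  by rewrite -mulrA (mulrA c) cx mul1r.
by rewrite -mulrA (mulrA y) yc mul1r.
Qed.
Lemma unit2_sq0 (S : pzRingType) (n : S) : n * n = 0 -> (1 - n) * (1 + n) = 1 /\ (1 + n) * (1 - n) = 1.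
Proof.
move=> n0; split; first by rewrite mulrBl mul1r mulrDr mulr1 n0 addr0 addrK.
by rewrite mulrDl mul1r mulrBr mulr1 n0 subr0 subrK.
Qed.

Section Corner.
Variables (S : pzRingType) (g : S).
Hypothesis gg : g * g = g.
Definition corner_pred & g * g = g : {pred S} := fun x => g * x * g == x.
Let C := corner_pred gg.
Fact corner_zmod : zmod_closed C.
Proof.
split=> [|x y]; rewrite !unfold_in ?mulr0 ?mul0r // => /eqP hx /eqP hy.
by rewrite mulrBr mulrBl hx hy.
Qed.
HB.instance Definition _ := GRing.isZmodClosed.Build S C corner_zmod.
Record corner := Corner { cval : S; cvalP : cval \in C }.
HB.instance Definition _ := [isSub for cval].
HB.instance Definition _ := [Choice of corner by <:].
HB.instance Definition _ := [SubChoice_isSubZmodule of corner by <:].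
Lemma cornerl (x : corner) : g * cval x = cval x.
Proof. by case: x => x /= /eqP <-; rewrite !mulrA gg. Qed.
Lemma cornerr (x : corner) : cval x * g = cval x.
Proof. by case: x => x /= /eqP <-; rewrite -!mulrA gg. Qed.
Fact corner1 : g \in C.
Proof. by rewrite unfold_in !gg. Qed.
Fact cornerM (x y : corner) : cval x * cval y \in C.
Proof. by rewrite unfold_in !mulrA cornerl -mulrA cornerr. Qed.
Definition corner_one := Corner corner1.
Definition corner_mul x y := Corner (cornerM x y).
Fact corner_mulA : associative corner_mul.
Proof. by move=> x y z; apply: val_inj; rewrite /= mulrA. Qed.
Fact corner_mul1l : left_id corner_one corner_mul.
Proof. by move=> x; apply: val_inj; rewrite /= cornerl. Qed.
Fact corner_mul1r : right_id corner_one corner_mul.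
Proof. by move=> x; apply: val_inj; rewrite /= cornerr. Qed.
Fact corner_mulDl : left_distributive corner_mul +%R.
Proof. by move=> x y z; apply: val_inj; rewrite /= mulrDl. Qed.
Fact corner_mulDr : right_distributive corner_mul +%R.
Proof. by move=> x y z; apply: val_inj; rewrite /= mulrDr. Qed.
HB.instance Definition _ := GRing.Zmodule_isPzRing.Build corner
  corner_mulA corner_mul1l corner_mul1r corner_mulDl corner_mulDr.
Lemma cornerP x : g * x * g \in C.
Proof. by rewrite unfold_in -!mulrA gg !mulrA gg. Qed.

Lemma corner_sr1 (u b d : S) : sr1 corner -> g * u * g * b * g + g * d * g = g ->
  exists s c, [/\ g * s = s, s * g = s, g * c = c, c * g = c &
    c * (g * b * g + s * d * g) = g /\ (g * b * g + s * d * g) * c = g].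
Proof.
move=> sr e.
have [|s [c [h1 h2]]] := sr (Corner (cornerP u)) (Corner (cornerP b)) (Corner (cornerP d)).
  by apply: val_inj; rewrite /= -[RHS]e !mulrA -(mulrA (g * u) g g) gg.
have E : cval s * (g * d * g) = cval s * d * g by rewrite !mulrA cornerr.
exists (cval s), (cval c); split; rewrite ?cornerl ?cornerr //; split.
  by have := congr1 cval h1; rewrite /= E.
by have := congr1 cval h2; rewrite /= E.
Qed.

End Corner.

(* Peirce decomposition 1 = g + f: make the gg-corner of b invertible, clear its row and column
   by elementary operations, then make the ff-corner invertible. *)
Lemma Peirce_sr1 (S : pzRingType) (g : S) (gg : g * g = g) (ff : (1 - g) * (1 - g) = 1 - g) :
  sr1 (corner gg) -> sr1 (corner ff) -> sr1 S.
Proof.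
move: ff; set f := 1 - g => ff srg srf u b d e.
have gf1 : g + f = 1 by rewrite /f addrC subrK.
have gf : g * f = 0 by rewrite /f mulrBr mulr1 gg subrr.
have fg : f * g = 0 by rewrite /f mulrBl mul1r gg subrr.
clearbody f.
have split x : x = x * g + x * f by rewrite -mulrDr gf1 mulr1.
have splitl x : x = g * x + f * x by rewrite -mulrDl gf1 mul1r.
have [|s [c [gs sg gc cg [cB Bc]]]] := @corner_sr1 _ g gg u b (u * f * b + d) srg.
  transitivity (g * (u * b + d) * g); last by rewrite e mulr1 gg.
  have -> : u * b = u * g * b + u * f * b by rewrite -!mulrA -mulrDr -splitl.
  by rewrite !mulrDr !mulrDl !mulrA !addrA.
have fs : f * s = 0 by rewrite -gs mulrA fg mul0r.
have fc : f * c = 0 by rewrite -gc mulrA fg mul0r.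
have cf : c * f = 0 by rewrite -cg -mulrA gf mulr0.
have [n1 n1E] : exists z, z = s * u * f by eexists.
have n10 : n1 * n1 = 0 by rewrite n1E -!mulrA (mulrA f) fs mul0r !mulr0.
have [b1 b1E] : exists z, z = (1 + n1) * b + s * d by eexists.
have gb1g : g * b1 * g = g * b * g + s * (u * f * b + d) * g.
  by rewrite b1E n1E !(mulrDl, mulrDr) !mul1r !mulrA gs !addrA.
rewrite -gb1g in cB Bc; clear gb1g.
have cb1g : c * b1 * g = g by rewrite -[RHS]cB -!mulrA (mulrA c g) cg.
have gb1c : g * b1 * c = g by rewrite -[RHS]Bc -!mulrA gc.
have [n2 n2E] : exists z, z = f * b1 * c by eexists.
have n20 : n2 * n2 = 0 by rewrite n2E -!mulrA (mulrA c) cf mul0r !mulr0.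
have [b2 b2E] : exists z, z = (1 - n2) * b1 by eexists.
have gb2 : g * b2 = g * b1 by rewrite b2E n2E mulrBl mul1r mulrBr -!mulrA (mulrA g f) gf mul0r subr0.
have fb2g : f * b2 * g = 0.
  rewrite b2E mulrBl mul1r mulrBr mulrBl n2E -!mulrA (mulrA c) cb1g.
  by rewrite (mulrA f f) ff subrr.
have [n3 n3E] : exists z, z = c * b2 * f by eexists.
have n30 : n3 * n3 = 0 by rewrite n3E -!mulrA (mulrA f) fc mul0r !mulr0.
have [b3 b3E] : exists z, z = b2 * (1 - n3) by eexists.
have gb3f : g * b3 * f = 0.
  rewrite b3E mulrBr mulr1 mulrBr mulrBl n3E !mulrA gb2 gb1c -!mulrA ff (mulrA g b2) gb2.
  by rewrite -mulrA subrr.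
have fb3g : f * b3 * g = 0.
  by rewrite b3E mulrBr mulr1 mulrBr mulrBl fb2g n3E -!mulrA fg !mulr0 subrr.
have gb3g : g * b3 * g = g * b1 * g.
  by rewrite b3E mulrBr mulr1 mulrBr mulrBl gb2 n3E -!mulrA fg !mulr0 subr0.
have [m1 m1'] := unit2_sq0 n10; have [m2 m2'] := unit2_sq0 n20; have [m3 m3'] := unit2_sq0 n30.
pose p := (1 - n2) * (1 + n1); pose p' := (1 - n1) * (1 + n2).
have p'p : p' * p = 1 by rewrite /p' /p -mulrA (mulrA (1 + n2)) m2' mul1r.
have pp' : p * p' = 1 by rewrite /p' /p -mulrA (mulrA (1 + n1)) m1' mul1r.
pose q := 1 - n3; pose q' := 1 + n3.
have qq' : q * q' = 1 := m3; have q'q : q' * q = 1 := m3'.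
pose s1 := (1 - n2) * s.
have b3F : b3 = p * b * q + s1 * d * q.
  by rewrite b3E b2E b1E /p /s1 -/q (mulrDr (1 - n2)) mulrDl !mulrA.
clearbody p p' q q' s1.
pose u3 := q' * u * p'; pose v3 := q' * (1 - u * p' * s1).
have e3 : u3 * b3 + v3 * d * q = 1.
  have h1 : u3 * (p * b * q) = q' * (u * b) * q by rewrite /u3 -!mulrA (mulrA p' p) p'p mul1r.
  have h2 : v3 * d * q = q' * d * q - u3 * (s1 * d * q).
    by rewrite /v3 /u3 mulrBr mulr1 !mulrBl !mulrA.
  by rewrite b3F mulrDr h1 h2 addrACA subrr addr0 -mulrDl -mulrDr e mulr1 q'q.
clearbody u3 v3; clear e.
have b3f : b3 * f = f * b3 * f by rewrite {1}(splitl (b3 * f)) !mulrA gb3f add0r.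
have [|t [c' [ft tf fc' c'f [c'D Dc']]]] := @corner_sr1 _ f ff u3 b3 (v3 * d * q) srf.
  transitivity (f * (u3 * b3 + v3 * d * q) * f); last by rewrite e3 mulr1 ff.
  rewrite mulrDr mulrDl; congr (_ + _).
  have -> : f * u3 * f * b3 * f = f * u3 * (f * b3 * f) by rewrite !mulrA.
  by rewrite -b3f !mulrA.
have [x xE] : exists z, z = t * (v3 * d * q) by eexists.
have x_unit : unit2 (b3 + x).
  have xf : f * b3 * f + t * (v3 * d * q) * f = f * b3 * f + x * f by rewrite xE.
  rewrite xf in c'D Dc'.
  have E : b3 + x = g * b1 * g + (f * b3 * f + x * f) + x * g.
    rewrite [in LHS](split b3) b3f (splitl (b3 * g)) !mulrA fb3g gb3g addr0.
    by rewrite [in LHS](split x) -!addrA; congr (_ + (_ + _)); rewrite addrC.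
  have gc' : g * c' = 0 by rewrite -fc' mulrA gf mul0r.
  have c'g : c' * g = 0 by rewrite -c'f -mulrA fg mulr0.
  have fx : f * x = x by rewrite xE (mulrA f t) ft.
  exists (c + c' - c' * x * c); rewrite E; split.
    have h1 : c * (g * b1 * g + (f * b3 * f + x * f) + x * g) = g.
      by rewrite !mulrDr cB -fx !mulrA cf !mul0r !addr0.
    have h2 : c' * (g * b1 * g + (f * b3 * f + x * f) + x * g) = f + c' * x * g.
      by rewrite (mulrDr c' _ (x * g)) (mulrDr c' (g * b1 * g)) c'D !mulrA c'g !mul0r add0r.
    by rewrite mulrBl mulrDl h1 h2 -(mulrA (c' * x)) h1 addrA addrK gf1.
  have h1 : (g * b1 * g + (f * b3 * f + x * f) + x * g) * c = g + x * c.
    by rewrite !mulrDl Bc -!mulrA fc !mulr0 !addr0 gc.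
  have h2 : (g * b1 * g + (f * b3 * f + x * f) + x * g) * c' = f.
    by rewrite (mulrDl _ (x * g)) (mulrDl (g * b1 * g)) Dc' -!mulrA gc' !mulr0 addr0 add0r.
  move: (_ + x * g) h1 h2 => T h1 h2.
  by rewrite mulrBr mulrDr h1 h2 !mulrA h2 fx addrAC addrK gf1.
exists (p' * (s1 + t * v3)).
have -> : b + p' * (s1 + t * v3) * d = p' * (b3 + x) * q'.
  rewrite b3F xE mulrDr mulrDl !mulrDr !mulrDl !mulrA p'p mul1r.
  by rewrite -!(mulrA _ q q') qq' !mulr1 addrA.
apply: unit2M; first apply: unit2M => //; first by exists p.
by exists q.
Qed.

(** By the pigeonhole principle the powers of x are eventually periodic; a multiple of the period
    beyond the preperiod gives an idempotent. *)
Lemma finite_power (S : pzRingType) (l : seq S) (x : S) : (forall y, y \in l) ->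
  exists2 k, (0 < k)%N & x ^+ k * x ^+ k = x ^+ k.
Proof.
move=> hl; pose m := [seq x ^+ i | i <- iota 0 (size l).+1].
have /(uniqPn 0)[i [j [ij jm e]]] : ~~ uniq m.
  apply/negP=> um; have : (size m <= size l)%N by apply: uniq_leq_size um _ => y _.
  by rewrite size_map size_iota ltnn.
rewrite size_map size_iota in jm.
rewrite !(nth_map 0%N) ?size_iota ?(ltn_trans ij) // !nth_iota ?(ltn_trans ij) // !add0n in e.
pose p := (j - i)%N.
have per k r : (i <= k)%N -> x ^+ (k + p * r) = x ^+ k.
  move=> ik; elim: r => [|r IH]; first by rewrite muln0 addn0.
  rewrite -[RHS]IH mulnS.
  have -> : (k + (p + p * r) = j + (k - i + p * r))%N by rewrite /p; lia.
  by rewrite exprD -e -exprD; congr (x ^+ _); rewrite /p; lia.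
have p1 : (0 < p)%N by rewrite subn_gt0.
exists (p * i.+1)%N; first by rewrite muln_gt0 p1.
by rewrite -exprD per // (leq_trans (leqnSn i)) // leq_pmull.
Qed.

(** Induction on the length of a list of all elements. A nontrivial idempotent leads to two smaller
    corners; without one, every element is nilpotent or invertible, and if b is nilpotent then so is
    u b, or else 1 = 0, whence d = 1 - u b is invertible. *)
Lemma finite_sr1 (S : pzRingType) (l : seq S) : (forall y, y \in l) -> sr1 S.
Proof.
have [n] := ubnP (size l); elim: n => // n IH in S l *; rewrite ltnS => ln hl.
have sub (g : S) (gg : g * g = g) : g != 1 -> sr1 (corner gg).
  move=> g1; apply: (IH _ (pmap (insub : S -> option (corner gg)) l)) => [|x]; last first.
    by rewrite mem_pmap; apply/mapP; exists (val x); rewrite ?valK.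
  rewrite size_pmap_sub; apply: leq_trans ln.
  rewrite ltn_neqAle count_size andbT -all_count.
  apply/negP=> /allP/(_ 1 (hl 1)) /=; rewrite unfold_in mulr1 gg.
  exact/negP.
have [[g gg /andP[g0 g1]]|no] : (exists2 g : S, g * g = g & (g != 0) && (g != 1)) \/
    forall g : S, g * g = g -> g = 0 \/ g = 1.
  have [/hasP[g _ /and3P[/eqP h1 h2 h3]]|/hasPn no] := boolP (has (fun g => [&& g * g == g, g != 0 & g != 1]) l).
    by left; exists g => //; rewrite h2 h3.
  right=> g gg; have := no g (hl g); rewrite gg eqxx /= negb_and !negbK.
  by move=> /orP[] /eqP; [left | right].
  have ff : (1 - g) * (1 - g) = 1 - g.
    by rewrite mulrBl mul1r mulrBr mulr1 gg subrr subr0.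
  apply: (@Peirce_sr1 _ g gg ff); apply: sub => //.
  by apply: contra g0 => /eqP e; rewrite -(subKr 1 g) e subrr.
move=> u b d e.
have pow (x : S) : (exists k, x ^+ k = 0) \/ exists c, c * x = 1 /\ x * c = 1.
  have [k k0 xk] := finite_power x hl; have [x0|x1] := no _ xk; first by left; exists k.
  by right; exists (x ^+ k.-1); rewrite -exprSr -exprS prednK.
have [[k bk]|[c hc]] := pow b; last by exists 0; rewrite mul0r addr0; exists c.
have z (x : S) k' : x ^+ k' = 0 -> (exists2 w, w * x = 1 & True) \/ (exists2 w, x * w = 1 & True) ->
    (1 : S) = 0.
  move=> x0 [] [w h _].
    have cb j : w ^+ j * x ^+ j = 1.
      elim: j => [|j IHj]; first by rewrite mulr1.
      by rewrite exprSr exprS -mulrA (mulrA w x) h mul1r.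
    by rewrite -(cb k') x0 mulr0.
  have cb j : x ^+ j * w ^+ j = 1.
    elim: j => [|j IHj]; first by rewrite mulr1.
    by rewrite exprSr exprS -mulrA (mulrA x w) h mul1r.
  by rewrite -(cb k') x0 mul0r.
have triv : (1 : S) = 0 -> exists s, unit2 (b + s * d).
  by move=> h; exists 0; exists 0; rewrite h !mulr0 mul0r.
have [[m um]|[c [hc _]]] := pow (u * b); last first.
  by apply: triv; apply: (z b k bk); left; exists (c * u) => //; rewrite -mulrA.
have dE : d = 1 - u * b by rewrite -e addrC addKr.
have [[k' dk]|[c [c1 c2]]] := pow d.
  apply: triv; apply: (z d k' dk); right; exists (\sum_(i < m) (u * b) ^+ i) => //.
  apply: oppr_inj; rewrite -mulNr dE opprB -subrX1 um sub0r //.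
by exists ((1 - b) * c); rewrite -mulrA c1 mulr1 addrC subrK; exists 1; rewrite mulr1.
Qed.

(** * Right multiplication on the group ring as a matrix *)

Section RightMul.
Variable F : comNzRingType.

Definition vecQ (u : QG F) : 'rV[F]_(14 + 14) := row_mx (\row_i u.1 i) (\row_i u.2 i).
Definition unvecQ (v : 'rV[F]_(14 + 14)) : QG F :=
  ([ffun i => v 0 (lshift 14 i)], [ffun i => v 0 (rshift 14 i)]).
Lemma vecQK : cancel vecQ unvecQ.
Proof.
move=> [a b]; rewrite /vecQ /unvecQ /=; congr pair; apply/ffunP=> i; rewrite ffunE.
  by rewrite row_mxEl mxE.
by rewrite row_mxEr mxE.
Qed.
Lemma unvecQK : cancel unvecQ vecQ.
Proof.
move=> v; rewrite /vecQ /unvecQ /= -[RHS]hsubmxK; congr row_mx; apply/rowP=> i;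
  by rewrite !mxE ffunE.
Qed.
Lemma vecQD u v : vecQ (u + v) = vecQ u + vecQ v.
Proof. by rewrite /vecQ add_row_mx; congr row_mx; apply/rowP=> i; rewrite !mxE ffunE. Qed.
Lemma unvecQD u v : unvecQ (u + v) = unvecQ u + unvecQ v.
Proof. by apply: (can_inj vecQK); rewrite vecQD !unvecQK. Qed.

Definition cst (c : F) : QG F := ([ffun i => c *+ (i == 0)], 0).
Lemma cst_mul c u : vecQ (cst c * u) = c *: vecQ u.
Proof.
have E (a : cyc F) : ([ffun i => c *+ (i == 0)] : cyc F) * a = [ffun i => c * a i].
  apply/ffunP=> i; rewrite !ffunE (bigD1 0) //= big1 ?addr0.
    by rewrite ffunE eqxx mulr1n subr0.
  by move=> j /negPf j0; rewrite ffunE j0 mulr0n mul0r.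
rewrite twE /cst /= !mul0r !addr0 !E /vecQ scale_row_mx.
by congr row_mx; apply/rowP=> i; rewrite !mxE ffunE.
Qed.
Lemma unvecQZ c v : unvecQ (c *: v) = cst c * unvecQ v.
Proof. by apply: (can_inj vecQK); rewrite cst_mul !unvecQK. Qed.

Definition rmul (b : QG F) (v : 'rV[F]_(14 + 14)) : 'rV[F]_(14 + 14) := vecQ (unvecQ v * b).
Fact rmul_linear b : linear (rmul b).
Proof. by move=> c u v; rewrite /rmul unvecQD unvecQZ mulrDl -mulrA vecQD cst_mul. Qed.
HB.instance Definition _ b := GRing.isLinear.Build F _ _ _ (rmul b) (rmul_linear b).
(** Right multiplications commute with the left module structure; the determinant serves as a norm
    on the group ring, and its residue mod m detects units mod m. *)
Definition RM (b : QG F) : 'M[F]_(14 + 14) := lin1_mx (rmul b).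
Lemma vecQ_mul r b : vecQ (r * b) = vecQ r *m RM b.
Proof. by rewrite mul_rV_lin1 /= /rmul vecQK. Qed.
Lemma RM_mul b c : RM (b * c) = RM b *m RM c.
Proof.
apply/row_matrixP=> i; rewrite !rowE mulmxA -(unvecQK (delta_mx 0 i)).
by rewrite -!vecQ_mul mulrA.
Qed.
Lemma RM1 : RM 1 = 1%:M.
Proof.
by apply/row_matrixP=> i; rewrite !rowE mulmx1 -{1}(unvecQK (delta_mx 0 i)) -vecQ_mul mulr1 unvecQK.
Qed.
End RightMul.

Fact vecQ_additive : {morph @vecQ int : u v / u - v}.
Proof.
move=> u v; apply: (can_inj (addrK (vecQ v))); rewrite -vecQD !subrK.
by [].
Qed.
HB.instance Definition _ := GRing.isZmodMorphism.Build R _ (@vecQ int) vecQ_additive.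

Lemma vecQ_int (n : int) (u : R) : vecQ (n%:~R * u) = n *: vecQ u.
Proof. by rewrite mulrzl raddfMz -scaler_int intz. Qed.

Lemma int_torsion (n : int) (u : R) : n != 0 -> n%:~R * u = 0 -> u = 0.
Proof.
move=> n0 /(congr1 (@vecQ int)); rewrite vecQ_int raddf0 => e.
apply: (can_inj (@vecQK int)); rewrite raddf0.
by apply/rowP=> i; have := congr1 (fun v : 'rV_(14 + 14) => v 0 i) e; rewrite !mxE => /eqP; rewrite mulf_eq0 (negPf n0) => /eqP.
Qed.

Lemma RM_int (n : int) : RM (n%:~R : R) = n%:M.
Proof.
apply/row_matrixP=> i; rewrite !rowE -{1}(unvecQK (delta_mx 0 i)) -vecQ_mul.
by rewrite (commr_int (unvecQ (delta_mx 0 i)) n : _ * _ = _) vecQ_int unvecQK mul_mx_scalar.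
Qed.

Lemma det_injective (h p : R) : \det (RM h) != 0 -> p * h = 0 -> p = 0.
Proof.
move=> d0 /(congr1 (@vecQ int)); rewrite vecQ_mul raddf0 => e.
apply: (int_torsion d0); apply: (can_inj (@vecQK int)); rewrite vecQ_int raddf0.
by rewrite -mul_mx_scalar -mul_mx_adj mulmxA e mul0mx.
Qed.

Lemma det_RM_neq0 (s h : R) (n : int) : n != 0 -> s * h = n%:~R -> \det (RM h) != 0.
Proof.
move=> n0 e; have := congr1 (fun b => \det (RM b)) e; rewrite RM_mul RM_int det_mulmx det_scalar.
move=> e'; apply/eqP=> d0; move: e'; rewrite d0 mulr0 => /esym/eqP.
by rewrite expf_eq0 (negPf n0) andbF.
Qed.

Lemma right_injective (s h p : R) (n : int) : n != 0 -> s * h = n%:~R -> p * h = 0 -> p = 0.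
Proof. by move=> n0 /(det_RM_neq0 n0); exact: det_injective. Qed.

(** The adjugate gives a left inverse up to the determinant; right multiplication by b is injective,
    so it is a right inverse up to the determinant as well. *)
Lemma adjugate_exists (b : R) : \det (RM b) != 0 ->
  exists b', b' * b = (\det (RM b))%:~R /\ b * b' = (\det (RM b))%:~R.
Proof.
set d := \det (RM b) => d0; exists (unvecQ (vecQ 1 *m \adj (RM b))).
have E : unvecQ (vecQ 1 *m \adj (RM b)) * b = d%:~R.
  apply: (can_inj (@vecQK int)); rewrite vecQ_mul unvecQK -mulmxA mul_adj_mx mul_mx_scalar.
  by rewrite -[in RHS](mulr1 d%:~R) vecQ_int.
split=> //; apply/eqP; rewrite -subr_eq0; apply/eqP; apply: (det_injective d0).
by rewrite mulrBl -mulrA E (commr_int b d : b * d%:~R = _) subrr.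
Qed.

Section BaseChange.
Variables (F F' : comNzRingType) (f : {rmorphism F -> F'}).
Definition cmap (u : cyc F) : cyc F' := [ffun i => f (u i)].
Fact cmap_additive : {morph cmap : u v / u - v}.
Proof. by move=> u v; apply/ffunP=> i; rewrite !ffunE rmorphB. Qed.
Fact cmap_multiplicative : monoid_morphism cmap.
Proof.
split=> [|u v]; apply/ffunP=> i; rewrite !ffunE ?rmorph_nat // rmorph_sum.
by apply: eq_bigr => j _; rewrite rmorphM !ffunE.
Qed.
HB.instance Definition _ := GRing.isZmodMorphism.Build _ _ cmap cmap_additive.
HB.instance Definition _ := GRing.isMonoidMorphism.Build _ _ cmap cmap_multiplicative.
Fact cmap_conj a : cmap (inv_conj (cycD F) a) = inv_conj (cycD F') (cmap a).
Proof. by apply/ffunP=> i; rewrite !ffunE. Qed.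
Fact cmap_sq : cmap (inv_sq (cycD F)) = inv_sq (cycD F').
Proof. by rewrite /= !cycXn; apply/ffunP=> i; rewrite !ffunE rmorph_nat. Qed.
Definition mapQ : {rmorphism QG F -> QG F'} :=
  twmap (@IMorph (cycD F) (cycD F') cmap cmap_conj cmap_sq).
Lemma vecQ_map u : vecQ (mapQ u) = map_mx f (vecQ u).
Proof. by rewrite /vecQ map_row_mx; congr row_mx; apply/rowP=> i; rewrite !mxE ffunE. Qed.
Lemma unvecQ_map v : unvecQ (map_mx f v) = mapQ (unvecQ v).
Proof. by apply: (can_inj (@vecQK F')); rewrite vecQ_map !unvecQK. Qed.
Lemma RM_map b : RM (mapQ b) = map_mx f (RM b).
Proof.
have E (K : comNzRingType) (c : QG K) i : delta_mx 0 i *m RM c = vecQ (unvecQ (delta_mx 0 i) * c).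
  by rewrite vecQ_mul unvecQK.
apply/row_matrixP=> i; rewrite -map_row !rowE !E -vecQ_map.
rewrite (rmorphM mapQ); congr (vecQ (_ * _)).
by rewrite -unvecQ_map map_delta_mx.
Qed.
End BaseChange.

Section Modulus.
Variable m : nat.
Hypothesis m1 : (1 < m)%N.
Definition intm : {rmorphism int -> 'Z_m} := intr.
Definition redm : {rmorphism R -> QG 'Z_m} := mapQ intm.

Lemma intm_eq0 k : (intm k == 0) = (m%:Z %| k)%Z.
Proof.
have E (n : nat) : (n%:R == 0 :> 'Z_m) = (m %| n)%N.
  by rewrite -val_eqE /= val_Zp_nat.
case: k => n; first exact: E.
by rewrite -[intm _]/(- (n.+1%:R)) oppr_eq0; exact: E.
Qed.

Lemma redm_eq0 u : redm u = 0 -> exists v, u = m%:Z%:~R * v.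
Proof.
case: u => a b /pair_equal_spec[ha hb].
have h (c : cyc int) : cmap intm c = 0 -> exists c', c = c' *~ m.
  move=> e; exists [ffun i => (c i %/ m)%Z]; apply/ffunP=> i.
  have /eqP := congr1 (fun z : cyc 'Z_m => z i) e; rewrite !ffunE intm_eq0 => /divzK {1}<-.
  rewrite -[RHS]/((([ffun i => (c i %/ m)%Z] : {ffun 'I_14 -> int}) *~ m) i).
  by rewrite -pmulrn ffunMnE ffunE -mulr_natr natz.
have [a' ->] := h a ha; have [b' ->] := h b hb.
exists (a', b'); rewrite mulrzl -pmulrn.
by apply: injective_projections; rewrite raddfMn.
Qed.

Lemma redm_surj w : exists u, redm u = w.
Proof.
exists ([ffun i => (w.1 i : nat)%:Z], [ffun i => (w.2 i : nat)%:Z]).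
have E (z : 'Z_m) : intm (z : nat)%:Z = z.
  rewrite -[intm _]/((z : nat)%:R); apply: val_inj; rewrite /= val_Zp_nat // modn_small //.
  by rewrite -[X in (_ < X)%N](Zp_cast m1) ltn_ord.
by apply: injective_projections; apply/ffunP=> i; rewrite !ffunE; exact: E.
Qed.

Lemma sr1_redm (u b d : R) : redm (u * b + d) = 1 ->
  exists s c, redm (c * (b + s * d)) = 1 /\ redm ((b + s * d) * c) = 1.
Proof.
rewrite rmorphD rmorphM => e.
have sr : sr1 (QG 'Z_m).
  pose T : finType := ({ffun 'I_14 -> 'Z_m} * {ffun 'I_14 -> 'Z_m})%type.
  pose l : seq (QG 'Z_m) := enum T.
  by apply: (@finite_sr1 (QG 'Z_m) l) => y; exact: (mem_enum T (y : T)).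
have [s [c [h1 h2]]] := sr _ _ _ e.
have [s' es] := redm_surj s; have [c' ec] := redm_surj c.
by exists s', c'; rewrite !(rmorphM redm) !(rmorphD redm) !(rmorphM redm) /= es ec.
Qed.

Lemma redm_det (b c : R) : redm (b * c) = 1 -> coprimez (\det (RM b)) m.
Proof.
rewrite (rmorphM redm) => /(congr1 (fun b => \det (RM b))) /=.
rewrite RM_mul RM1 det1 det_mulmx !RM_map !det_map_mx -rmorphM => e.
have /eqP : intm (\det (RM b) * \det (RM c) - 1) = 0 by rewrite rmorphB e rmorph1 subrr.
rewrite intm_eq0 => /dvdzP[k ek]; apply/coprimezP; exists (\det (RM c), - k).
by rewrite /= mulrC mulNr -ek opprB addrC subrK.
Qed.
End Modulus.

(** * Modules over the group ring *)

Notation Ro := (QG int)^o.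

Definition lin (M N : lmodType R) (f : M -> N) := forall r u v, f (r *: u + v) = r *: f u + f v.
Section Lin.
Variables (M N : lmodType R) (f : M -> N).
Hypothesis lf : lin f.
Lemma lin0 : f 0 = 0.
Proof. by have := lf (-1) 0 0; rewrite scaler0 addr0 scaleN1r addNr. Qed.
Lemma linD u v : f (u + v) = f u + f v.
Proof. by have := lf 1 u v; rewrite !scale1r. Qed.
Lemma linZ r u : f (r *: u) = r *: f u.
Proof. by have := lf r u 0; rewrite lin0 !addr0. Qed.
Lemma linN u : f (- u) = - f u.
Proof. by rewrite -scaleN1r linZ scaleN1r. Qed.
Lemma linB u v : f (u - v) = f u - f v.
Proof. by rewrite linD linN. Qed.
End Lin.

Lemma lin_comp (M N L : lmodType R) (f : M -> N) (g : N -> L) : lin f -> lin g -> lin (fun x => g (f x)).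
Proof. by move=> lf lg r u v; rewrite lf lg. Qed.
Lemma add_pair (M N : lmodType R) (a c : M) (b d : N) :
  (a, b) + (c, d) = (a + c, b + d) :> (M * N)%type.
Proof. by []. Qed.
Lemma scale_pair (M N : lmodType R) r (a : M) (b : N) : r *: (a, b) = (r *: a, r *: b) :> (M * N)%type.
Proof. by []. Qed.
Lemma lin_fst (M N : lmodType R) : lin (@fst M N).
Proof. by move=> r [a b] [c d]. Qed.
Lemma lin_snd (M N : lmodType R) : lin (@snd M N).
Proof. by move=> r [a b] [c d]. Qed.
Lemma scaler1 (r : R) : r *: (1 : Ro) = r.
Proof. exact: mulr1. Qed.

Definition iso (M N : lmodType R) := exists (f : M -> N) (g : N -> M),
  [/\ lin f, lin g, cancel f g & cancel g f].

Lemma iso_refl M : iso M M.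
Proof. by exists id, id; split=> // r u v. Qed.
Lemma iso_sym M N : iso M N -> iso N M.
Proof. by move=> [f [g [lf lg fK gK]]]; exists g, f; split. Qed.
Lemma iso_trans M N L : iso M N -> iso N L -> iso M L.
Proof.
move=> [f [g [lf lg fK gK]]] [f' [g' [lf' lg' fK' gK']]].
exists (f' \o f), (g \o g'); split.
- by move=> r u v; rewrite /= lf lf'.
- by move=> r u v; rewrite /= lg' lg.
- by move=> x; rewrite /= fK' fK.
by move=> x; rewrite /= gK gK'.
Qed.
Lemma iso_prod (M M' N N' : lmodType R) : iso M N -> iso M' N' -> iso (M * M')%type (N * N')%type.
Proof.
move=> [f [g [lf lg fK gK]]] [f' [g' [lf' lg' fK' gK']]].
exists (fun x => (f x.1, f' x.2)), (fun x => (g x.1, g' x.2)); split.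
- by move=> r u v; rewrite /= lf lf'.
- by move=> r u v; rewrite /= lg lg'.
- by move=> [x y]; rewrite /= fK fK'.
by move=> [x y]; rewrite /= gK gK'.
Qed.
Lemma iso_prodC (M N : lmodType R) : iso (M * N)%type (N * M)%type.
Proof. by exists (fun x => (x.2, x.1)), (fun x => (x.2, x.1)); split=> // -[]. Qed.
Lemma iso_prodA (M N L : lmodType R) : iso (M * (N * L))%type (M * N * L)%type.
Proof.
exists (fun x => (x.1, x.2.1, x.2.2)), (fun x => (x.1.1, (x.1.2, x.2))); split=> //.
  by move=> [x [y z]].
by move=> [[x y] z].
Qed.

(** Isomorphisms below are described by linear relations, such as division by a generator, rather
    than by formulas; choice turns the relation into functions. *)
Lemma iso_rel_fun (M N : lmodType R) (T : M -> N -> Prop) :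
    (forall r m n m' n', T m n -> T m' n' -> T (r *: m + m') (r *: n + n')) ->
    (forall m, exists n, T m n) -> (forall n, exists m, T m n) ->
    (forall n, T 0 n -> n = 0) -> (forall m, T m 0 -> m = 0) ->
  exists (f : M -> N) (g : N -> M), [/\ lin f, lin g, cancel f g, cancel g f & forall m, T m (f m)].
Proof.
move=> TL TM TN T0 T0'.
pose f m := proj1_sig (constructive_indefinite_description _ (TM m)).
pose g n := proj1_sig (constructive_indefinite_description _ (TN n)).
have Tf m : T m (f m) by rewrite /f; case: constructive_indefinite_description.
have Tg n : T (g n) n by rewrite /g; case: constructive_indefinite_description.
clearbody f g.
have uf m n : T m n -> f m = n.
  move=> h; apply/eqP; rewrite -subr_eq0; apply/eqP; apply: T0.
  by have := TL (-1) _ _ _ _ h (Tf m); rewrite !scaleN1r addNr addrC.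
have ug m n : T m n -> g n = m.
  move=> h; apply/eqP; rewrite -subr_eq0; apply/eqP; apply: T0'.
  by have := TL (-1) _ _ _ _ h (Tg n); rewrite !scaleN1r addNr addrC.
exists f, g; split.
- by move=> r u v; apply: uf; apply: TL.
- by move=> r u v; apply: ug; apply: TL.
- by move=> m; apply: ug.
- by move=> n; apply: uf.
exact: Tf.
Qed.

Lemma iso_rel (M N : lmodType R) (T : M -> N -> Prop) :
    (forall r m n m' n', T m n -> T m' n' -> T (r *: m + m') (r *: n + n')) ->
    (forall m, exists n, T m n) -> (forall n, exists m, T m n) ->
    (forall n, T 0 n -> n = 0) -> (forall m, T m 0 -> m = 0) -> iso M N.
Proof.
by move=> h1 h2 h3 h4 h5; have [f [g [lf lg fK gK _]]] := iso_rel_fun h1 h2 h3 h4 h5; exists f, g.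
Qed.

(** * Kernels of unimodular functionals *)

Section Kernel.
Variables (M Q : lmodType R).
(** M is, up to isomorphism, the kernel of a unimodular functional on Q, which by [iso_Ker] and
    [Ker_iso] is the same as M + R being isomorphic to Q. Stable isomorphisms are handled by
    changing the functional while keeping M. *)
Definition Ker (pi : Q -> Ro) := [/\ lin pi, exists q, pi q = 1 &
  exists i : M -> Q, [/\ lin i, injective i, forall m, pi (i m) = 0 & forall q, pi q = 0 -> exists m, i m = q]].

Lemma iso_Ker : iso (M * Ro)%type Q -> exists pi, Ker pi.
Proof.
move=> [f [g [lf lg fK gK]]]; exists (fun q => (g q).2); split.
- by move=> r u v; rewrite lg.
- by exists (f (0, 1)); rewrite fK.
exists (fun m => f (m, 0)); split.
- move=> r u v; rewrite -lf; congr (f _).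
  by apply: injective_projections; rewrite //= scaler0 addr0.
- by move=> u v /(can_inj fK) [].
- by move=> m; rewrite fK.
by move=> q h; exists (g q).1; rewrite -[RHS]gK; congr (f _); case: (g q) h => a b /= ->.
Qed.

Lemma Ker_iso pi : Ker pi -> iso (M * Ro)%type Q.
Proof.
move=> [lp [q1 e1] [i [li inj ik ki]]].
pose f (x : (M * Ro)%type) := i x.1 + x.2 *: q1.
have lf : lin f.
  by move=> r u v; rewrite /f /= li scalerDl -scalerA scalerDr addrACA.
have pf x : pi (f x) = x.2.
  by rewrite /f (linD lp) ik add0r (linZ lp) e1; exact: mulr1.
apply: (@iso_rel _ _ (fun x q => f x = q)).
- by move=> r m n m' n' <- <-; rewrite lf.
- by move=> x; exists (f x).
- move=> q; have [|m em] := ki (q - pi q *: q1).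
    by rewrite (linB lp) (linZ lp) e1 -[_ *: 1]/(_ * 1) mulr1 subrr.
  by exists (m, pi q); rewrite /f /= em subrK.
- by move=> q <-; exact: lin0.
move=> [m r] e; have := pf (m, r); rewrite e (lin0 lp) /= => r0.
move: e; rewrite /f /= -r0 scale0r addr0 => e.
by congr pair; apply: inj; rewrite e (lin0 li).
Qed.

(** As xi (n0) = 0, the map q -> q + xi (q) n0 is an automorphism of Q, and the new functional is
    its composition with pi. *)
Lemma Ker_transvection pi (xi : Q -> Ro) n0 : lin xi -> xi n0 = 0 -> Ker pi ->
  Ker (fun q => pi q + xi q * pi n0).
Proof.
move=> lx x0 [lp [q1 e1] [i [li inj ik ki]]].
have E q : pi q + xi q * pi n0 = pi (q + xi q *: n0) by rewrite (linD lp) (linZ lp).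
pose be q := q - xi q *: n0.
have be1 q : be q + xi (be q) *: n0 = q.
  by rewrite /be (linB lx) (linZ lx) x0 scaler0 subr0 subrK.
have be2 q : be (q + xi q *: n0) = q.
  by rewrite /be (linD lx) (linZ lx) x0 scaler0 addr0 addrK.
have lb : lin be.
  by move=> r u v; rewrite /be lx scalerDl scalerBr scalerA opprD addrACA.
split.
- by move=> r u v; rewrite lp lx mulrDl scalerDr addrACA -[r *: _ * _]/(r * _ * _) -mulrA.
- by exists (be q1); rewrite E be1.
exists (fun m => be (i m)); split.
- by move=> r u v; rewrite li lb.
- by move=> u v h; apply: inj; rewrite -(be1 (i u)) h be1.
- by move=> m; rewrite E be1.
move=> q; rewrite E => /ki[m em]; exists m; rewrite em; exact: be2.
Qed.

End Kernel.

Lemma Ker_unique (M M' Q : lmodType R) (pi : Q -> Ro) : Ker M pi -> Ker M' pi -> iso M M'.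
Proof.
move=> [_ _ [i [li inj ik ki]]] [_ _ [i' [li' inj' ik' ki']]].
apply: (@iso_rel _ _ (fun m m' => i m = i' m')).
- by move=> r m n m' n' e e'; rewrite li li' e e'.
- by move=> m; have [m' e] := ki' _ (ik m); exists m'.
- by move=> m'; have [m e] := ki _ (ik' m'); exists m.
- by move=> n; rewrite (lin0 li) -(lin0 li') => /inj'.
by move=> m; rewrite (lin0 li') -(lin0 li) => /inj.
Qed.

(** The last basis vector spans a complement of the kernel, which therefore projects isomorphically
    to N. *)
Lemma Ker_split (M N : lmodType R) (pi : (N * Ro)%type -> Ro) : Ker M pi -> pi (0, 1) = 1 -> iso M N.
Proof.
move=> [lp _ [i [li inj ik ki]]] e1.
have pE n r : pi (n, r) = pi (n, 0) + r.
  have -> : (n, r) = (n, 0) + r *: (0, 1) :> (N * Ro)%type.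
    apply: injective_projections; rewrite /= ?scaler0 ?addr0 // add0r.
    by rewrite -[_ *: 1]/(r * 1) mulr1.
  by rewrite (linD lp) (linZ lp) e1 -[_ *: 1]/(r * 1) mulr1.
apply: (@iso_rel _ _ (fun m n => (i m).1 = n)).
- by move=> r m n m' n' <- <-; rewrite li.
- by move=> m; exists (i m).1.
- move=> n; have [|m em] := ki (n, - pi (n, 0)); first by rewrite pE subrr.
  by exists m; rewrite em.
- by move=> n <-; rewrite (lin0 li).
move=> m h; apply: inj; rewrite (lin0 li); have := ik m.
move: h; case: (i m) => n r /= ->; rewrite pE.
by rewrite -[(0, 0)]/(0 : (N * Ro)%type) (lin0 lp) add0r => ->.
Qed.

(* [Pm b] consists of the r whose image in Z[i] (x -> -1) lies in the prime (2 + i) for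
   [b = false], (2 - i) for [b = true]. *)
Definition kk (b : bool) : int := if b then -2 else 2.
Definition rho (b : bool) : Zi := (2, if b then -1 else 1).
Definition Pm (b : bool) : {pred Ro} := fun r => (5 %| (piI r).1 - kk b * (piI r).2)%Z.

Lemma ZiE (u v : Zi) : u * v = (u.1 * v.1 - u.2 * v.2, u.1 * v.2 + u.2 * v.1).
Proof. by rewrite twE /=; congr pair; rewrite expr1 mulrN1. Qed.

Lemma PmP b (r : R) : r \in Pm b <-> exists q, piI r = q * rho b.
Proof.
rewrite unfold_in; case: (piI r) => s t /=; split.
  move=> /dvdzP[c e]; rewrite /rho /kk in e *; case: b e => e.
    pose q : Zi := (2 * c - t, c); exists q; rewrite /q ZiE.
    by apply: injective_projections => /=; lia.
  pose q : Zi := (t + 2 * c, - c); exists q; rewrite /q ZiE.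
  by apply: injective_projections => /=; lia.
move=> [[c d]]; rewrite ZiE /rho /kk /= => -[-> ->]; apply/dvdzP.
by case: b; [exists d | exists (- d)]; lia.
Qed.

Fact Pm_closed b : submod_closed (Pm b).
Proof.
split; first by apply/PmP; exists 0; rewrite rmorph0 mul0r.
move=> a u v /PmP[q Eq] /PmP[q' Eq']; apply/PmP; exists (piI a * q + q').
transitivity (piI ((a : R) * u) + piI v); first exact: (rmorphD piI ((a : R) * u) v).
by rewrite piIM Eq Eq' mulrDl mulrA.
Qed.
HB.instance Definition _ b := GRing.isSubmodClosed.Build R Ro (Pm b) (Pm_closed b).
Record Pt b := PT { pval : Ro; pvalP : pval \in Pm b }.
HB.instance Definition _ b := [isSub for (@pval b)].
HB.instance Definition _ b := [Choice of Pt b by <:].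
HB.instance Definition _ b := [SubChoice_isSubLmodule of Pt b by <:].

Lemma pval_lin b : lin (@pval b).
Proof. by []. Qed.

Fact five_mem b : 5%:~R \in Pm b.
Proof.
rewrite unfold_in; have -> : piI 5%:~R = (5%:Z, 0%:Z) by exact: etrans (rmorph_int piI 5) (Zi_int 5).
by rewrite /= mulr0 subr0.
Qed.
Definition five b : Pt b := PT (five_mem b).

Lemma five_scale b (p : Pt b) : pval p *: five b = 5%:~R *: p.
Proof. by apply: val_inj => /=; exact: (commr_int (pval p) 5). Qed.

(** A functional on [Pt b] is right multiplication by a fraction with denominator 5, so it is
    determined by its value at 5. *)
Lemma lin_five b (a : Pt b -> Ro) p : lin a -> 5%:~R * a p = pval p * a (five b).
Proof.
move=> la; transitivity (a (5%:~R *: p)); first exact: esym (linZ la _ _).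
by rewrite -five_scale; exact: (linZ la).
Qed.

Lemma redm_mod (m : nat) (u : R) : (1 < m)%N -> redm m (m%:Z%:~R * u) = 0.
Proof.
move=> m1; rewrite (rmorphM (redm m)) (rmorph_int (redm m)) -pmulrn.
have m0 : m%:R = 0 :> 'Z_m by apply/eqP; rewrite -[_ == _]/(intm m m == 0) intm_eq0.
have c0 (a : cyc 'Z_m) : a *+ m = 0.
  by apply/ffunP=> i; rewrite (ffunMnE (a : {ffun 'I_14 -> 'Z_m})) -mulr_natr m0 mulr0 ffunE.
by rewrite mulr_natl; apply: injective_projections; rewrite raddfMn c0.
Qed.

Lemma redm_modD (m : nat) (u v w : R) : (1 < m)%N -> u = v + m%:Z%:~R * w -> redm m u = redm m v.
Proof. by move=> m1 ->; rewrite (rmorphD (redm m)) redm_mod // addr0. Qed.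

Lemma bezout_unimodular (S : pzRingType) (k k' m : int) (a b : S) : k * 5 + k' * m = 1 ->
  a + b = 1 -> (k * 5)%:~R * a + b = 1 + m%:~R * (- (k'%:~R * a)).
Proof.
move=> ek e; have -> : k * 5 = 1 - k' * m by apply: (can_inj (addrK (k' * m))); rewrite subrK.
rewrite rmorphB rmorphM /= mulrBl mul1r addrAC e mulrN mulrA; congr (_ - _ * _).
by rewrite -!rmorphM mulrC.
Qed.
Lemma bezout_scale (S : pzRingType) (k k' m : int) (c v x : S) : k * 5 + k' * m = 1 ->
  c * (v + (5 * k)%:~R * x) = c * (v + x) + m%:~R * (- (c * (k'%:~R * x))).
Proof.
move=> ek; have -> : 5 * k = 1 - k' * m.
  by rewrite mulrC; apply: (can_inj (addrK (k' * m))); rewrite subrK.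
rewrite rmorphB rmorphM /= mulrBl mul1r addrA (mulrBr c) mulrN; congr (_ - _).
rewrite [in RHS]mulrA -(commr_int c m : c * _ = _) -!mulrA; congr (_ * _).
by rewrite !mulrA -!rmorphM mulrC.
Qed.

(* Eichler-type cancellation.  The functional on P + F + R + R is changed by transvections until
   it is unimodular on P + F + R: first its coefficient b1 on the third summand becomes a unit
   mod 5, then its value at 5 in P becomes a unit modulo the norm n of b1. *)
Lemma cancel_free b (M F : lmodType R) :
  iso (M * Ro)%type (Pt b * F * Ro * Ro)%type -> iso M (Pt b * F * Ro)%type.
Proof.
move=> /iso_Ker[pi K].
pose Q := (Pt b * F * Ro * Ro)%type.
pose e1 : Q := (0, 0, 1, 0).
have lxi1 : @lin Q Ro (fun q => q.1.2) := lin_comp (@lin_fst _ _) (@lin_snd _ _).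
have [pi1 [K1 [n [b1' [cn n0 En]]]]] : exists pi1 : Q -> Ro, Ker M pi1 /\
   exists n b1', [/\ coprimez n 5, n != 0 & b1' * pi1 e1 = n%:~R].
  have [lp [[[[p f] r1] r2] eq] _] := K.
  pose n1 : Q := (p, f, 0, r2).
  have E : r1 * pi e1 + pi n1 = 1.
    rewrite -[r1 * _]/(r1 *: _) -(linZ lp) -(linD lp) -[RHS]eq; congr (pi _).
    by rewrite /e1 /n1 !scale_pair !add_pair !scaler0 !add0r addr0 scaler1.
  have m1 : (1 < 5)%N by [].
  have [|s [c [_ hc]]] := sr1_redm m1 (u := r1) (b := pi e1) (d := pi n1).
    by rewrite E rmorph1.
  exists (fun q => pi q + q.1.2 * pi (s *: n1)); split.
    apply: Ker_transvection => //; rewrite /n1 /=; exact: mulr0.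
  have cd := redm_det m1 hc.
  have E' : pi e1 + e1.1.2 * pi (s *: n1) = pi e1 + s * pi n1 by rewrite mul1r (linZ lp).
  have d0 : \det (RM (pi e1 + s * pi n1)) != 0.
    by apply/eqP=> d0; move: cd; rewrite d0.
  have [b' [hb _]] := adjugate_exists d0.
  exists (\det (RM (pi e1 + s * pi n1))), b'.
  by split; [exact: cd | exact: d0 | exact: etrans (congr1 ( *%R b') E') hb].
clear pi K.
(* The factor 2 ensures m > 1 also when n is 1 or -1, and keeps 5 invertible mod m. *)
pose m := (2 * `|n|)%N.
have m1 : (1 < m)%N by rewrite /m; clear -n0; lia.
have cm : coprimez 5 m.
  rewrite coprimez_sym /m PoszM coprimezMl; apply/andP.
  by split; [vm_compute | exact: cn].
have [w Ew] : exists w : int, m%:Z = w * n.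
  by exists (2 * sgz n); clear -n0; rewrite /m; lia.
pose v5 : Q := (five b, 0, 0, 0).
have [pi2 [K2 E2 [c [z Ec]]]] : exists pi2 : Q -> Ro, [/\ Ker M pi2, pi2 e1 = pi1 e1 &
    exists c z, c * pi2 v5 = 1 + m%:Z%:~R * z].
  have [lp [[[[p f] r1] r2] eq] _] := K1.
  pose q0 : Q := (0, f, r1, r2); pose qp : Q := (p, 0, 0, 0).
  have E : pi1 qp + pi1 q0 = 1.
    rewrite -(linD lp) -[RHS]eq; congr (pi1 _).
    by rewrite /qp /q0 !add_pair !add0r !addr0.
  have lq : lin (fun p : Pt b => pi1 ((p, 0, 0, 0) : Q)).
    move=> r u v; rewrite -lp; congr (pi1 _).
    by rewrite !scale_pair !add_pair !scaler0 !addr0.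
  have E5 := lin_five p lq.
  have /coprimezP[[k k'] /= ek] := cm.
  (* Since k 5 = 1 mod m, [lin_five] rewrites the value at p as k p times the value at 5, which
     brings unimodularity into the form required by stable rank one. *)
  have [|s [c [hc _]]] := sr1_redm m1 (u := k%:~R * pval p) (b := pi1 v5) (d := pi1 q0).
    rewrite -(rmorph1 (redm m)); apply: (redm_modD (w := - (k'%:~R * pi1 qp)) m1).
    have E' : (pi1 qp : R) + (pi1 q0 : R) = 1 :> R := E.
    have B := bezout_unimodular ek E'.
    apply: etrans B; apply: (congr1 (fun t : R => t + (pi1 q0 : R))).
    rewrite -(mulrA k%:~R) -[pval p * _]E5 mulrA; congr (_ * _); exact: esym (rmorphM intr k 5).
  exists (fun q => pi1 q + pval q.1.1.1 * (k%:~R * s) * pi1 q0); split.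
  - apply: (@Ker_transvection _ _ pi1 (fun q : Q => pval q.1.1.1 * (k%:~R * s)) q0) => //.
      apply: (lin_comp (f := fun q : Q => q.1.1.1) (g := fun p : Pt b => pval p * (k%:~R * s) : Ro)).
        exact: (lin_comp (@lin_fst _ _) (lin_comp (@lin_fst _ _) (@lin_fst _ _))).
      by move=> r u v; rewrite pval_lin mulrDl -[_ *: (_ * _)]/(_ * (_ * _)) mulrA.
    by rewrite /= mul0r.
  - by rewrite /= !mul0r addr0.
  have [X EX] : exists X, X = c * (pi1 v5 + pval v5.1.1.1 * (k%:~R * s) * pi1 q0) by eexists.
  have hX : redm m X = 1.
    rewrite -hc EX; apply: (redm_modD (w := - (c * (k'%:~R * (s * pi1 q0)))) m1).
    apply: etrans (bezout_scale c (pi1 v5) _ ek); congr (_ * (_ + _)).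
    rewrite -[pval v5.1.1.1]/(5%:~R) mulrA -!(mulrA _ s); congr (_ * _).
    exact: esym (rmorphM intr 5 k).
  have [|z ez] := @redm_eq0 m m1 (X - 1); first by rewrite (rmorphB (redm m)) hX rmorph1 subrr.
  exists c, z; apply: etrans (esym EX) _.
  by rewrite -ez addrC subrK.
rewrite -E2 in En; clear pi1 K1 E2.
have [lp _ _] := K2.
pose N := (Pt b * F * Ro)%type.
have lN : lin (fun x : N => pi2 (x, 0)).
  by move=> r u v; rewrite -lp scale_pair add_pair scaler0 addr0.
pose t1 : N := (0, 0, 1); pose t5 : N := (five b, 0, 0).
(* The value at c t5 is 1 + m z, and m z = z w n is corrected by a multiple of the value at t1,
   which divides n. *)
pose x2 : N := c *: t5 - (z * (w%:~R * b1')) *: t1.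
have E : pi2 (x2, 0) = 1.
  rewrite /x2 (linB lN) !(linZ lN) -/e1 -/v5 -[c *: _]/(c * _) Ec.
  rewrite -[_ *: pi2 e1]/(_ * _) -!mulrA En -rmorphM /= -Ew.
  by rewrite (commr_int z m : z * _ = _) addrK.
pose y0 : Q := (0, 1).
have K3 : Ker M (fun q : Q => pi2 q + q.2 * pi2 ((1 - pi2 y0) *: (x2, 0))).
  apply: (@Ker_transvection _ _ pi2 (fun q : Q => q.2) _ _ _ K2); first exact: lin_snd.
  by rewrite scale_pair /= scaler0.
apply: (Ker_split K3); rewrite -/y0 -[(0, 1).2]/(1 : Ro) mul1r (linZ lp) E scaler1.
by rewrite addrC subrK.
Qed.

(** * Modules stably isomorphic to P *)

Lemma det2 (C : comNzRingType) (M : 'M[C]_2) : \det M = M 0 0 * M 1 1 - M 0 1 * M 1 0.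
Proof.
rewrite (expand_det_row _ 0) big_ord_recl big_ord1 /cofactor !det_mx11 !mxE.
have -> : lift 0 0 = 1 :> 'I_2 by apply/val_inj.
have -> : lift 1 0 = 0 :> 'I_2 by apply/val_inj.
by rewrite /= addn0 expr0 mul1r add0n expr1 mulN1r mulrN.
Qed.

Section Kappa.
Variable F : comNzRingType.
(** The splitting of the quaternion ring by 2x2 matrices over F[zeta]; it makes determinants of
    matrices over [Lam] available. *)
Definition kap (x : tw (LD F true)) : 'M[OL F]_2 := \matrix_(i, j)
  if i == 0 then if j == 0 then x.1 else x.2 else if j == 0 then - Lconj x.2 else Lconj x.1.
Lemma kapD x y : kap (x + y) = kap x + kap y.
Proof.
apply/matrixP=> i j; rewrite !mxE; do 2! case: ifP => _ //; by rewrite ?rmorphD ?opprD.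
Qed.
Lemma kapN x : kap (- x) = - kap x.
Proof.
apply/matrixP=> i j; rewrite !mxE; do 2! case: ifP => _ //; by rewrite ?rmorphN ?opprK.
Qed.
Lemma kap0 : kap 0 = 0.
Proof. by have := kapD 0 0; rewrite addr0 => /eqP; rewrite -subr_eq subrr => /eqP. Qed.
Lemma kap1 : kap 1 = 1%:M.
Proof.
apply/matrixP=> i j; rewrite !mxE /= rmorph0 rmorph1 oppr0.
by case: i j => [[|[|i]] hi] [[|[|j]] hj].
Qed.
Lemma kapM x y : kap (x * y) = kap x *m kap y.
Proof.
apply/matrixP=> i j; rewrite !mxE big_ord_recl big_ord1 !mxE quatE /=.
rewrite !(rmorphD, rmorphB, rmorphN, rmorphM) /= !LconjK.
by case: i j => [[|[|i]] hi] [[|[|j]] hj] //=; ring.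
Qed.
Lemma det_kap x : \det (kap x) = LC (nr x).
Proof.
have -> : LC (nr x) = LC (Lnorm x.1) + LC (Lnorm x.2) by exact: rmorphD.
by rewrite det2 !mxE -!Lnorm_conj /= mulrN opprK.
Qed.
End Kappa.

Lemma OL_unit_norm (u v : OL int) : u * v = 1 -> KN (Lnorm u) = 1.
Proof.
move=> /(congr1 (fun z => KN (Lnorm z))); rewrite LnormM KNM Lnorm1 KN1 => e.
exact: int_mul_eq1 (KN_Lnorm_int u) (KN_Lnorm_int v) e.
Qed.

(* The reduced norm of an invertible 2x2 matrix over Lam is a unit, and
   [[l, -m], [u, v]] * [[1, al], [0, be]] = [[l, 0], [u, 1]]. *)
Lemma unimodular_norm (l m u v al be k1 k2 : Lam) :
    l * al = m * be -> u * al + v * be = 1 ->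
    k1 * l + al * u = 1 -> - (k1 * m) + al * v = 0 ->
    k2 * l + be * u = 0 -> - (k2 * m) + be * v = 1 ->
  KN (nr l) = KN (nr be).
Proof.
move=> e1 e2 f1 f2 f3 f4.
pose A := block_mx (kap l) (- kap m) (kap u) (kap v).
pose A' := block_mx (kap k1) (kap al) (kap k2) (kap be).
have AA : A' *m A = 1%:M.
  rewrite mulmx_block !mulmxN -!kapM -!kapN -!kapD f1 f2 f3 f4 kap1 kap0.
  by rewrite -scalar_mx_block.
have D : \det A * LC (nr be) = LC (nr l).
  rewrite -!det_kap -[\det (kap be)]mul1r -[X in _ * (X * _)](det1 _ 2) -(det_ublock 1%:M (kap al)).
  rewrite -det_mulmx mulmx_block !mulmx1 !mulmx0 !addr0 mulNmx -!kapM -kapN -!kapD e1 e2 addrN kap0 kap1.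
  by rewrite det_lblock det1 mulr1.
have U : KN (Lnorm (\det A)) = 1.
  by apply: (OL_unit_norm (v := \det A')); rewrite mulrC -det_mulmx AA det1.
have := congr1 (fun z => KN (Lnorm z)) D; rewrite LnormM KNM U mul1r !Lnorm_C.
rewrite !expr2 !KNM.
move=> /eqP; rewrite -!expr2 eqrXn2 ?KN_nr_ge0 // => /eqP ->.
by [].
Qed.

Lemma Lam_torsion (n : int) (u : Lam) : n != 0 -> n%:~R * u = 0 -> u = 0.
Proof.
move=> n0; rewrite mulrzl => e.
have D (f : {additive Lam -> int}) : f u = 0.
  by have /eqP := congr1 f e; rewrite raddfMz raddf0 mulrz_eq0 (negPf n0) => /eqP.
have E (f : {additive Lam -> OL int}) : f u = 0.
  apply: L_ext; apply: K_ext.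
  - exact: (D (@K0 int \o (@L0 int \o f))).
  - exact: (D (@K1 int \o (@L0 int \o f))).
  - exact: (D (@K2 int \o (@L0 int \o f))).
  - exact: (D (@K0 int \o (@L1 int \o f))).
  - exact: (D (@K1 int \o (@L1 int \o f))).
  exact: (D (@K2 int \o (@L1 int \o f))).
by apply: injective_projections; [exact: (E fst) | exact: (E snd)].
Qed.

Lemma Zi_torsion (n : int) (u : Zi) : n != 0 -> n%:~R * u = 0 -> u = 0.
Proof.
move=> n0; rewrite Zi_int ZiE; case: u => s t /= [e1 e2].
by apply: injective_projections => /=; move: e1 e2; rewrite !mul0r ?subr0 ?addr0 => /eqP + /eqP;
  rewrite !mulf_eq0 (negPf n0) => /eqP + /eqP.
Qed.

Lemma add_intmul (T : pzRingType) (n : int) (z : T) : z + n%:~R * z = (1 + n)%:~R * z.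
Proof. by rewrite rmorphD mulrDl mul1r. Qed.

(** Membership in P only concerns the Z[i]-component, which may be changed by multiples of 14
    without touching [Lam]. Here r is changed so that this component is multiplied by 15, hence
    divisible by 5. *)
Lemma P_surjL b (l : Lam) : exists p : Pt b, piL (pval p) = l.
Proof.
have [r er] := piL_surj l.
have [c1 c2 c3 c4] := char14.
have [E [b1 b2 b3 b4]] : exists r, [/\ piL r = 0, piI r = 14%:~R, piA r = 0 & piS r = 0].
  by apply: glue; rewrite ?(rmorph_int redZi) ?(rmorph_int mod2I) ?rmorph0.
have m : (r + E * r : R) \in Pm b.
  apply/PmP; pose q : Zi := (2, if b then 1 else -1); exists (piI r * 3%:~R * q).
  transitivity (piI r + piI (E * r)); first exact: (rmorphD piI).
  rewrite piIM b2 -!mulrA; have -> : (3 : int)%:~R * (q * rho b) = 15%:~R.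
    by rewrite !Zi_int !ZiE /q /rho; case: (b).
  rewrite (commr_int (piI r) 15 : _ * _ = _); exact: (add_intmul 14).
exists (PT m); rewrite /=; transitivity (piL r + piL (E * r)); first exact: (rmorphD piL).
by rewrite piLM b1 mul0r addr0.
Qed.

Lemma neg_proj (S : pzRingType) (x y : S) : x * y = 0 - (0 + (-1) * x) * y.
Proof. by rewrite sub0r add0r mulN1r mulNr opprK. Qed.

Section Ideal.
Variables (b : bool) (a : Pt b -> Ro) (be : R) (p0 : Pt b) (r0 : R).
Hypothesis la : lin a.
Hypothesis uni : (a p0 : R) + r0 * be = 1.

(** The kernel of (p, y) -> a p + y be, projected to P and seen as a left ideal of R; the projection
    is injective once right multiplication by be is. *)
Definition Iker (r : R) := exists2 p : Pt b, pval p = r & exists y : R, (a p : R) = y * be.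

Lemma Iker_ideal : lideal Iker.
Proof.
split.
- by exists 0 => //; exists 0; rewrite (lin0 la) mul0r.
- move=> _ _ [p <- [y e]] [p' <- [y' e']]; exists (p + p') => //.
  exists (y + y'); rewrite mulrDl -e -e'; exact: (linD la).
move=> r _ [p <- [y e]]; exists (r *: p) => //; exists (r * y).
by rewrite -mulrA -e; exact: (linZ la).
Qed.

(** The projection of (p, y) to the kernel along (p0, r0), where the functional takes the value
    1. *)
Lemma Iker_proj (p : Pt b) (y : R) : Iker (pval p - ((a p : R) + y * be) * pval p0).
Proof.
set t := (a p : R) + y * be; exists (p - t *: p0) => //.
exists (t * r0 - y); transitivity ((a p : R) - t * (a p0 : R)).
  by rewrite (linB la) (linZ la).
have -> : (a p0 : R) = 1 - r0 * be by rewrite -uni addrK.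
by rewrite /t mulrBr mulr1 mulrBl opprB mulrA addrCA opprD addNKr.
Qed.

Let A : R := a (five b).
Let a5 p : (5%:~R : R) * (a p : R) = pval p * A.
Proof. exact: (lin_five p la). Qed.

Let P3 : exists p : Pt b, piI (pval p) = rho b.
Proof.
have [r er] := piI_surj (rho b).
have m : r \in Pm b by apply/PmP; exists 1; rewrite mul1r.
by exists (PT m).
Qed.

Let a3 (p p' : Pt b) q : piI (pval p) = rho b -> piI (pval p') = q * rho b ->
  piI (a p') = q * piI (a p).
Proof.
move=> e e'; apply/eqP; rewrite -subr_eq0; apply/eqP; apply: (@Zi_torsion 5) => //.
have h (z : Pt b) : 5%:~R * piI (a z) = piI (pval z) * piI A.
  by rewrite -piIM -a5 piIM (rmorph_int piI).
rewrite mulrBr h e' mulrA -[5%:~R * q](commr_int q 5) -[q * 5%:~R * _]mulrA h e mulrA.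
by rewrite subrr.
Qed.

(** Over a commutative ring the kernel of a unimodular row (al, be) is generated by (be, -al); the
    P-coordinate is counted in multiples of rho. *)
Lemma Iker_I : img piI Iker (rho b * piI be) /\
  (forall i, Iker i -> exists q, piI i = q * (rho b * piI be)).
Proof.
have [p e] := P3; have [q0 e0] : exists q, piI (pval p0) = q * rho b by apply/PmP; exact: pvalP.
set al := piI (a p).
have u3 : q0 * al + piI r0 * piI be = 1.
  rewrite -(a3 e e0) -piIM -(rmorph1 piI) -uni; exact: esym (rmorphD piI _ _).
split.
  have [_ ID IM] := Iker_ideal.
  exists (((a p : R) * (be * pval p0)) + be * (pval p - (a p : R) * pval p0)).
    apply: (ID); apply: IM.
      have E : (be * pval p0 : R) = (pval (0 : Pt b) : R) - ((a 0 : R) + (-1) * be) * pval p0.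
        have -> : (a 0 : R) = 0 by exact: (lin0 la).
        exact: (neg_proj be (pval p0 : R)).
      by rewrite E; exact: Iker_proj.
    have E : (pval p - (a p : R) * pval p0 : R) = pval p - ((a p : R) + 0 * be) * pval p0.
      by rewrite mul0r addr0.
    by rewrite E; exact: Iker_proj.
  transitivity (piI be * piI (pval p)); last by rewrite e Zi_mulC.
  transitivity (piI ((a p : R) * (be * pval p0)) + piI (be * (pval p - (a p : R) * pval p0))).
    exact: (rmorphD piI).
  rewrite !piIM; have -> : piI (pval p - (a p : R) * pval p0) = piI (pval p) - piI (a p) * piI (pval p0).
    by rewrite -piIM; exact: (rmorphB piI).
  rewrite mulrBr !mulrA [piI (a p) * piI be]Zi_mulC addrC subrK.
  by [].
move=> _ [p' <- [y ey]]; have [q' e'] : exists q, piI (pval p') = q * rho b by apply/PmP; exact: pvalP.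
have Ey : q' * al = piI y * piI be by rewrite -(a3 e e') ey piIM.
exists (q0 * piI y + q' * piI r0); rewrite e' (Zi_mulC (rho b)) mulrA; congr (_ * _).
by rewrite mulrDl -!mulrA -Ey mulrA [q0 * q']Zi_mulC -mulrA -mulrDr u3 mulr1.
Qed.

Hypothesis be0 : KN (nr (piL be)) != 0.

Let beL_inj x : x * piL be = 0 -> x = 0.
Proof.
move=> h; have := congr1 (fun z => KN (nr z)) h; rewrite nrM KNM.
have -> : KN (nr (0 : Lam)) = 0 by rewrite /nr /= /Lnorm !LE.
move=> /eqP; rewrite mulf_eq0 (negPf be0) orbF => /eqP k0.
have := KN_nr_gt0 (u := x); rewrite k0.
by move=> H; apply: NNPP => x0; have := H x0; rewrite ltxx.
Qed.

(** Noncommutativity prevents taking be itself as generator. The generator l from [Lam_principal],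
    with the splitting vector (u, v), completes to an invertible 2x2 matrix, and this ties the norm
    of l to that of be. *)
Lemma Iker_L : exists l, [/\ img piL Iker l, forall i, Iker i -> exists q, piL i = q * l &
  KN (nr l) = KN (nr (piL be))].
Proof.
have [l Il Gl] := Lam_principal (img_lideal (f := piL) piL_surj Iker_ideal).
exists l; split=> //; first by move=> i Ii; apply: Gl; exists i.
have [p1 e1] := P_surjL b 1.
set al := piL (a p1).
have aL (p : Pt b) : piL (a p) = piL (pval p) * al.
  apply/eqP; rewrite -subr_eq0; apply/eqP; apply: (@Lam_torsion 5) => //.
  have h (z : Pt b) : 5%:~R * piL (a z) = piL (pval z) * piL A.
    by rewrite -piLM -a5 piLM (rmorph_int piL).
  rewrite mulrBr h mulrA -[5%:~R * piL (pval p)](commr_int _ 5) -[_ * 5%:~R * _]mulrA h e1 mul1r.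
  by rewrite subrr.
have IL x y : x * al = y * piL be -> img piL Iker x.
  move=> h; have [p ep] := P_surjL b x; have [r er] := piL_surj (- y).
  exists (pval p - ((a p : R) + r * be) * pval p0); first exact: Iker_proj.
  transitivity (piL (pval p) - piL ((a p : R) + r * be) * piL (pval p0)).
    by rewrite -piLM; exact: (rmorphB piL).
  have -> : piL ((a p : R) + r * be) = piL (a p) + piL (r * be) by exact: (rmorphD piL).
  by rewrite piLM er aL ep h mulNr subrr mul0r subr0.
have LI x : img piL Iker x -> exists y, x * al = y * piL be.
  by move=> [_ [p <- [y ey]] <-]; exists (piL y); rewrite -aL ey piLM.
have [m em] := LI l Il.
set u := piL (pval p0); set v := piL r0.
have uv : u * al + v * piL be = 1.
  rewrite -aL -piLM -(rmorph1 piL) -uni; exact: esym (rmorphD piL _ _).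
have [k1 ek1] : exists k, 1 - al * u = k * l.
  apply: Gl; apply: (IL _ (al * v)); rewrite mulrBl mul1r -!mulrA.
  have -> : v * piL be = 1 - u * al by rewrite -uv addrC addKr.
  by rewrite mulrBr mulr1.
have [k2 ek2] : exists k, - (piL be * u) = k * l.
  apply: Gl; apply: (IL _ (piL be * v - 1)); rewrite mulNr mulrBl mul1r -!mulrA.
  have -> : u * al = 1 - v * piL be by rewrite -uv addrK.
  by rewrite mulrBr mulr1 opprB.
apply: (unimodular_norm em uv (k1 := k1) (k2 := k2)).
- by rewrite -ek1 subrK.
- apply: beL_inj; rewrite mulrDl mulNr -mulrA -em mulrA -ek1 mulrBl mul1r -!mulrA.
  have -> : v * piL be = 1 - u * al by rewrite -uv addrC addKr.
  by rewrite mulrBr mulr1 addNr.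
- by rewrite -ek2 addNr.
apply/eqP; rewrite -subr_eq0; apply/eqP; apply: beL_inj.
rewrite mulrBl mulrDl mulNr -mulrA -em mulrA -ek2 mulNr opprK mul1r -!mulrA.
have -> : u * al = 1 - v * piL be by rewrite -uv addrK.
by rewrite mulrBr mulr1 subrK subrr.
Qed.

End Ideal.

Section Class.
Variables (b : bool) (pi : (Pt b * Ro)%type -> Ro) (x1 : (Pt b * Ro)%type) (be' : R) (n : int).
Hypothesis lp : lin pi.
Hypothesis e1 : pi x1 = 1.
Let a (p : Pt b) : Ro := pi (p, 0).
Let be : R := pi (0, 1).
Hypothesis hn : be' * be = n%:~R.
Hypothesis cn : coprimez n 14.

Lemma pi_pair p (r : R) : (pi (p, r) : R) = (a p : R) + r * be.
Proof.
have -> : (p, r) = (p, 0) + r *: (0, 1) :> (Pt b * Ro)%type.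
  by rewrite scale_pair add_pair scaler0 addr0 add0r scaler1.
by rewrite (linD lp) (linZ lp).
Qed.
Lemma a_lin : lin a.
Proof. by move=> r u v; rewrite /a -lp scale_pair add_pair scaler0 addr0. Qed.
Lemma a_uni : (a x1.1 : R) + (x1.2 : R) * be = 1.
Proof. by rewrite -pi_pair -surjective_pairing. Qed.

Let n0 : n != 0.
Proof. by apply: contraTneq cn => ->. Qed.
Let be_inj y : y * be = 0 -> y = 0.
Proof. exact: right_injective n0 hn. Qed.

Lemma Iker_int : Iker a be (n * 5)%:~R.
Proof.
exists (n%:~R *: five b); first exact: esym (rmorphM intr n 5).
exists ((a (five b) : R) * be'); rewrite -mulrA hn.
transitivity (n%:~R * (a (five b) : R)); first exact: (linZ a_lin).
exact: esym (commr_int _ n).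
Qed.

Lemma Iker_Ker (c : bool) (w : int) (h : R) : w != 0 ->
    (forall q, (exists q', piI q = q' * rho c) -> exists2 i, Iker a be i & q * h = w%:~R * i) ->
    (forall i, Iker a be i -> exists2 q, (exists q', piI q = q' * rho c) & w%:~R * i = q * h) ->
    (forall q, q * h = 0 -> q = 0) -> Ker (Pt c) pi.
Proof.
move=> w0 H1 H2 H3.
(* (q, s) corresponds to the x of value s whose kernel part x - s x1 becomes q h after scaling by
   w. *)
pose T (y : (Pt c * Ro)%type) (x : (Pt b * Ro)%type) :=
  pi x = y.2 /\ (w%:~R : R) * pval (x.1 - y.2 *: x1.1) = (pval y.1 : R) * h.
have [] := @iso_rel_fun _ _ T.
- move=> r [q s] [p t] [q' s'] [p' t'] [h1 h2] [h1' h2']; split; first by rewrite lp h1 h1'.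
  have E : r *: p + p' - (r *: s + s') *: x1.1 = r *: (p - s *: x1.1) + (p' - s' *: x1.1).
    by rewrite scalerBr scalerDl scalerA opprD addrACA.
  apply: etrans (congr1 (fun z : Pt b => (w%:~R : R) * (pval z : R)) E) _.
  have G (S : pzRingType) (W r' A B A' B' H : S) : W * r' = r' * W -> W * A = B * H -> W * A' = B' * H ->
    W * (r' * A + A') = (r' * B + B') * H.
    by move=> cm g g'; rewrite mulrDr mulrA cm -mulrA g g' mulrDl mulrA.
  apply: (G (QG int)) h2 h2'; exact: esym (commr_int r w).
- move=> [q s].
  have [_ [p <- [y ey]] E] := H1 (pval q) ((PmP c (pval q)).1 (pvalP q)).
  exists ((p, - y) + s *: x1); split.
    rewrite (linD lp) (linZ lp) e1 scaler1 /=.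
    have -> : pi (p, - y) = 0; last by rewrite add0r.
    by apply: etrans (pi_pair p (- y)) _; rewrite ey mulNr subrr.
  rewrite -[((p, - y) + s *: x1).1]/(p + s *: x1.1) addrK; exact: esym E.
- move=> x; pose s := pi x; pose x' := x - s *: x1.
  have px' : pi x' = 0 by rewrite (linB lp) (linZ lp) e1 scaler1 subrr.
  have Ix' : Iker a be (pval x'.1).
    exists x'.1 => //; exists (- (x'.2 : R)).
    move: px'; rewrite (surjective_pairing x') => /(etrans (esym (pi_pair _ _))) /eqP.
    by rewrite addr_eq0 mulNr => /eqP.
  have [q hq E] := H2 _ Ix'; have mq : q \in Pm c by apply/PmP.
  by exists (PT mq, s).
- move=> x [/= p0 h0].
  have x10 : x.1 = 0.
    apply: val_inj; apply: (int_torsion w0).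
    move: h0; rewrite scale0r subr0 => ->; exact: mul0r.
  have x20 : x.2 = 0.
    apply: be_inj; move: p0; rewrite (surjective_pairing x) x10 => /(etrans (esym (pi_pair _ _))).
    by rewrite (lin0 a_lin) add0r.
  by rewrite (surjective_pairing x) x10 x20.
- move=> [q s] [/= p0 h0]; have s0 : s = 0 by rewrite -p0 (lin0 lp).
  rewrite s0; congr pair; apply: val_inj; apply: H3; rewrite -h0 s0 scale0r subr0; exact: mulr0.
move=> f [g [lf lg fK gK Tf]]; split=> //; first by exists x1.
exists (fun q => f (q, 0)); split.
- by move=> r u v; rewrite -lf scale_pair add_pair scaler0 addr0.
- by move=> u v /(can_inj fK) [].
- by move=> q; have [-> _] := Tf (q, 0).
move=> x px; exists (g x).1; rewrite -[RHS]gK; congr (f _).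
have [/= hh _] := Tf (g x); apply: injective_projections => //=.
by rewrite -hh gK px.
Qed.

(** Apply [locally_principal] to w times the kernel ideal. The scaling allows a change of prime: 5
    (2 + i) = (2 - i) (2 + i)^2 shows how w = 5 leads from one prime over 5 to the other. *)
Lemma Ker_class (l : Lam) (c : bool) (w : int) (nu : Zi) :
    img piL (Iker a be) l -> (forall i, Iker a be i -> exists q, piL i = q * l) ->
    coprimez w 14 -> rho c * nu = w%:~R * (rho b * piI be) ->
    (exists (k : int) (e : bool), redLam (w%:~R * l) = k%:~R * redZi (Zij ^+ e * nu)) ->
  Ker (Pt c) pi.
Proof.
move=> Il Gl cw Enu Hk.
have w0 : w != 0 by apply: contraTneq cw => ->.
have hI := @Iker_ideal b a be a_lin; have [I0 ID IM] := hI.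
pose J (r : R) := exists2 i, Iker a be i & r = w%:~R * i.
have hJ : lideal J.
  split; first by exists 0; rewrite ?mulr0.
    by move=> _ _ [i Ii ->] [j Ij ->]; exists (i + j); [exact: ID | rewrite mulrDr].
  move=> r _ [i Ii ->]; exists (r * i); first exact: IM.
  by rewrite !mulrA (commr_int r w : r * _ = _).
have JN : J (w * (n * 5))%:~R by exists (n * 5)%:~R; [exact: Iker_int | rewrite rmorphM].
have cN : coprimez (w * (n * 5)) 14 by rewrite !coprimezMl cw cn.
have [I3 G3] := Iker_I a_lin a_uni.
have [|||||h [h1 h2]] := @locally_principal J (w * (n * 5)) (w%:~R * l) (rho c) nu hJ JN cN.
- by have [i Ii ei] := Il; exists (w%:~R * i); [exists i | rewrite piLM ei (rmorph_int piL)].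
- move=> _ [i Ii ->]; have [q eq] := Gl i Ii; exists q.
  by rewrite piLM (rmorph_int piL) eq mulrA -[w%:~R * q](commr_int q w) -mulrA.
- have [i Ii ei] := I3; exists (w%:~R * i); first by exists i.
  by rewrite Enu piIM ei (rmorph_int piI).
- move=> _ [i Ii ->]; have [q eq] := G3 i Ii; exists q.
  by rewrite Enu piIM (rmorph_int piI) eq [LHS]mulrA -[w%:~R * q](commr_int q w) -[q * _ * _]mulrA.
- exact: Hk.
have [s _ es] := h2 _ JN.
have N0 : w * (n * 5) != 0 by apply: contraTneq cN => ->.
apply: (Iker_Ker (h := h) w0).
- by move=> q hq; have [i Ii ei] := h1 q hq; exists i.
- by move=> i Ii; have [|q hq eq] := h2 (w%:~R * i); [exists i | exists q].
by move=> q; exact: (right_injective N0 (esym es)).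
Qed.
End Class.

(** * Residue classes in F49 and the two modules *)

Definition mul7 (u v : 'F_7 * 'F_7) := (u.1 * v.1 - u.2 * v.2, u.1 * v.2 + u.2 * v.1).
Definition Zpow (e : bool) : 'F_7 * 'F_7 := if e then (0, 1) else (1, 0).
(** Either s + t i is a scalar times a power of i, or it becomes one after multiplication by 5 / (3
    + 4i), where 3 + 4i is (2 + i)^2. Raw pairs let [vm_compute] run through all of F49. *)
Definition F49_test (s t : 'F_7) : bool :=
  has (fun k : int => has (fun e => mul7 (k%:~R, 0) (Zpow e) == (s, t)) [:: false; true])
    [:: 0; 1; 2; 3; 4; 5; 6] ||
  has (fun k : int => has (fun e =>
      mul7 (mul7 (k%:~R, 0) (Zpow e)) (3, 4) == mul7 (5, 0) (s, t)) [:: false; true])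
    [:: 0; 1; 2; 3; 4; 5; 6].

Lemma F49_testP (s t : 'F_7) : (s ^+ 2 + t ^+ 2) ^+ 3 = 1 -> F49_test s t.
Proof.
move=> /eqP h; pose F7 : seq 'F_7 := [:: 0; 1; 2; 3; 4; 5; 6].
have C : all (fun s => all (fun t : 'F_7 => ((s ^+ 2 + t ^+ 2) ^+ 3 == 1) ==> F49_test s t) F7) F7.
  by vm_compute.
by have := allP (allP C _ (F7_case s)) _ (F7_case t); rewrite h.
Qed.

Lemma mul7A u v w : mul7 u (mul7 v w) = mul7 (mul7 u v) w.
Proof. by rewrite /mul7 /=; congr pair; ring. Qed.

Lemma F49E (u v : F49) : u * v = mul7 u v.
Proof. by rewrite twE /mul7 /=; congr pair; rewrite expr1 mulrN1. Qed.

Lemma F49_classes (l : F49) (v : Zi) :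
    (redZi v).1 ^+ 2 + (redZi v).2 ^+ 2 != 0 ->
    (l.1 ^+ 2 + l.2 ^+ 2) ^+ 3 = ((redZi v).1 ^+ 2 + (redZi v).2 ^+ 2) ^+ 3 ->
  (exists (k : int) (e : bool), l = k%:~R * redZi (Zij ^+ e * v)) \/
  (exists (k : int) (e : bool), 5%:~R * l = k%:~R * redZi (Zij ^+ e * (rho false * rho false * v))).
Proof.
move=> h1 h2.
have Ze (e : bool) u : redZi (Zij ^+ e * u) = mul7 (Zpow e) (redZi u).
  by rewrite (rmorphM redZi) F49E; case: e; rewrite ?expr1 // expr0 rmorph1.
have Zr : redZi (rho false * rho false * v) = mul7 (3, 4) (redZi v).
  rewrite (rmorphM redZi) F49E.
  by have -> : redZi (rho false * rho false) = (3, 4) :> 'F_7 * 'F_7 by rewrite ZiE; apply/eqP.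
case: l h2 => l1 l2; case Ev: (redZi v) h1 Zr => [b1 b2] h1 Zr h2; rewrite /= in h1 h2.
pose d := b1 ^+ 2 + b2 ^+ 2; pose s := (l1 * b1 + l2 * b2) / d; pose t := (l2 * b1 - l1 * b2) / d.
have El : (l1, l2) = mul7 (s, t) (b1, b2) by rewrite /mul7 /s /t /d /=; congr pair; field.
have /F49_testP/orP : (s ^+ 2 + t ^+ 2) ^+ 3 = 1.
  have -> : s ^+ 2 + t ^+ 2 = (l1 ^+ 2 + l2 ^+ 2) / d by rewrite /s /t /d; field.
  by rewrite expr_div_n h2 divff // expf_neq0.
case=> /hasP[k _ /hasP[e _ /eqP E]]; [left | right]; exists k, e.
  by rewrite El Ze Ev F49_int F49E mul7A E.
by rewrite Ze Zr !F49_int !F49E El !mul7A E.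
Qed.

Lemma redLam_nr (u : Lam) : redK (nr u) = (redLam u).1 ^+ 2 + (redLam u).2 ^+ 2.
Proof.
have sq x : redK (Lnorm x) = redL x ^+ 2.
  by rewrite -redL_C -Lnorm_conj (rmorphM redL) redL_conj.
by case: u => u1 u2; rewrite -!sq; exact: (rmorphD redK).
Qed.

(** A transvection makes the value be on the free summand a unit mod 14. Then generator and be have
    equal norms in [Lam], hence residues with norms of equal cube, and [F49_classes] leaves the two
    cases. *)
Lemma rank_one (M : lmodType R) : iso (M * Ro)%type (Pt false * Ro)%type ->
  iso M (Pt false) \/ iso M (Pt true).
Proof.
move=> /iso_Ker[pi K].
have [pi1 [K1 [c hc]]] : exists pi1 : (Pt false * Ro)%type -> Ro, Ker M pi1 /\
    exists c : R, redm 14 ((pi1 (0, 1) : R) * c) = 1.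
  have [lp [[p r] eq] _] := K.
  have E := pi_pair lp p r; rewrite eq addrC in E.
  have [|s [c [_ hc]]] := sr1_redm (isT : (1 < 14)%N) (u := r) (b := pi (0, 1)) (d := pi (p, 0)).
    by rewrite -E rmorph1.
  exists (fun q => pi q + q.2 * pi (s *: (p, 0))); split.
    apply: (@Ker_transvection _ _ pi (fun q => q.2) _ _ _ K); first exact: lin_snd.
    by rewrite scale_pair /= scaler0.
  have E' : (pi (s *: (p, 0)) : R) = s * (pi (p, 0) : R) by exact: (linZ lp).
  exists c.
  exact: etrans (congr1 (fun z : R => redm 14 (((pi (0, 1) : R) + z) * c)) (etrans (mul1r _) E')) hc.
clear pi K; have [lp [x1 e1] _] := K1.
pose be : R := pi1 (0, 1).
have cd := redm_det (isT : (1 < 14)%N) hc.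
have d0 : \det (RM be) != 0 by apply: contraTneq cd => ->.
have [be' [hb _]] := adjugate_exists d0.
have cL : coprimez (KN (nr (piL be))) 14.
  by apply: (Lam_coprime (q := piL be') (n := \det (RM be))) cd; rewrite -piLM hb (rmorph_int piL).
have be0 : KN (nr (piL be)) != 0 by apply: contraTneq cL => ->.
have [l [Il Gl Nl]] := Iker_L (a_lin lp) (a_uni lp e1) be0.
have redbe : redZi (piI be) = redLam (piL be) by rewrite red_pi.
have [_ b7] := K_coprime14_red cL; rewrite redLam_nr -redbe in b7.
have N3 : ((redLam l).1 ^+ 2 + (redLam l).2 ^+ 2) ^+ 3 =
    ((redZi (piI be)).1 ^+ 2 + (redZi (piI be)).2 ^+ 2) ^+ 3.
  by rewrite redbe -!redLam_nr !redK_norm Nl.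
have [[k [e E]]|[k [e E]]] := F49_classes b7 N3; [left | right]; apply: (Ker_unique K1).
  apply: (Ker_class lp e1 hb cd (w := 1) (nu := piI be) Il Gl) => //; first by rewrite mul1r.
  by exists k, e; rewrite mul1r.
apply: (Ker_class lp e1 hb cd (w := 5) (nu := rho false * rho false * piI be) Il Gl) => //.
  have E5 : rho true * rho false = 5%:~R by rewrite Zi_int ZiE.
  by rewrite !mulrA E5.
by exists k, e; rewrite -E (rmorphM redLam) (rmorph_int redLam).
Qed.

Lemma lin_piL b (a : Pt b -> Ro) : lin a -> exists al, forall p, piL (a p) = piL (pval p) * al.
Proof.
move=> la; have [p1 e1] := P_surjL b 1; exists (piL (a p1)) => p.
apply/eqP; rewrite -subr_eq0; apply/eqP; apply: (@Lam_torsion 5) => //.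
have h (z : Pt b) : 5%:~R * piL (a z) = piL (pval z) * piL (a (five b)).
  by rewrite -piLM -[pval z * _](lin_five z la) [RHS]piLM (rmorph_int piL).
rewrite mulrBr h mulrA -[5%:~R * piL (pval p)](commr_int _ 5) -[_ * 5%:~R * _]mulrA h e1 mul1r.
by rewrite subrr.
Qed.

Lemma lin_piI b (a : Pt b -> Ro) : lin a ->
  exists ep, forall p q, piI (pval p) = q * rho b -> piI (a p) = q * ep.
Proof.
move=> la; have [r er] := piI_surj (rho b).
have m : r \in Pm b by apply/PmP; exists 1; rewrite mul1r.
exists (piI (a (PT m))) => p q e; apply/eqP; rewrite -subr_eq0; apply/eqP; apply: (@Zi_torsion 5) => //.
have h (z : Pt b) : 5%:~R * piI (a z) = piI (pval z) * piI (a (five b)).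
  by rewrite -piIM -[pval z * _](lin_five z la) [RHS]piIM (rmorph_int piI).
rewrite mulrBr h e mulrA -[5%:~R * q](commr_int q 5) -[q * 5%:~R * _]mulrA h /= er mulrA.
by rewrite subrr.
Qed.

Lemma Zi_unit (u : Zi) : Zi_norm u = 1 -> [\/ u = (1, 0), u = (-1, 0), u = (0, 1) | u = (0, -1)].
Proof.
case: u => s t; rewrite /Zi_norm /= => h.
have sq1 (x y : int) : x ^+ 2 + y ^+ 2 = 1 -> x != 0 -> y = 0 /\ (x = 1 \/ x = -1).
  move=> e x0; have x2 : 0 < x ^+ 2 by rewrite exprn_even_gt0.
  have y2 := sqr_ge0 y.
  have /eqP : y ^+ 2 = 0 by move: (x ^+ 2) (y ^+ 2) e x2 y2 => *; lia.
  rewrite sqrf_eq0 => /eqP y0; split=> //.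
  move: e; rewrite y0 expr0n addr0 => /eqP; rewrite sqrf_eq1.
  by case/orP=> /eqP; [left | right].
have [s0|s0] := eqVneq s 0.
  have t0 : t != 0 by apply: contraTneq isT => t0; move: h; rewrite s0 t0.
  rewrite addrC in h; have [-> [->|->]] := sq1 _ _ h t0; first by constructor 3.
  by constructor 4.
by have [-> [->|->]] := sq1 _ _ h s0; [constructor 1 | constructor 2].
Qed.

(** An isomorphism multiplies by a unit al in [Lam] and by e (2 - i) / (2 + i) in Z[i], with e a
    unit. At 5 this gives 5 al = e (2 - i)^2 mod 7. Both coordinates of (2 - i)^2 = 3 - 4i are
    nonzero mod 7, whereas al has a zero coordinate. *)
Lemma P_not_iso : ~ iso (Pt false) (Pt true).
Proof.
move=> [f [g [lf lg fK gK]]].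
have la : lin (fun p => pval (f p)) by move=> r u v; rewrite lf.
have lb : lin (fun p => pval (g p)) by move=> r u v; rewrite lg.
have [al Ha] := lin_piL la; have [al' Hb] := lin_piL lb.
have [ep He] := lin_piI la.
have alu : al * al' = 1.
  have [p1 e1] := P_surjL false 1.
  have h1 : piL (pval (g (f p1))) = piL (pval (f p1)) * al' := Hb (f p1).
  have h2 : piL (pval (f p1)) = piL (pval p1) * al := Ha p1.
  by rewrite -[al]mul1r -e1 -h2 -h1 fK.
have [r er] := piI_surj (rho false).
have m : r \in Pm false by apply/PmP; exists 1; rewrite mul1r.
have [e Ee] : exists e, ep = e * rho true.
  have [q eq] : exists q, piI (pval (f (PT m))) = q * rho true by apply/PmP; exact: pvalP.
  by exists q; rewrite -eq (He _ 1) ?mul1r.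
have [z Ez] : exists z, rho true = z * ep.
  have [r' er'] := piI_surj (rho true).
  have m' : r' \in Pm true by apply/PmP; exists 1; rewrite mul1r.
  have [q eq] : exists q, piI (pval (g (PT m'))) = q * rho false by apply/PmP; exact: pvalP.
  by exists q; rewrite -(He _ _ eq) gK.
have ue : Zi_norm e = 1.
  have n5 : Zi_norm (rho true) = 5 by apply/eqP; vm_compute.
  have := congr1 Zi_norm Ez; rewrite Ee !Zi_norm_M n5.
  have : 0 <= Zi_norm e by rewrite addr_ge0 ?sqr_ge0.
  have : 0 <= Zi_norm z by rewrite addr_ge0 ?sqr_ge0.
  move: (Zi_norm z) (Zi_norm e) => x y hx hy E; apply: (int_mul_eq1 hy hx).
  by rewrite mulrC; move: E; rewrite mulrA; move: (x * y) => t; lia.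
have R5 : redLam (5%:~R * al) = redZi (rho true * (e * rho true)).
  have E1 := Ha (five false); have E2 := He (five false) (rho true).
  rewrite -Ee -E2; last by rewrite /= (rmorph_int piI) Zi_int ZiE.
  by rewrite -red_pi E1 /= (rmorph_int piL).
have {R5} := R5; rewrite (rmorphM redLam) (rmorph_int redLam) F49_int F49_scal.
have h1 : redLam al = (redL al.1, redL al.2) by [].
have [z1|z1] := Lam_unit alu; rewrite h1 z1 rmorph0 /= mulr0.
  by move=> /(congr1 fst) /=; have [->|->|->|->] := Zi_unit ue; move=> /eqP; vm_compute.
by move=> /(congr1 snd) /=; have [->|->|->|->] := Zi_unit ue; move=> /eqP; vm_compute.
Qed.

Lemma Pm_mulr b (r s : R) : r \in Pm b -> r * s \in Pm b.
Proof. by move=> /PmP[q e]; apply/PmP; exists (q * piI s); rewrite piIM e -!mulrA [rho b * _]Zi_mulC. Qed.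

(** The two ideals are comaximal, so their direct sum is R plus their intersection. The latter has
    Z[i]-component (5), a scalar mod 7, and is therefore principal. *)
Lemma P_sum_free : iso (Pt false * Pt true)%type (Ro * Ro)%type.
Proof.
pose J (r : R) := r \in Pm false /\ r \in Pm true.
have hJ : lideal J.
  split; first by split; apply: rpred0.
    by move=> u v [h1 h2] [h3 h4]; split; apply: (rpredD (S := Pm _)).
  by move=> r u [h1 h2]; split; [exact: (rpredZ r h1) | exact: (rpredZ r h2)].
have J5 : J (5 : int)%:~R by split; exact: five_mem.
have JI i : J i -> exists q, piI i = q * (1 * 5%:~R).
  move=> [/PmP[[a b] e1] h2]; move: h2; rewrite unfold_in e1 ZiE /rho /kk /= mul1r => /dvdzP[d ed].
  pose q : Zi := (b + a * 2 - d * 2, b + a - d); exists q.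
  by rewrite Zi_int ZiE /q; apply: injective_projections => /=; lia.
have [c1 c2 c3 c4] := char14.
have [E [b1 b2 b3 b4]] : exists r, [/\ piL r = 0, piI r = 14%:~R, piA r = 0 & piS r = 0].
  by apply: glue; rewrite ?(rmorph_int redZi) ?(rmorph_int mod2I) ?rmorph0.
have EL : piL (1 + E) = 1.
  transitivity (piL 1 + piL E); first exact: (rmorphD piL).
  by rewrite b1 addr0; exact: (rmorph1 piL).
have EI : piI (1 + E) = (15%:Z, 0%:Z).
  transitivity (piI 1 + piI E); first exact: (rmorphD piI).
  by rewrite b2 (_ : piI 1 = 1) ?Zi_int //; exact: (rmorph1 piI).
have JE : J (1 + E) by split; rewrite unfold_in EI.
have [|||||h [h1 h2]] := @locally_principal J 5 1 1 5%:~R hJ J5 isT.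
- by exists (1 + E).
- by move=> i _; exists (piL i); rewrite mulr1.
- by exists 5%:~R; rewrite // mul1r (rmorph_int piI).
- exact: JI.
- exists 3, false; rewrite expr0 mul1r (rmorph_int redZi) rmorph1 !F49_int F49_scal /=.
  by apply/eqP.
have hR p : J (p * h) by apply: h1; exists (piI p); rewrite mulr1.
have hK q : q * h = 0 -> q = 0.
  have [s _ es] := h2 _ J5; exact: (right_injective (isT : 5 != 0 :> int) (esym es)).
(* The partition of unity: 3 - i = (2 + i) (1 - i), and 1 - (3 - i) = -(2 - i). *)
have [e ee] := piI_surj (3%:Z, -1%:Z).
pose e' := 1 - e.
have ee' : piI e' = (-2%:Z, 1%:Z).
  transitivity (piI 1 - piI e); first exact: (rmorphB piI).
  by rewrite ee (_ : piI 1 = 1) //; exact: (rmorph1 piI).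
have me : e \in Pm false by rewrite unfold_in ee.
have me' : e' \in Pm true by rewrite unfold_in ee'.
pose T (x : (Pt false * Pt true)%type) (y : (Ro * Ro)%type) :=
  (pval x.1 : R) + pval x.2 = y.1 /\ (pval x.1 : R) * e' - (pval x.2 : R) * e = (y.2 : R) * h.
apply: (@iso_rel _ _ T).
- move=> r [p p'] [u v] [q q'] [u' v'] [h3 h4] [h5 h6]; split.
    apply: etrans (_ : r * ((pval p : R) + pval p') + ((pval q : R) + pval q') = _); last by rewrite h3 h5.
    by rewrite mulrDr addrACA.
  apply: etrans (_ : r * ((pval p : R) * e' - (pval p' : R) * e) + ((pval q : R) * e' - (pval q' : R) * e) = _).
    have G (S : pzRingType) (r0 a0 b0 c0 d0 x0 y0 : S) :
      (r0 * a0 + c0) * x0 - (r0 * b0 + d0) * y0 = r0 * (a0 * x0 - b0 * y0) + (c0 * x0 - d0 * y0).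
      by rewrite !mulrDl mulrBr !mulrA opprD addrACA.
    exact: (G (QG int) r (pval p) (pval p') (pval q) (pval q') e' e).
  rewrite h4 h6 mulrA; exact: esym (mulrDl (r * (v : R)) (v' : R) h).
- move=> [p p'].
  have m : J ((pval p : R) * e' - (pval p' : R) * e).
    have [H1 H2] : J ((pval p : R) * e') /\ J ((pval p' : R) * e).
      split; split.
      - exact: Pm_mulr (pvalP p).
      - exact: (rpredZ (pval p) me').
      - exact: (rpredZ (pval p') me).
      exact: Pm_mulr (pvalP p').
    exact: (lidealB hJ).
  by have [t _ et] := h2 _ m; exists ((pval p : R) + pval p', t).
- move=> [r t].
  have m1 : (r : R) * e + (t : R) * h \in Pm false.
    by apply: (rpredD (rpredZ r me)); have [] := hR t.
  have m2 : (r : R) * e' - (t : R) * h \in Pm true.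
    by apply: (rpredB (rpredZ r me')); have [] := hR t.
  exists (PT m1, PT m2); split.
    have G (S : pzRingType) (r0 e0 z : S) : r0 * e0 + z + (r0 * (1 - e0) - z) = r0.
      by rewrite addrACA subrr addr0 -mulrDr addrC subrK mulr1.
    exact: (G (QG int) r e (t * h)).
  have G (S : pzRingType) (r0 e0 z : S) : (r0 * e0 + z) * (1 - e0) - (r0 * (1 - e0) - z) * e0 = z.
    rewrite mulrDl mulrBl opprB -!mulrA; have -> : e0 * (1 - e0) = (1 - e0) * e0.
      by rewrite mulrBr mulrBl mulr1 mul1r.
    by rewrite addrC addrA subrK -mulrDr addrC subrK mulr1.
  exact: (G (QG int) r e (t * h)).
- move=> [r t] [h3 h4].
  have r0 : r = 0 by rewrite -[r]h3; exact: addr0.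
  have t0 : t = 0 by apply: hK; rewrite -[LHS]h4 !mul0r subrr.
  by rewrite r0 t0.
move=> [p p'] [h3 h4].
have pp : (pval p' : R) = - (pval p : R) by apply/eqP; rewrite -addr_eq0 addrC; apply/eqP; exact: h3.
have p0 : (pval p : R) = 0.
  move: h4; rewrite pp mulNr opprK -mulrDr subrK mulr1 => ->; exact: mul0r.
by congr pair; apply: val_inj; rewrite /= ?p0 // pp p0 oppr0.
Qed.

(** * An explicit stable isomorphism between the two modules *)

Definition polyX (S : pzRingType) (z : S) (l : seq int) : S := foldr (fun c t => c%:~R + z * t) 0 l.
Lemma polyX_morph (S S' : pzRingType) (f : {rmorphism S -> S'}) z l : f (polyX z l) = polyX (f z) l.
Proof. by elim: l => [|c l IH] /=; rewrite ?rmorph0 // rmorphD rmorphM rmorph_int IH. Qed.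

Definition el (l1 l2 : seq int) : R := (polyX (cycX int) l1, polyX (cycX int) l2).
Lemma elL l1 l2 : piL (el l1 l2) = (polyX ((-1) ^+ true * Lz) l1, polyX ((-1) ^+ true * Lz) l2).
Proof.
have E l : evL true (polyX (cycX int) l) = polyX ((-1) ^+ true * Lz) l.
  exact: etrans (polyX_morph (evL true) _ _) (congr1 (fun z => polyX z l) (evLX true)).
by apply: injective_projections; exact: E.
Qed.
Lemma elA l1 l2 : piA (el l1 l2) = (polyX ((-1) ^+ false * Lz) l1, polyX ((-1) ^+ false * Lz) l2).
Proof.
have E l : evL false (polyX (cycX int) l) = polyX ((-1) ^+ false * Lz) l.
  exact: etrans (polyX_morph (evL false) _ _) (congr1 (fun z => polyX z l) (evLX false)).
by apply: injective_projections; exact: E.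
Qed.
Lemma elI l1 l2 : piI (el l1 l2) = (polyX ((-1) ^+ true) l1, polyX ((-1) ^+ true) l2).
Proof.
have E l : evZ true (polyX (cycX int) l) = polyX ((-1) ^+ true) l.
  exact: etrans (polyX_morph (evZ true) _ _) (congr1 (fun z => polyX z l) (evZX true)).
by apply: injective_projections; exact: E.
Qed.
Lemma elS l1 l2 : piS (el l1 l2) = (polyX ((-1) ^+ false) l1, polyX ((-1) ^+ false) l2).
Proof.
have E l : evZ false (polyX (cycX int) l) = polyX ((-1) ^+ false) l.
  exact: etrans (polyX_morph (evZ false) _ _) (congr1 (fun z => polyX z l) (evZX false)).
by apply: injective_projections; exact: E.
Qed.

(* xa = - sqrt(-7) y and xb = 1 + (1 - x) y, where sqrt(-7) = 1 + 2 (z + z^2 + z^4) for z = -x; the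
   Bezout pair (xu, xv) was found by lattice reduction. *)
Definition xa : R := el [::] [:: -1; 2; -2; 0; -2].
Definition xb : R := el [:: 1] [:: 1; -1].
Definition xu : R := el [:: 0; 1; 0; 0; 0; 0; 1; 1; -1; 1; -1; -2; 0; 0]
  [:: 0; 0; 1; 1; 0; 0; 0; 0; 0; 0; 0; -1; -2; 0].
Definition xv : R := el [:: -2; -2; -1; -1; -1; 1; 1; 0; 0; 4; -1; 0; 1; -1]
  [:: -1; -3; -3; 2; 0; 0; 1; 0; -1; 1; 2; 3; -1; 0].
Definition xb' : R := el [:: 47; 38; 2; -32; -33; -2; 27; 18; 27; -2; -33; -32; 2; 38]
  [:: -9; 9; 36; 34; 1; -31; -29; 9; -9; 29; 31; -1; -34; -36].

Lemma x_bezout : xu * xa + xv * xb = 1.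
Proof.
have H (T : nzRingType) (f : {rmorphism R -> T}) u a v b : f xu = u -> f xa = a -> f xv = v -> f xb = b ->
    u * a + v * b = 1 -> f (xu * xa + xv * xb) = f 1.
  by move=> <- <- <- <- e; rewrite rmorph1 -e rmorphD !rmorphM.
apply: pi_inj.
- by apply: (H _ piL _ _ _ _ (elL _ _) (elL _ _) (elL _ _) (elL _ _)); apply/eqP; vm_compute.
- by apply: (H _ piI _ _ _ _ (elI _ _) (elI _ _) (elI _ _) (elI _ _)); apply/eqP; vm_compute.
- by apply: (H _ piA _ _ _ _ (elA _ _) (elA _ _) (elA _ _) (elA _ _)); apply/eqP; vm_compute.
by apply: (H _ piS _ _ _ _ (elS _ _) (elS _ _) (elS _ _) (elS _ _)); apply/eqP; vm_compute.
Qed.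

Lemma xb_norm : xb' * xb = (65 : int)%:~R.
Proof.
have H (T : nzRingType) (f : {rmorphism R -> T}) b' b : f xb' = b' -> f xb = b ->
    b' * b = (65 : int)%:~R -> f (xb' * xb) = f (65 : int)%:~R.
  by move=> <- <- e; rewrite rmorph_int -e rmorphM.
apply: pi_inj.
- by apply: (H _ piL _ _ (elL _ _) (elL _ _)); apply/eqP; vm_compute.
- by apply: (H _ piI _ _ (elI _ _) (elI _ _)); apply/eqP; vm_compute.
- by apply: (H _ piA _ _ (elA _ _) (elA _ _)); apply/eqP; vm_compute.
by apply: (H _ piS _ _ (elS _ _) (elS _ _)); apply/eqP; vm_compute.
Qed.

(** Its reduced norm 3 + c has norm 13, just like that of [xb] in [Lam]; so once [lam0_eq] places it
    in the kernel ideal, it generates the [Lam]-component. *)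
Definition lam0 : Lam := (1 + Lz, 1).
Definition sq7 : Lam := (- (1 + (Lz + Lz ^+ 2 + Lz ^+ 4) *+ 2), 0).
Lemma lam0_eq : lam0 * piL xa = sq7 * piL xb.
Proof. by rewrite !elL; apply/eqP; vm_compute. Qed.

Lemma F49_not_classA (s k : 'F_7) (f e : bool) :
  mul7 (mul7 (s, 0) (Zpow f)) (mul7 (k, 0) (mul7 (Zpow e) (1, 2))) != (2, 1).
Proof.
have C : all (fun s => all (fun k : 'F_7 => all (fun f => all (fun e =>
  mul7 (mul7 (s, 0) (Zpow f)) (mul7 (k, 0) (mul7 (Zpow e) (1, 2))) != (2, 1)) [:: true; false])
  [:: true; false]) [:: 0; 1; 2; 3; 4; 5; 6]) [:: 0; 1; 2; 3; 4; 5; 6] by vm_compute.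
have B (x : bool) : x \in [:: true; false] by case: x.
exact: (allP (allP (allP (allP C _ (F7_case s)) _ (F7_case k)) _ (B f)) _ (B e)).
Qed.

(** The functional given by [xa] and [xb] on P + R is unimodular. Mod 7 the generator is 2 + i and
    [xb] is 1 + 2i; their quotient is not a scalar times a power of i, so the kernel belongs to the
    second class, that of P'. *)
Lemma P_stably_iso : iso (Pt true * Ro)%type (Pt false * Ro)%type.
Proof.
have mu : xu \in Pm false by rewrite unfold_in elI; vm_compute.
pose pi (x : (Pt false * Ro)%type) : Ro := (pval x.1 : R) * xa + (x.2 : R) * xb.
have lp : lin pi.
  have G (S : pzRingType) (r a b c d x y : S) :
    (r * a + c) * x + (r * b + d) * y = r * (a * x + b * y) + (c * x + d * y).
    by rewrite !mulrDl mulrDr !mulrA addrACA.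
  by move=> r [p s] [p' s']; exact: (G (QG int) r (pval p) s (pval p') s' xa xb).
pose x1 : (Pt false * Ro)%type := (PT mu, xv).
have e1 : pi x1 = 1 := x_bezout.
have beE : (pi (0, 1) : R) = xb.
  have G (S : pzRingType) (a b : S) : 0 * a + 1 * b = b by rewrite mul0r mul1r add0r.
  exact: (G (QG int) xa xb).
have hn : xb' * (pi (0, 1) : R) = (65 : int)%:~R by rewrite beE; exact: xb_norm.
have cn : coprimez (65 : int) 14 by [].
have nb : KN (nr (piL (pi (0, 1)))) = 13 by rewrite beE elL; apply/eqP; vm_compute.
have nl0 : KN (nr lam0) = 13 by apply/eqP; vm_compute.
have be0 : KN (nr (piL (pi (0, 1)))) != 0 by rewrite nb.
have [l [Il Gl Nl]] := Iker_L (a_lin lp) (a_uni lp e1) be0.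
have [q Eq] : exists q, lam0 = q * l.
  have [p ep] := P_surjL false lam0; have [r er] := piL_surj (- sq7).
  have [t Et] := Gl _ (Iker_proj (a_lin lp) (a_uni lp e1) p r); exists t; rewrite -Et.
  have H (T : nzRingType) (f : {rmorphism R -> T}) (P A B U V r' : R) : A = P * V + 0 * U -> B = U ->
      f P * f V + f r' * f U = 0 -> f (P - (A + r' * B) * xu) = f P.
    move=> -> -> e; rewrite mul0r addr0 rmorphB rmorphM rmorphD !rmorphM e mul0r subr0.
    by [].
  rewrite -ep; apply: esym; apply: (H _ piL _ _ _ xb xa) => //.
  by rewrite /= ep er mulNr lam0_eq subrr.
have qu : q * (star q * DK (Kcof (nr q))) = 1.
  rewrite mulrA nr_star -DK_M Kcof_mul.
  suff -> : KN (nr q) = 1 by rewrite rmorph1 DK1.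
  have := congr1 (fun z => KN (nr z)) Eq; rewrite nrM KNM nl0 Nl nb.
  by move: (KN _) => t; lia.
have redbe : redZi (piI (pi (0, 1))) = redLam (piL (pi (0, 1))) by rewrite red_pi.
have cL : coprimez (KN (nr (piL (pi (0, 1))))) 14 by rewrite nb.
have [_ b7] := K_coprime14_red cL; rewrite redLam_nr -redbe in b7.
have N3 : ((redLam l).1 ^+ 2 + (redLam l).2 ^+ 2) ^+ 3 =
    ((redZi (piI (pi (0, 1)))).1 ^+ 2 + (redZi (piI (pi (0, 1)))).2 ^+ 2) ^+ 3.
  by rewrite redbe -!redLam_nr !redK_norm Nl.
have [[k [e E]]|[k [e E]]] := F49_classes b7 N3.
  exfalso.
  have Eb : redZi (piI (pi (0, 1))) = (1, 2) :> 'F_7 * 'F_7 by rewrite beE elI; apply/eqP; vm_compute.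
  have El : redLam lam0 = (2, 1) :> 'F_7 * 'F_7 by apply/eqP; vm_compute.
  have [s [f Es]] : exists (s : 'F_7) f, redLam q = mul7 (s, 0) (Zpow f).
    have E0 : redLam q = (redL q.1, redL q.2) by [].
    have [z|z] := Lam_unit qu; rewrite E0 z rmorph0.
      by exists (redL q.2), true; rewrite /mul7 /=; congr pair; ring.
    by exists (redL q.1), false; rewrite /mul7 /=; congr pair; ring.
  have Ze u : redZi (Zij ^+ e * u) = mul7 (Zpow e) (redZi u).
    by rewrite (rmorphM redZi) F49E; case: (e); rewrite ?expr1 // expr0 rmorph1.
  have H : redLam lam0 = mul7 (mul7 (s, 0) (Zpow f)) (mul7 (k%:~R, 0) (mul7 (Zpow e) (1, 2))).
    by rewrite Eq (rmorphM redLam) F49E Es E F49E F49_int Ze Eb.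
  by have := F49_not_classA s k%:~R f e; rewrite -H El eqxx.
apply: Ker_iso; apply: (Ker_class lp e1 hn cn (w := 5) (nu := rho false * rho false * piI (pi (0, 1))) Il Gl) => //.
  have E5 : rho true * rho false = 5%:~R by rewrite Zi_int ZiE.
  by rewrite !mulrA E5.
by exists k, e; rewrite -E (rmorphM redLam) (rmorph_int redLam).
Qed.

(** * The group basis of the group ring *)

Notation U := ('I_14 * bool)%type.
(** The group law on normal forms x^i y^b: y inverts the power of x it passes, and y y contributes
    x^7. *)
Definition opU (u v : U) : U :=
  (u.1 + (if u.2 then - v.1 else v.1) + (if u.2 && v.2 then 7%:R else 0), u.2 (+) v.2).
Definition del (i : 'I_14) : cyc int := [ffun k => (k == i)%:R].
Definition bas (u : U) : R := if u.2 then (0, del u.1) else (del u.1, 0).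
Definition coef (r : R) (u : U) : int := if u.2 then r.2 u.1 else r.1 u.1.

Lemma delM i j : del i * del j = del (i + j).
Proof.
apply/ffunP=> k; rewrite !ffunE (bigD1 i) //= big1 ?addr0.
  by rewrite !ffunE eqxx mul1r subr_eq addrC.
by move=> l /negPf li; rewrite ffunE li mul0r.
Qed.
Lemma del_conj i : inv_conj (cycD int) (del i) = del (- i).
Proof. by apply/ffunP=> k; rewrite !ffunE eqr_oppLR. Qed.
Lemma del7 : inv_sq (cycD int) = del 7%:R.
Proof. exact: cycXn. Qed.
Lemma bas_op u v : bas (opU u v) = bas u * bas v.
Proof.
have c0 : inv_conj (cycD int) 0 = 0 by exact: (rmorph0 (@cyc_conj int)).
rewrite twE; case: u v => [i []] [j []]; apply: injective_projections; rewrite /opU /bas;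
  rewrite ?[(_, _).1]/= ?[(_, _).2]/= ?del7 ?c0 ?del_conj ?mulr0 ?mul0r ?add0r ?addr0 ?mul0r ?delM ?addr0 //=.
by rewrite (del7 : cycX int ^+ 7 = _) delM.
Qed.
Lemma bas0 : bas (0, false) = 1.
Proof. by []. Qed.

Lemma coefD r s u : coef (r + s) u = coef r u + coef s u.
Proof. by case: u => i []; rewrite /coef /= ffunE. Qed.
Lemma coef_bas u v : coef (bas u) v = (u == v)%:R.
Proof.
case: u v => [i []] [j []]; rewrite /coef /bas /= xpair_eqE ?andbF ?andbT ?ffunE // eq_sym //.
Qed.
Lemma coef_inj r s : (forall u, coef r u = coef s u) -> r = s.
Proof.
move=> h; apply: injective_projections; apply/ffunP=> i.
  exact: (h (i, false)).
exact: (h (i, true)).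
Qed.
Lemma coef_sum (I : finType) (F : I -> R) u : coef (\sum_i F i) u = \sum_i coef (F i) u.
Proof.
apply: (big_morph (fun r => coef r u)) => [r s|]; first exact: coefD.
by case: u => i []; rewrite /coef /= ffunE.
Qed.
Lemma coefMz r (n : int) u : coef (r *~ n) u = coef r u * n.
Proof.
have h0 s : coef (- s) u = - coef s u by case: u => i []; rewrite /coef /= ffunE.
have hn (k : nat) : coef (r *+ k) u = coef r u * k%:Z.
  elim: k => [|k IH]; first by rewrite mulr0; case: u {h0} => i []; rewrite /coef /= ffunE.
  by rewrite mulrS coefD IH; move: (coef r u) => t; lia.
case: n => k; first exact: hn.
by rewrite NegzE mulrNz h0 -pmulrn hn mulrN.
Qed.
Lemma bas_sum r : r = \sum_u bas u *~ coef r u.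
Proof.
apply: coef_inj => v; rewrite coef_sum (bigD1 v) //= big1 ?addr0.
  by rewrite coefMz coef_bas eqxx mul1r.
by move=> u /negPf uv; rewrite coefMz coef_bas uv mul0r.
Qed.
Lemma R_ext (V : zmodType) (F F' : R -> V) : {morph F : r s / r + s} -> {morph F' : r s / r + s} ->
  (forall u, F (bas u) = F' (bas u)) -> forall r, F r = F' r.
Proof.
have Z (f : R -> V) : {morph f : r s / r + s} -> f 0 = 0.
  by move=> fD; apply: (addrI (f 0)); rewrite -fD !addr0.
have N (f : R -> V) : {morph f : r s / r + s} -> {morph f : r s / r - s}.
  move=> fD r s; apply: (addIr (f s)); rewrite -fD !subrK //.
have M (f : R -> V) (fD : {morph f : r s / r + s}) r (n : int) : f (r *~ n) = f r *~ n.
  have fN := N f fD; pose m := GRing.isZmodMorphism.Build R V f fN.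
  pose g : {additive R -> V} := HB.pack f m; exact: (raddfMz g).
move=> FD FD' h r; rewrite (bas_sum r).
rewrite (big_morph F FD (Z F FD)) (big_morph F' FD' (Z F' FD')).
by apply: eq_bigr => u _; rewrite !M // h.
Qed.

(** The automorphism x -> x, y -> xy on normal forms; [tauR] is its linear extension. *)
Definition tauU (u : U) : U := (if u.2 then u.1 + 1 else u.1, u.2).
Lemma tauU_op u v : tauU (opU u v) = opU (tauU u) (tauU v).
Proof.
case: u v => [i []] [j []]; rewrite /tauU /opU /= //; congr pair.
- by congr (_ + _); rewrite opprD addrACA subrr addr0.
- by rewrite !addr0 addrAC.
by rewrite !addr0 addrA.
Qed.
Definition tauR (r : R) : R := (r.1, del 1 * r.2).
Definition tauR' (r : R) : R := (r.1, del (-1) * r.2).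
Lemma tauRK : cancel tauR tauR'.
Proof. by case=> a b; rewrite /tauR /tauR' /= mulrA delM addNr mul1r. Qed.
Lemma tauR'K : cancel tauR' tauR.
Proof. by case=> a b; rewrite /tauR /tauR' /= mulrA delM addrN mul1r. Qed.
Lemma tauRD : {morph tauR : r s / r + s}.
Proof. by move=> [a b] [c d]; rewrite /tauR /= mulrDr. Qed.
Lemma tauR_bas u : tauR (bas u) = bas (tauU u).
Proof. by case: u => i []; rewrite /tauR /bas /= ?mulr0 // delM addrC. Qed.
Lemma tauRM r s : tauR (r * s) = tauR r * tauR s.
Proof.
rewrite !twE /tauR /= rmorphM /= del_conj; congr pair; first congr (_ + _).
  have -> : del 1 * r.2 * (del (-1) * cyc_conj s.2) = (del 1 * del (-1)) * (r.2 * cyc_conj s.2) by ring.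
  by rewrite delM addrN mul1r.
by ring.
Qed.
(** At x = -1 the automorphism sends y to -y, which is complex conjugation on Z[i] and exchanges the
    primes over 5. *)
Lemma tauR_Pm (r : R) b : (tauR r \in Pm b) = (r \in Pm (~~ b)).
Proof.
have d1 : evZ true (del 1) = -1 by exact: evZX.
rewrite !unfold_in /= rmorphM /= d1 mulN1r.
by case: b; rewrite /kk /= mulrN -mulNr.
Qed.

(** * Lattices as modules *)

(** A copy of the column space indexed by f, able to carry the R-module structure that f defines. *)
Definition actV n (f : {rmorphism R -> 'M[int]_n}) := 'cV[int]_n.
Section ActV.
Variables (n : nat) (f : {rmorphism R -> 'M[int]_n}).
HB.instance Definition _ := GRing.Zmodule.copy (actV f) 'cV[int]_n.
Definition act_scale (r : R) (v : actV f) : actV f := f r *m v.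
Fact act_scaleA a b v : act_scale a (act_scale b v) = act_scale (a * b) v.
Proof. by rewrite /act_scale mulmxA (rmorphM f). Qed.
Fact act_scale1 : left_id 1 act_scale.
Proof. by move=> v; rewrite /act_scale (rmorph1 f) mul1mx. Qed.
Fact act_scaleDr : right_distributive act_scale +%R.
Proof. by move=> a u v; rewrite /act_scale mulmxDr. Qed.
Fact act_scaleDl v : {morph act_scale^~ v : a b / a + b}.
Proof. by move=> a b; rewrite /act_scale (rmorphD f) mulmxDl. Qed.
HB.instance Definition _ := GRing.Zmodule_isLmodule.Build R (actV f)
  act_scaleA act_scale1 act_scaleDr act_scaleDl.
End ActV.
Lemma act_scaleE n (f : {rmorphism R -> 'M[int]_n}) (r : R) (v : actV f) : r *: v = f r *m (v : 'cV_n).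
Proof. by []. Qed.

Lemma mx_ext m n (A B : 'M[int]_(m, n)) : (forall v : 'cV_n, A *m v = B *m v) -> A = B.
Proof.
move=> h; apply/matrixP=> i j; have := h (delta_mx j 0).
by rewrite -!colE => /colP/(_ i); rewrite !mxE.
Qed.

Lemma additive_mx m n (f : 'cV[int]_n -> 'cV[int]_m) : {morph f : u v / u + v} ->
  exists A : 'M[int]_(m, n), forall v, f v = A *m v.
Proof.
move=> fD; have f0 : f 0 = 0 by apply: (addrI (f 0)); rewrite -fD !addr0.
have fN : {morph f : u v / u - v} by move=> u v; apply: (addIr (f v)); rewrite -fD !subrK.
pose mm := GRing.isZmodMorphism.Build 'cV[int]_n 'cV[int]_m f fN.
pose g : {additive 'cV[int]_n -> 'cV[int]_m} := HB.pack f mm.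
have fZ (c : int) v : f (c *: v) = c *: f v.
  rewrite -[c in LHS]intz scaler_int -[c in RHS]intz scaler_int; exact: (raddfMz g).
exists (\matrix_(i, j) f (delta_mx j 0) i 0) => v.
rewrite {1}(matrix_sum_delta v) (big_morph f fD f0); apply/colP=> i.
rewrite summxE mxE; apply: eq_bigr => j _.
by rewrite big_ord1 fZ !mxE mulrC.
Qed.

(** * Lattices over the group and modules over its group ring *)

Section Q28.
Variables (gT : finGroupType) (G : {group gT}) (x y : gT).
Hypothesis HG : (G :=: <<[set x; y]>>)%g.
Hypothesis h7 : (x ^+ 7 = y ^+ 2)%g.
Hypothesis hyx : (y * x * y^-1 = x^-1)%g.
Hypothesis cG : #|G| = 28.

Lemma xG : x \in G.
Proof. by rewrite HG mem_gen ?set21. Qed.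
Lemma yG : y \in G.
Proof. by rewrite HG mem_gen ?set22. Qed.

Lemma x14 : (x ^+ 14 = 1)%g.
Proof.
have E : ((x ^+ 7) ^ y^-1 = x ^- 7)%g by rewrite conjXg /conjg invgK mulgA hyx expgVn.
have E2 : ((x ^+ 7) ^ y^-1 = x ^+ 7)%g.
  by rewrite h7 /conjg invgK mulgA -expgS expgSr mulgK.
by rewrite -[14%N]/(7 + 7)%N expgD -{1}E2 E mulVg.
Qed.

Lemma x_ord (i j : 'I_14) : (x ^+ (i + j)%R = x ^+ i * x ^+ j)%g.
Proof. by rewrite -expgD /= -(expg_mod _ x14) modn_mod expg_mod // x14. Qed.
Lemma x_opp (i : 'I_14) : (x ^+ (- i)%R = x ^- i)%g.
Proof. by apply/eqP; rewrite eq_sym eq_invg_mul -x_ord addrN. Qed.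
Lemma yx (i : 'I_14) : (y * x ^+ i = x ^+ (- i)%R * y)%g.
Proof.
have E : ((x ^+ i) ^ y^-1 = x ^- i)%g by rewrite conjXg /conjg invgK mulgA hyx expgVn.
by rewrite x_opp -E /conjg invgK mulgA mulgKV.
Qed.

Definition phi (u : U) : gT := (x ^+ u.1 * y ^+ u.2)%g.
Lemma phi_op u v : phi (opU u v) = (phi u * phi v)%g.
Proof.
have p1 (k : 'I_14) : phi (k, true) = (x ^+ k * y)%g by [].
have p0 (k : 'I_14) : phi (k, false) = (x ^+ k)%g by rewrite /phi mulg1.
have x7 : (x ^+ (7%:R : 'I_14) = y * y)%g by exact: h7.
case: u v => [i []] [j []].
- rewrite -[opU _ _]/(i - j + 7%:R, false) p0 !p1 (x_ord (i - j)) (x_ord i) x7.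
  by rewrite -[RHS]mulgA [(y * _)%g in RHS]mulgA yx !mulgA.
- rewrite -[opU _ _]/(i - j + 0, true) addr0 !p1 p0 x_ord -[RHS]mulgA yx mulgA.
  by [].
- by rewrite -[opU _ _]/(i + j + 0, true) addr0 !p1 p0 x_ord mulgA.
by rewrite -[opU _ _]/(i + j + 0, false) addr0 !p0 x_ord.
Qed.
Lemma phi0 : phi (0, false) = 1%g.
Proof. by rewrite /phi /= mulg1. Qed.

Fact phi_group : group_set [set phi u | u : U].
Proof.
apply/group_setP; split; first by apply/imsetP; exists (0, false); rewrite // phi0.
move=> _ _ /imsetP[u _ ->] /imsetP[v _ ->]; apply/imsetP; exists (opU u v); rewrite // phi_op.
by [].
Qed.
Lemma phiG u : phi u \in G.
Proof. by rewrite groupM ?groupX ?xG ?yG. Qed.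
Lemma phi_imset : [set phi u | u : U] = G :> {set gT}.
Proof.
apply/eqP; rewrite eqEsubset; apply/andP; split.
  by apply/subsetP=> _ /imsetP[u _ ->]; exact: phiG.
have gs : (<<[set x; y]>>%g \subset [set phi u | u : U]) = ([set x; y] \subset [set phi u | u : U]).
  exact: (gen_subG [set x; y] (Group phi_group)).
rewrite HG gs.
apply/subsetP=> g; rewrite !inE => /orP[] /eqP ->; apply/imsetP.
  by exists (1, false); rewrite // /phi /= mulg1.
by exists (0, true); rewrite // /phi /= mul1g.
Qed.
Lemma phi_surj g : g \in G -> exists u, phi u = g.
Proof. by rewrite -phi_imset => /imsetP[u _ ->]; exists u. Qed.
Lemma phi_inj : injective phi.
Proof.
have /imset_injP h : #|[set phi u | u in [set: U]]| == #|[set: U]|.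
  have -> : [set phi u | u in [set: U]] = G :> {set gT}.
    by rewrite -phi_imset; apply/setP=> g; apply/imsetP/imsetP => -[u _ ->]; exists u.
  by rewrite cG cardsT card_prod card_ord card_bool.
by move=> u v; apply: h; rewrite inE.
Qed.

Section Rep.
Variables (M : lattice gT).
Hypothesis hM : is_rep G M.
Definition Phi & is_rep G M := fun r : R => (\sum_u lrep M (phi u) *~ coef r u : 'M[int]_(ldim M)).
Fact Phi_additive : {morph Phi hM : r s / r - s}.
Proof.
have D : {morph Phi hM : r s / r + s}.
  by move=> r s; rewrite /Phi -big_split /=; apply: eq_bigr => u _; rewrite coefD mulrzDr.
by move=> r s; apply: (addIr (Phi hM s)); rewrite -D !subrK.
Qed.
Lemma PhiD : {morph Phi hM : r s / r + s}.
Proof.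
by move=> r s; rewrite /Phi -big_split /=; apply: eq_bigr => u _; rewrite coefD mulrzDr.
Qed.
Lemma Phi_bas u : Phi hM (bas u) = lrep M (phi u).
Proof.
rewrite /Phi (bigD1 u) //= big1 ?addr0; first by rewrite coef_bas eqxx.
by move=> v vu; rewrite coef_bas eq_sym (negPf vu).
Qed.
Fact Phi_multiplicative : monoid_morphism (Phi hM).
Proof.
have [h1 hm] := hM; split; first by rewrite -bas0 Phi_bas phi0 h1.
move=> r s; move: r.
apply: R_ext.
- by move=> a b; rewrite mulrDl PhiD.
- by move=> a b; rewrite PhiD mulrDl.
move=> u; move: s; apply: R_ext.
- by move=> a b; rewrite mulrDr PhiD.
- by move=> a b; rewrite PhiD mulrDr.
by move=> v; rewrite -bas_op !Phi_bas phi_op hm ?phiG.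
Qed.
HB.instance Definition _ := GRing.isZmodMorphism.Build R 'M[int]_(ldim M) (Phi hM) Phi_additive.
HB.instance Definition _ := GRing.isMonoidMorphism.Build R 'M[int]_(ldim M) (Phi hM) Phi_multiplicative.
Definition lmodM : lmodType R := actV (Phi hM).
End Rep.

Lemma intertwine (M N : lattice gT) (hM : is_rep G M) (hN : is_rep G N) (A : 'M[int]_(ldim N, ldim M)) :
  {in G, forall g, A *m lrep M g = lrep N g *m A} -> forall r, A *m Phi hM r = Phi hN r *m A.
Proof.
move=> h; apply: R_ext.
- by move=> a b; rewrite PhiD mulmxDr.
- by move=> a b; rewrite PhiD mulmxDl.
by move=> u; rewrite !Phi_bas h ?phiG.
Qed.

Lemma lat_isoP (M N : lattice gT) (hM : is_rep G M) (hN : is_rep G N) :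
  lat_iso G M N <-> iso (lmodM hM) (lmodM hN).
Proof.
split=> [[A [B [AB BA h]]]|[f [g [lf lg fK gK]]]].
  have hB : {in G, forall g, B *m lrep N g = lrep M g *m B}.
    move=> g Gg; rewrite -[lrep N g]mulmx1 -AB (mulmxA (lrep N g)) -h // !mulmxA BA mul1mx.
    by [].
  exists (fun v => A *m v), (fun v => B *m v); split.
  - by move=> r u v; rewrite !act_scaleE mulmxDr !mulmxA (intertwine hM hN h).
  - by move=> r u v; rewrite !act_scaleE mulmxDr !mulmxA (intertwine hN hM hB).
  - by move=> v; rewrite mulmxA BA mul1mx.
  by move=> v; rewrite mulmxA AB mul1mx.
have [A EA] : exists A : 'M[int]_(ldim N, ldim M), forall v, f v = A *m v by apply: additive_mx; exact: linD lf.
have [B EB] : exists B : 'M[int]_(ldim M, ldim N), forall v, g v = B *m v by apply: additive_mx; exact: linD lg.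
exists A, B; split.
- by apply: mx_ext => v; rewrite -mulmxA -EB -EA gK mul1mx.
- by apply: mx_ext => v; rewrite -mulmxA -EA -EB fK mul1mx.
move=> k Gk; have [u <-] := phi_surj Gk; apply: mx_ext => v.
rewrite -!mulmxA -(Phi_bas hM) -(Phi_bas hN) -!EA; exact: (linZ lf (bas u) v).
Qed.

Lemma lin_inv (V W : lmodType R) (f : V -> W) g : lin f -> cancel f g -> cancel g f -> lin g.
Proof. by move=> lf fK gK r u v; rewrite -{1}(gK u) -{1}(gK v) -lf fK. Qed.

Lemma rep_dsum M N : is_rep G M -> is_rep G N -> is_rep G (dsum M N).
Proof.
move=> [m1 mm] [n1 nm]; split; first by rewrite /= m1 n1 -scalar_mx_block.
by move=> g h Gg Gh; rewrite /= mulmx_block !mulmx0 !mul0mx !addr0 add0r mm // nm.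
Qed.

Lemma iso_dsum M N (hM : is_rep G M) (hN : is_rep G N) (h : is_rep G (dsum M N)) :
  iso (lmodM h) (lmodM hM * lmodM hN)%type.
Proof.
pose f (v : lmodM h) : (lmodM hM * lmodM hN)%type :=
  (usubmx (v : 'cV_(ldim M + ldim N)), dsubmx (v : 'cV_(ldim M + ldim N))).
pose g (p : (lmodM hM * lmodM hN)%type) : lmodM h := col_mx p.1 p.2.
have fK : cancel f g by move=> v; exact: vsubmxK.
have gK : cancel g f by case=> u v; rewrite /f /g /= col_mxKu col_mxKd.
have hu (v : 'cV[int]_(ldim M + ldim N)) : usubmx v = row_mx 1%:M 0 *m v.
  by rewrite -{2}[v]vsubmxK mul_row_col mul1mx mul0mx addr0.
have hd (v : 'cV[int]_(ldim M + ldim N)) : dsubmx v = row_mx 0 1%:M *m v.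
  by rewrite -{2}[v]vsubmxK mul_row_col mul1mx mul0mx add0r.
have iu := intertwine h hM (A := row_mx 1%:M 0).
have id' := intertwine h hN (A := row_mx 0 1%:M).
have lf : lin f.
  move=> r u v; rewrite /f; apply: injective_projections.
    rewrite /= hu mulmxDr !mulmxA iu -?mulmxA -?hu //.
    by move=> k _; rewrite /= mul_row_block mul_mx_row !mul1mx !mul0mx !mulmx1 !mulmx0 !addr0.
  rewrite /= hd mulmxDr !mulmxA id' -?mulmxA -?hd //.
  by move=> k _; rewrite /= mul_row_block mul_mx_row !mul1mx !mul0mx !mulmx1 !mulmx0 !add0r.
by exists f, g; split=> //; exact: lin_inv lf fK gK.
Qed.

Let rk (g : gT) : 'I_#|G| := enum_rank_in (group1 G) g.
Let rkK g : g \in G -> enum_val (rk g) = g.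
Proof. exact: enum_rankK_in. Qed.
Let val_rk (i : 'I_#|G|) : rk (enum_val i) = i.
Proof. exact: enum_valK_in. Qed.
Let reg_sum (F : gT -> int) (h : gT) : h \in G ->
  \sum_(k < #|G|) F (enum_val k) * (enum_val k == h)%:R = F h.
Proof.
move=> Gh; rewrite (bigD1 (rk h)) //= big1 => [|k kh]; first by rewrite rkK // eqxx mulr1 addr0.
by rewrite (_ : (enum_val k == h) = false) ?mulr0 //; apply: contraNF kh => /eqP <-; rewrite val_rk.
Qed.

Lemma rep_reg : is_rep G (reg_lat G).
Proof.
split=> [|g h Gg Gh]; apply/matrixP=> i j; rewrite !mxE.
  by rewrite mul1g (inj_eq enum_val_inj).
transitivity (\sum_(k < #|G|) ((enum_val i == g * enum_val k)%g%:R * (enum_val k == h * enum_val j)%g%:R : int)).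
  by rewrite (reg_sum (fun z => (enum_val i == g * z)%g%:R)) ?groupM ?enum_valP // mulgA.
by apply: eq_bigr => k _; rewrite !mxE.
Qed.

Lemma iso_reg (h : is_rep G (reg_lat G)) : iso (lmodM h) Ro.
Proof.
pose e1 : 'cV[int]_#|G| := \col_i (enum_val i == 1%g)%:R.
pose f (r : Ro) : lmodM h := Phi h r *m e1.
pose g (v : lmodM h) : Ro :=
  ([ffun i => (v : 'cV_#|G|) (rk (phi (i, false))) 0], [ffun i => (v : 'cV_#|G|) (rk (phi (i, true))) 0]).
have cg v u : coef (g v) u = (v : 'cV_#|G|) (rk (phi u)) 0.
  by case: u => i []; rewrite /coef /= ffunE.
have fE (r : R) i : (f r : 'cV_#|G|) i 0 = \sum_u coef r u * (enum_val i == phi u)%:R.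
  move: r; apply: R_ext.
  - by move=> a b; rewrite /f PhiD mulmxDl mxE.
  - by move=> a b; rewrite -big_split; apply: eq_bigr => u _; rewrite coefD mulrDl.
  move=> u; rewrite /f Phi_bas (bigD1 u) //= coef_bas eqxx mul1r big1 ?addr0 => [|w wu].
    rewrite mxE; transitivity (\sum_(k < #|G|) ((enum_val i == phi u * enum_val k)%g%:R * (enum_val k == 1%g)%:R : int)).
      by apply: eq_bigr => k _; rewrite !mxE.
    by rewrite (reg_sum (fun z => (enum_val i == phi u * z)%g%:R)) ?group1 // mulg1.
  by rewrite coef_bas eq_sym (negPf wu) mul0r.
have fK : cancel f g.
  move=> r; apply: coef_inj => u; rewrite cg fE rkK ?phiG // (bigD1 u) //= eqxx mulr1.
  rewrite big1 ?addr0 // => w wu; rewrite (inj_eq phi_inj) eq_sym (negPf wu); exact: mulr0.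
have gK : cancel g f.
  move=> v; apply/colP=> i; rewrite fE; have [u eu] := phi_surj (enum_valP i).
  rewrite (bigD1 u) //= cg -eu eqxx mulr1 eu val_rk big1 ?addr0 // => w wu.
  by rewrite -eu (inj_eq phi_inj) eq_sym (negPf wu) mulr0.
apply: iso_sym; exists f, g; have lf : lin f.
  move=> r u v.
  have M : Phi h ((r : R) * u) = Phi h r *m Phi h u := rmorphM (Phi h) r u.
  transitivity (Phi h ((r : R) * u) *m e1 + Phi h v *m e1); last by rewrite M -mulmxA.
  rewrite -mulmxDl; congr (_ *m _); exact: (PhiD h ((r : R) * u) v).
by split=> //; exact: lin_inv lf fK gK.
Qed.

Section LatOf.
Variables (V : lmodType R) (n : nat) (c : V -> 'cV[int]_n) (d : 'cV[int]_n -> V).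
Hypothesis cD : {morph c : u v / u + v}.
Hypothesis cK : cancel c d.
Hypothesis dK : cancel d c.
Let dD : {morph d : u v / u + v}.
Proof. by move=> u v; apply: (can_inj cK); rewrite cD !dK. Qed.

Lemma action_mx (r : R) : exists A : 'M[int]_n, forall v, c (r *: d v) = A *m v.
Proof. by apply: additive_mx => u v; rewrite dD scalerDr cD. Qed.
Definition amx (r : R) := proj1_sig (constructive_indefinite_description _ (action_mx r)).
Lemma amxP r v : c (r *: d v) = amx r *m v.
Proof. by rewrite /amx; case: constructive_indefinite_description. Qed.
(** Any R-module with additive coordinates in Z^n is a lattice; outside G the matrix takes the
    default value 1. *)
Definition latOf : lattice gT :=
  @Lat gT n (fun g => if [pick u | phi u == g] is Some u then amx (bas u) else 1%:M).
Lemma latOf_phi u : lrep latOf (phi u) = amx (bas u).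
Proof. by rewrite /=; case: pickP => [w /eqP/phi_inj -> //|/(_ u)]; rewrite eqxx. Qed.
Lemma rep_latOf : is_rep G latOf.
Proof.
split.
  rewrite -phi0 latOf_phi bas0; apply: mx_ext => v.
  by rewrite -amxP scale1r dK mul1mx.
move=> _ _ /phi_surj[u <-] /phi_surj[w <-]; rewrite -phi_op !latOf_phi bas_op.
by apply: mx_ext => v; rewrite -mulmxA -!amxP cK scalerA.
Qed.
Lemma iso_latOf (h : is_rep G latOf) : iso (lmodM h) V.
Proof.
exists d, c; have ld : @lin (lmodM h) V d.
  move=> r u v; rewrite dD; congr (_ + _); move: r; apply: R_ext.
  - by move=> a b; rewrite scalerDl dD.
  - by move=> a b; rewrite scalerDl.
  move=> w; have E : (bas w *: u : lmodM h) = amx (bas w) *m (u : 'cV_n) :> 'cV_n.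
    by rewrite -latOf_phi -(Phi_bas h).
  by rewrite E -amxP cK.
by split=> //; exact: (@lin_inv (lmodM h) V d c ld dK cK).
Qed.
End LatOf.

(** Elements outside G are fixed, as membership in [Aut G] demands of a permutation of the ambient
    type. *)
Definition thetaf (g : gT) : gT := if [pick u | phi u == g] is Some u then phi (tauU u) else g.
Lemma thetaf_phi u : thetaf (phi u) = phi (tauU u).
Proof. by rewrite /thetaf; case: pickP => [w /eqP/phi_inj -> //|/(_ u)]; rewrite eqxx. Qed.
Lemma thetaf_notin g : g \notin G -> thetaf g = g.
Proof. by rewrite /thetaf => Gg; case: pickP => // u /eqP e; case/negP: Gg; rewrite -e phiG. Qed.
Lemma thetaf_inj : injective thetaf.
Proof.
have tI : injective tauU.
  by move=> [i b] [j c] [e1 e2]; move: e1; rewrite e2; case: c {e2} => [/addIr|] ->.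
move=> g h; have [/phi_surj[u <-]|Gg] := boolP (g \in G); have [/phi_surj[w <-]|Gh] := boolP (h \in G).
- by rewrite !thetaf_phi => /phi_inj/tI ->.
- by rewrite thetaf_phi (thetaf_notin Gh) => e; case/negP: Gh; rewrite -e phiG.
- by rewrite thetaf_phi (thetaf_notin Gg) => e; case/negP: Gg; rewrite e phiG.
by rewrite !thetaf_notin.
Qed.
Definition theta : {perm gT} := perm thetaf_inj.
Lemma theta_Aut : theta \in Aut G.
Proof.
rewrite inE; apply/andP; split.
  by apply/subsetP=> g; rewrite inE permE; apply: contraR => /thetaf_notin ->.
apply/morphicP=> _ _ /phi_surj[u <-] /phi_surj[w <-].
by rewrite !permE -phi_op !thetaf_phi tauU_op phi_op.
Qed.

Lemma rep_twist th M : th \in Aut G -> is_rep G M -> is_rep G (twist th M).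
Proof.
move=> hth [m1 mm]; have mth := Aut_morphic hth.
have th1 : th 1%g = 1%g by rewrite -(autmE hth) morph1.
have thG g : g \in G -> th g \in G by move=> Gg; rewrite Aut_closed.
split=> [|g h Gg Gh] /=; first by rewrite th1 m1.
by rewrite (morphicP mth) // mm ?thG.
Qed.

Lemma lat_iso_refl M : lat_iso G M M.
Proof. by exists 1%:M, 1%:M; split=> [||g _]; rewrite ?mulmx1 ?mul1mx. Qed.

Section Coordinates.
Variable b : bool.
(* The coordinate of 1 is traded for a fifth of the value of the congruence defining [Pm b]. *)
Let ev (r : R) : int := (piI r).1 - kk b * (piI r).2.
Let evD r s : ev (r + s) = ev r + ev s.
Proof.
have E : piI (r + s) = piI r + piI s by exact: (rmorphD piI).
by rewrite /ev E /=; ring.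
Qed.
Let ev_int (n : int) : ev n%:~R = n.
Proof.
have E : piI n%:~R = (n, 0) by exact: etrans (rmorph_int piI n) (Zi_int n).
by rewrite /ev E /=; ring.
Qed.
Let co (r : R) : int := r.1 0.
Let coD r s : co (r + s) = co r + co s.
Proof. by rewrite /co /= ffunE. Qed.
Let co_int (n : int) : co n%:~R = n.
Proof.
have -> : n%:~R = bas (0, false) *~ n :> R by rewrite bas0.
by rewrite -[co _]/(coef _ (0, false)) coefMz coef_bas eqxx mul1r.
Qed.
Let sP (p : Pt b) : R := (pval p : R) + ((ev (pval p) %/ 5)%Z - co (pval p))%:~R.
Let tR (w : R) : R := w + (co w * 5 - ev w)%:~R.
Let tR_mem w : tR w \in Pm b.
Proof.
rewrite unfold_in -/(ev (tR w)) /tR evD ev_int addrCA subrr addr0.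
exact: dvdz_mull.
Qed.
Let tP w : Pt b := PT (tR_mem w).
Let evP (p : Pt b) : (ev (pval p) %/ 5)%Z * 5 = ev (pval p).
Proof. by apply: divzK; have := pvalP p; rewrite unfold_in. Qed.
Let sK : cancel sP tP.
Proof.
move=> p; apply: val_inj; rewrite /= /tR /sP evD coD ev_int co_int -addrA -rmorphD /=.
have -> : (ev (pval p) %/ 5)%Z - co (pval p) + ((co (pval p) + ((ev (pval p) %/ 5)%Z - co (pval p))) * 5
   - (ev (pval p) + ((ev (pval p) %/ 5)%Z - co (pval p)))) = 0.
  by have := evP p; move: (ev _) (co _) (_ %/ _)%Z => e c k h; lia.
exact: addr0.
Qed.
Let tK : cancel tP sP.
Proof.
move=> w; rewrite /sP /= {2 3}/tR evD coD ev_int co_int /tR -addrA -rmorphD /=.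
have -> : (ev w + (co w * 5 - ev w)) = co w * 5 by ring.
rewrite mulzK // (_ : _ + _ = 0) ?addr0 //; ring.
Qed.
Let sD : {morph sP : p q / p + q}.
Proof.
move=> p q; apply: (can_inj (g := fun z => z)) => //; rewrite /sP.
have E : (ev (pval (p + q)) %/ 5)%Z = (ev (pval p) %/ 5)%Z + (ev (pval q) %/ 5)%Z.
  rewrite -[pval (p + q)]/((pval p : R) + pval q) evD -(evP p) -(evP q) -mulrDl.
  by rewrite !mulzK.
rewrite E -[pval (p + q)]/((pval p : R) + pval q) coD opprD addrACA rmorphD addrACA.
by [].
Qed.
Let c (p : Pt b) : 'cV[int]_(14 + 14) := (vecQ (sP p))^T.
Let d (v : 'cV[int]_(14 + 14)) : Pt b := tP (unvecQ v^T).
Lemma P_coord : exists (c : Pt b -> 'cV[int]_(14 + 14)) d,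
  [/\ {morph c : p q / p + q}, cancel c d & cancel d c].
Proof.
exists c, d; split.
- by move=> p q; rewrite /c sD vecQD linearD.
- by move=> p; rewrite /c /d trmxK vecQK sK.
by move=> v; rewrite /c /d tK unvecQK trmxK.
Qed.
End Coordinates.

Lemma P_lattice b : exists P : lattice gT, exists h : is_rep G P, ldim P = 28 /\ iso (lmodM h) (Pt b).
Proof.
have [c [d [cD cK dK]]] := P_coord b.
exists (latOf cD cK dK), (rep_latOf cD cK dK); split=> //.
exact: iso_latOf.
Qed.

(** Twisting by [theta] is restriction of scalars along [tauR], and [tauR] carries P' onto P. *)
Lemma twist_P M (h : is_rep G M) (h' : is_rep G (twist theta M)) :
  iso (lmodM h) (Pt false) -> iso (lmodM h') (Pt true).
Proof.
move=> [f [g [lf lg fK gK]]].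
have PhiT r : Phi h' r = Phi h (tauR r).
  move: r; apply: R_ext; first exact: PhiD.
    by move=> a b; rewrite tauRD PhiD.
  by move=> u; rewrite tauR_bas !Phi_bas /= permE thetaf_phi.
pose T (v : lmodM h') (p : Pt true) := (pval (f v) : R) = tauR (pval p).
have f0 : f 0 = 0 by exact: lin0.
have t0 : tauR 0 = 0 by rewrite /tauR mulr0.
apply: (@iso_rel _ _ T).
- move=> r v p v' p' h1 h2; rewrite /T.
  have E : f (r *: v + v') = (tauR r : R) *: f v + f v'.
    rewrite -lf; congr (f (_ + _)).
    exact: (congr1 (fun A : 'M_(ldim M) => A *m (v : 'cV_(ldim M))) (PhiT r)).
  rewrite E; apply: etrans (_ : tauR r * (pval (f v) : R) + (pval (f v') : R) = _); first by [].
  by rewrite h1 h2 -tauRM -tauRD.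
- move=> v; have m : tauR' (pval (f v)) \in Pm true.
    by rewrite -[true]/(~~ false) -tauR_Pm tauR'K; exact: pvalP.
  by exists (PT m); rewrite /T /= tauR'K.
- move=> p; have m : tauR (pval p) \in Pm false by rewrite tauR_Pm; exact: pvalP.
  by exists (g (PT m)); rewrite /T gK.
- move=> p; rewrite /T f0 => /(congr1 tauR'); rewrite tauRK => e.
  apply: val_inj; rewrite /= -[LHS]e; rewrite /tauR' /=; apply: injective_projections => //=.
  exact: mulr0.
move=> v; rewrite /T -[pval 0]/(0 : R) t0 => e.
have fv : f v = 0 by apply: val_inj; exact: e.
by rewrite -[v]fK fv -f0 fK.
Qed.

Lemma rep_zero : is_rep G (zero_lat gT).
Proof. by split=> // g h _ _; rewrite /= mulmx1. Qed.
Fixpoint rep_free k : is_rep G (free_lat G k) :=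
  if k is k'.+1 then rep_dsum (rep_free k') rep_reg else rep_zero.
Definition Fr k : lmodType R := lmodM (rep_free k).
Lemma Fr_S k : iso (Fr k.+1) (Fr k * Ro)%type.
Proof.
apply: iso_trans (iso_dsum (rep_free k) rep_reg (rep_dsum (rep_free k) rep_reg)) _; apply: iso_prod; first exact: iso_refl.
exact: iso_reg.
Qed.
Lemma Fr_0 (V : lmodType R) : iso (V * Fr 0)%type V.
Proof.
exists fst, (fun v => (v, 0)); split.
- exact: lin_fst.
- by move=> r u v; rewrite scale_pair add_pair scaler0 addr0.
- by case=> v w; congr pair; apply/colP; case.
by [].
Qed.
Lemma Fr_prodS (V : lmodType R) k : iso (V * Fr k.+1)%type (V * Fr k * Ro)%type.
Proof. exact: iso_trans (iso_prod (iso_refl V) (Fr_S k)) (iso_prodA _ _ _). Qed.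

(** * Cancellation in the stable class of P *)

Lemma cancel_rank2 (M : lmodType R) k i : iso (M * Fr i)%type (Pt false * Fr (k.+1 + i))%type ->
  iso M (Pt false * Fr k * Ro)%type.
Proof.
elim: i => [|i IH] h.
  rewrite addn0 in h; apply: iso_trans (iso_sym (Fr_0 M)) _; apply: iso_trans h _.
  exact: Fr_prodS.
apply: IH; rewrite addnS in h.
have h1 : iso (M * Fr i * Ro)%type (Pt false * Fr (k + i) * Ro * Ro)%type.
  apply: iso_trans (iso_sym (Fr_prodS M i)) _; apply: iso_trans h _.
  apply: iso_trans (Fr_prodS _ _) _; apply: iso_prod; last exact: iso_refl.
  exact: Fr_prodS.
exact: iso_trans (cancel_free h1) (iso_sym (Fr_prodS _ _)).
Qed.

(** Free summands are stripped by [cancel_free] while P is accompanied by at least two of them; the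
    last one is the business of [rank_one], which is where the second class appears. *)
Lemma cancel_rank1 (M : lmodType R) i : iso (M * Fr i)%type (Pt false * Fr i)%type ->
  iso M (Pt false) \/ iso M (Pt true).
Proof.
elim: i => [|i IH] h.
  by left; apply: iso_trans (iso_sym (Fr_0 M)) _; apply: iso_trans h _; exact: Fr_0.
case: i IH h => [|i] IH h.
  apply: rank_one.
  apply: iso_trans (iso_prod (iso_sym (Fr_0 M)) (iso_refl Ro)) _.
  apply: iso_trans (iso_sym (Fr_prodS M 0)) _; apply: iso_trans h _.
  apply: iso_trans (Fr_prodS _ 0) _; apply: iso_prod; last exact: iso_refl.
  exact: Fr_0.
apply: IH.
have h1 : iso (M * Fr i.+1 * Ro)%type (Pt false * Fr i * Ro * Ro)%type.
  apply: iso_trans (iso_sym (Fr_prodS M i.+1)) _; apply: iso_trans h _.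
  apply: iso_trans (Fr_prodS _ _) _; apply: iso_prod; last exact: iso_refl.
  exact: Fr_prodS.
exact: iso_trans (cancel_free h1) (iso_sym (Fr_prodS _ _)).
Qed.

Lemma lat_iso_dim M N : lat_iso G M N -> ldim M = ldim N.
Proof.
have le m n (A : 'M[int]_(m, n)) B : A *m B = 1%:M -> (m <= n)%N.
  move=> /(congr1 (map_mx (intr : int -> rat))); rewrite map_mxM map_mx1 => e.
  rewrite -(mxrank1 rat m) -e; exact: leq_trans (mxrankM_maxl _ _) (rank_leq_col _).
by move=> [A [B [AB BA _]]]; apply/eqP; rewrite eqn_leq (le _ _ _ _ AB) (le _ _ _ _ BA).
Qed.
Lemma free_dim k : ldim (free_lat G k) = (28 * k)%N.
Proof. by elim: k => //= k ->; rewrite cG mulnS addnC. Qed.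

Lemma class_cases P (hP : is_rep G P) M (hM : is_rep G M) : ldim P = 28 ->
    iso (lmodM hP) (Pt false) -> in_stable_class G P M ->
  [\/ ldim M = 0, ldim M = 28 /\ (iso (lmodM hM) (Pt false) \/ iso (lmodM hM) (Pt true)) |
      exists k, ldim M = (28 * k.+2)%N /\ iso (lmodM hM) (Pt false * Fr k * Ro)%type].
Proof.
move=> dP iP [_ [i [j h]]].
have := lat_iso_dim h; rewrite /= !free_dim dP => dim.
move: h => /(lat_isoP (rep_dsum hM (rep_free i)) (rep_dsum hP (rep_free j))) h.
have {h} h : iso (lmodM hM * Fr i)%type (Pt false * Fr j)%type.
  apply: iso_trans (iso_sym (iso_dsum hM (rep_free i) (rep_dsum hM (rep_free i)))) _; apply: iso_trans h _.
  by apply: iso_trans (iso_dsum hP (rep_free j) (rep_dsum hP (rep_free j))) _; apply: iso_prod => //; exact: iso_refl.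
(* Comparing ranks, i > j leaves only rank 0 for M. This case is carried along, since two lattices
   of rank 0 are isomorphic. *)
have [ij|ij] := leqP i j; last by constructor 1; lia.
case E : (j - i)%N => [|k].
  have ej : j = i by lia.
  rewrite ej in h; constructor 2; split; first by lia.
  exact: cancel_rank1 h.
have ej : j = (k.+1 + i)%N by lia.
rewrite ej in h; constructor 3; exists k; split; first by lia.
exact: cancel_rank2 h.
Qed.

Lemma Fr_2 (V : lmodType R) : iso V (Ro * Ro)%type -> iso V (Fr 2).
Proof.
move=> h; apply: iso_trans h _; apply: iso_sym; apply: iso_trans (Fr_S 1) _.
apply: iso_prod; last exact: iso_refl.
apply: iso_trans (Fr_S 0) _; apply: iso_trans (iso_prodC _ _) _; exact: Fr_0.
Qed.

Lemma Q28_main : exists P : lattice gT,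
  [/\ projective G P, ~ has_cancellation G P & has_cancellation_mod_Aut G P].
Proof.
have [P [hP [dP iP]]] := P_lattice false; have [P' [hP' [dP' iP']]] := P_lattice true.
have pP : projective G P.
  split=> //; exists P'; split=> //; exists 2%N.
  apply/(lat_isoP (rep_dsum hP hP') (rep_free 2)); apply: Fr_2.
  apply: iso_trans (iso_dsum hP hP' (rep_dsum hP hP')) _.
  exact: iso_trans (iso_prod iP iP') P_sum_free.
have pP' : projective G P'.
  split=> //; exists P; split=> //; exists 2%N.
  apply/(lat_isoP (rep_dsum hP' hP) (rep_free 2)); apply: Fr_2.
  apply: iso_trans (iso_dsum hP' hP (rep_dsum hP' hP)) _; apply: iso_trans (iso_prodC _ _) _.
  exact: iso_trans (iso_prod iP iP') P_sum_free.
have stab : iso (lmodM hP * Ro)%type (lmodM hP' * Ro)%type.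
  apply: iso_trans (iso_prod iP (iso_refl _)) _; apply: iso_trans (iso_sym P_stably_iso) _.
  exact: iso_prod (iso_sym iP') (iso_refl _).
have cP : in_stable_class G P P by split=> //; exists 0%N, 0%N; exact: lat_iso_refl.
have cP' : in_stable_class G P P'.
  split=> //; exists 1%N, 1%N; apply/(lat_isoP (rep_dsum hP' (rep_free 1)) (rep_dsum hP (rep_free 1))).
  apply: iso_trans (iso_dsum hP' (rep_free 1) (rep_dsum hP' (rep_free 1))) _; apply: iso_trans (Fr_prodS _ 0) _.
  apply: iso_trans (iso_prod (Fr_0 _) (iso_refl _)) _; apply: iso_trans (iso_sym stab) _.
  apply: iso_trans _ (iso_sym (iso_dsum hP (rep_free 1) (rep_dsum hP (rep_free 1)))); apply: iso_trans _ (iso_sym (Fr_prodS _ 0)).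
  exact: iso_prod (iso_sym (Fr_0 _)) (iso_refl _).
exists P; split=> //.
  move=> hc; have : lat_iso G P P'.
    apply: hc => //; apply/(lat_isoP (rep_dsum hP rep_reg) (rep_dsum hP' rep_reg)).
    apply: iso_trans (iso_dsum hP rep_reg (rep_dsum hP rep_reg)) _; apply: iso_trans (iso_prod (iso_refl _) (iso_reg rep_reg)) _.
    apply: iso_trans stab _; apply: iso_trans _ (iso_sym (iso_dsum hP' rep_reg (rep_dsum hP' rep_reg))).
    exact: iso_prod (iso_refl _) (iso_sym (iso_reg rep_reg)).
  move=> /(lat_isoP hP hP') h; apply: P_not_iso.
  exact: iso_trans (iso_sym iP) (iso_trans h iP').
move=> P1 P2 c1 c2 h12.
have [[h1 _] _] := c1; have [[h2 _] _] := c2.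
have dim : ldim P1 = ldim P2 by have /= := lat_iso_dim h12; move/addIn.
have same V : iso (lmodM h1) V -> iso (lmodM h2) V ->
    exists2 th, th \in Aut G & lat_iso G (twist th P1) P2.
  move=> i1 i2; exists 1%g; first exact: group1.
  have /(lat_isoP h1 h2) [A [B [AB BA h]]] : iso (lmodM h1) (lmodM h2) by exact: iso_trans i1 (iso_sym i2).
  by exists A, B; split=> // g Gg; rewrite /= perm1 h.
have tw : iso (lmodM h1) (Pt false) -> iso (lmodM h2) (Pt true) ->
    exists2 th, th \in Aut G & lat_iso G (twist th P1) P2.
  move=> i1 i2; exists theta; first exact: theta_Aut.
  have ht := rep_twist theta_Aut h1; apply/(lat_isoP ht h2).
  exact: iso_trans (twist_P ht i1) (iso_sym i2).
have wt : iso (lmodM h1) (Pt true) -> iso (lmodM h2) (Pt false) ->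
    exists2 th, th \in Aut G & lat_iso G (twist th P1) P2.
  (* [twist_P] only leads from P to P', so it is applied to P2 and the isomorphism is then twisted
     back. *)
  move=> i1 i2; exists (theta^-1)%g; first by rewrite groupV theta_Aut.
  have ht := rep_twist theta_Aut h2.
  have /(lat_isoP h1 ht) [A [B [AB BA h]]] : iso (lmodM h1) (lmodM ht).
    exact: iso_trans i1 (iso_sym (twist_P ht i2)).
  exists A, B; split=> // g Gg /=; rewrite h /= ?permKV //.
  by rewrite Aut_closed // groupV theta_Aut.
have [d1|[d1 i1]|[k [d1 i1]]] := class_cases h1 dP iP c1;
  have [d2|[d2 i2]|[k' [d2 i2]]] := class_cases h2 dP iP c2; try by exfalso; lia.
- have z (N : lattice gT) (hN : is_rep G N) : ldim N = 0 -> iso (lmodM hN) (Fr 0).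
    move=> dN; apply: (@iso_rel _ _ (fun _ _ => True)) => //.
    + by move=> m; exists 0.
    + by move=> m; exists 0.
    + by move=> n _; apply/colP; case.
    by move=> m _; apply/colP=> -[i hi]; exfalso; rewrite dN in hi.
  by apply: (same (Fr 0)); exact: z.
- by case: i1 i2 => i1 [] i2; [exact: same i1 i2 | exact: tw | exact: wt | exact: same i1 i2].
have ek : k = k' by lia.
by rewrite -ek in i2; exact: same i1 i2.
Qed.
End Q28.

Local Close Scope ring_scope.

(* G is (a copy of) Q_28 = < x, y | x^7 = y^2, y x y^-1 = x^-1 >:
   generated by x, y satisfying the relations and of order 28. *)
Theorem theorem8p4 (gT : finGroupType) (G : {group gT}) (x y : gT) :
  (G :=: <<[set x; y]>>)%g ->
  (x ^+ 7 = y ^+ 2)%g ->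
  (y * x * y^-1 = x^-1)%g ->
  #|G| = 28 ->
  exists P : lattice gT,
    [/\ projective G P, ~ has_cancellation G P & has_cancellation_mod_Aut G P].
Proof. by move=> HG h7 hyx cG; exact: Q28_main HG h7 hyx cG. Qed.
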